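(* Let $d>0$ be fixed and for $\beta\in\mathbb{R}\setminus\{0\}$ let $\alpha_{\mathrm{crit}}(\beta)\in(0,\tfrac12)$ be the critical flux value. Then $$\alpha_{\mathrm{crit}}(\beta)\to \tfrac12-\quad\text{as }\beta\to+\infty\text{ and as }\beta\to-\infty,$$ and $$\alpha_{\mathrm{crit}}(\beta)\to 0+\quad\text{as }\beta\to0,$$ where $\pm$ after the limit value indicates that the limit is approached from above, respectively from below.
   Context: Fix $d>0$. Let $x_n=d(n+\tfrac12)$, $n\in\mathbb{Z}$, and for $\beta\in\mathbb{R}\setminus\{0\}$ let $\mathrm{h}_\beta$ be the operator in $L^2(\mathbb{R})$ acting as $f\mapsto -f''$ on continuous $f\in W^{2,2}(\mathbb{R}\setminus\{x_n\}_{n\in\mathbb{Z}})$ with $f'(x_n^+)-f'(x_n^-)=\beta f(x_n)$ for all $n\in\mathbb{Z}$. Put $E_0=E_0(\beta):=\inf\sigma(\mathrm{h}_\beta)$. Let $u=u_\beta$ be the (nontrivial, nowhere vanishing, unique up to a constant multiple) real-valued $d$-periodic generalized solution of $\mathrm{h}_\beta u=E_0u$, i.e. $u$ is continuous on $\mathbb{R}$, $-u''=E_0u$ away from the $x_n$, and $u'(x_n^+)-u'(x_n^-)=\beta u(x_n)$ for all $n\in\mathbb{Z}$. Put $$c_{\mathrm{crit}}(\beta):=-\frac14\left(\frac1d\int_0^d\frac{1}{u^2}\,dx\right)^{-1}\left(\frac1d\int_0^d u^2\,dx\right)^{-1},\qquad \alpha_{\mathrm{crit}}(\beta):=\sqrt{c_{\mathrm{crit}}(\beta)+\tfrac14}.$$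 The role of this number is as follows. With $r_n=d(n+\tfrac12)$, $n=0,1,\dots$, let $H_{\alpha;\beta}$, $\alpha\in(0,\tfrac12)$, be the self-adjoint Hamiltonian in $L^2(\mathbb{R}^2)$ with a pure Aharonov-Bohm flux $\alpha$ (in units of the flux quantum) at the origin and $\delta$ interactions of strength $\beta$ on the circles of radii $r_n$ centered at the origin; its essential spectrum is $[E_0,\infty)$. Then $\alpha_{\mathrm{crit}}(\beta)$ is the value for which the discrete spectrum of $H_{\alpha;\beta}$ below $E_0$ is infinite and accumulates at $E_0$ when $\alpha\in(0,\alpha_{\mathrm{crit}}(\beta))$, and is finite when $\alpha\in[\alpha_{\mathrm{crit}}(\beta),\tfrac12)$. *)

(* Defs.v *)
From HB Require Import structures.
From mathcomp Require Import all_boot all_order all_algebra.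
From mathcomp Require Import all_classical all_reals all_analysis.
From mathcomp Require Import complex.

Set Implicit Arguments.
Unset Strict Implicit.
Unset Printing Implicit Defensive.

Import Order.TTheory GRing.Theory Num.Theory.
Import numFieldNormedType.Exports.

Local Open Scope ring_scope.
Local Open Scope complex_scope.
Local Open Scope classical_set_scope.

Section ComplexL2.
Context {R : realType}.
Implicit Types F G H : R -> R[i].

(* Elements of the complex Hilbert space L^2(R) are represented by functions,
   with equality almost everywhere written out where it is needed. *)
Definition inL2 F : Prop :=
  ((fun x => complex.Re (F x)) \in Lfun (@lebesgue_measure R) 2%:E) /\
  ((fun x => complex.Im (F x)) \in Lfun (@lebesgue_measure R) 2%:E).

Definition normL2 F : \bar R :=
  'N[@lebesgue_measure R]_2%:E[EFin \o (@Normc.normc R \o F)].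

(* An unbounded operator A in L^2(R) is given by its graph: A F G means that
   F lies in the domain of A and that A F = G in L^2(R).
   The number z is in the resolvent set when A - z is a bijection from the
   domain of A onto L^2(R) with a bounded inverse. *)
Definition resolvent_set (A : (R -> R[i]) -> (R -> R[i]) -> Prop) : set R[i] :=
  [set z |
    (forall F G, A F G ->
      {ae @lebesgue_measure R, forall x, G x - z * F x = 0} ->
      {ae @lebesgue_measure R, forall x, F x = 0}) /\
    exists M : R, forall H, inL2 H -> exists F G,
      [/\ A F G,
          {ae @lebesgue_measure R, forall x, G x - z * F x = H x} &
          (normL2 F <= M%:E * normL2 H)%E]].

Definition spectrum (A : (R -> R[i]) -> (R -> R[i]) -> Prop) : set R[i] :=
  ~` resolvent_set A.

End ComplexL2.

Section Sobolev.
Context {R : realType}.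

(* C_c^infty(U), the functions being extended by zero to the whole line. *)
Definition test_function (U : set R) (phi : R -> R) : Prop :=
  (forall n x, derivable (derive1n n phi) x 1) /\
  exists K : set R, [/\ compact K, K `<=` U & forall x, ~ K x -> phi x = 0].

Definition weak_derivative (U : set R) (f g : R -> R) : Prop :=
  forall phi, test_function U phi ->
    \int[@lebesgue_measure R]_x (f x * derive1 phi x) =
    - \int[@lebesgue_measure R]_x (g x * phi x).

Definition cweak_derivative (U : set R) (F G : R -> R[i]) : Prop :=
  weak_derivative U (fun x => complex.Re (F x)) (fun x => complex.Re (G x)) /\
  weak_derivative U (fun x => complex.Im (F x)) (fun x => complex.Im (G x)).

(* F is in W^{2,2}(U), with second weak derivative F2; U is meant to have a
   Lebesgue-null complement, so that L^2(U) = L^2(R). *)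
Definition W22 (U : set R) (F F2 : R -> R[i]) : Prop :=
  exists F1, [/\ inL2 F, inL2 F1, inL2 F2,
                 cweak_derivative U F F1 & cweak_derivative U F1 F2].

End Sobolev.

Section DeltaComb.
Context {R : realType}.
Implicit Types (d beta : R).

Definition node d (n : int) : R := d * (n%:~R + 2^-1).

Definition off_nodes d : set R := ~` range (node d).

(* f'(x+) - f'(x-) = b, both one-sided limits existing. *)
Definition derivative_jump (f : R -> R) (x b : R) : Prop :=
  exists l r : R,
    [/\ derive1 f y @[y --> x^'-] --> l, derive1 f y @[y --> x^'+] --> r & r - l = b].

(* The graph of h_beta. A continuous F in W^{2,2} off the nodes is C^1 off the
   nodes, so its traces F'(x_n^+), F'(x_n^-) are limits of the classical
   derivative. *)
Definition h_op d beta (F G : R -> R[i]) : Prop :=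
  [/\ continuous (fun x => complex.Re (F x)),
      continuous (fun x => complex.Im (F x)),
      W22 (off_nodes d) F (fun x => - G x) &
      forall n : int,
        derivative_jump (fun x => complex.Re (F x)) (node d n)
          (beta * complex.Re (F (node d n))) /\
        derivative_jump (fun x => complex.Im (F x)) (node d n)
          (beta * complex.Im (F (node d n)))].

(* h_beta is self-adjoint, so its spectrum consists of real numbers. *)
Definition E0 d beta : R :=
  inf [set lambda : R | spectrum (h_op d beta) lambda%:C].

Definition periodic_solution d beta (u : R -> R) : Prop :=
  [/\ continuous u,
      exists x, u x != 0,
      forall x, u (x + d) = u x,
      forall x, off_nodes d x ->
        [/\ derivable u x 1, derivable (derive1 u) x 1 &
            - derive1n 2 u x = E0 d beta * u x] &
      forall n : int, derivative_jump u (node d n) (beta * u (node d n))].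

(* periodic_solution determines u up to a nonzero constant factor, which does
   not affect c_crit below. *)
Definition u_sol d beta : R -> R := [get u | periodic_solution d beta u].

Definition c_crit d beta : R :=
  - 4^-1 *
  (d^-1 * \int[@lebesgue_measure R]_(x in `[0, d]) (u_sol d beta x ^+ 2)^-1)^-1 *
  (d^-1 * \int[@lebesgue_measure R]_(x in `[0, d]) (u_sol d beta x ^+ 2))^-1.

Definition alpha_crit d beta : R := Num.sqrt (c_crit d beta + 4^-1).

End DeltaComb.

(* Main.v *)
(* Let c, s be the even and odd solutions of -f'' = lam f with c(0) = 1, s'(0) = 1, let
   h = d / 2, and write C, S for their values at h. The function equal to c(x - n d) on the
   n-th cell satisfies the jump conditions iff beta C = 2 lam S; this equation has a
   solution lam < (pi / d)^2 for which c > 0 on [-h, h].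

   This lam is E_0(beta). Indeed, for smaller lam a Sturm comparison produces a positive
   generalized solution psi decaying geometrically to the right; factorizing
   h_beta - lam through psi inverts it by two one-sided integrals, bounded on L^2 by Schur's
   test, so lam is in the resolvent set. At lam itself the bounded ground state u obstructs
   solvability for the right-hand side u 1_I, I one cell.

   Then u is explicit, \int_0^h c^2 = (h + S C) / 2 and \int_0^h c^-2 = S / C, so that
   alpha_crit = sqrt ((1 - 1 / q) / 4) with q = S / (2 h C) + S^2 / (2 h^2). Cauchy-Schwarz
   gives q > 1, while q -> 1 as beta -> 0 and q -> +oo as beta -> +oo or -oo follow from
   elementary bounds on c and s. *)

Require Import Defs.
From mathcomp Require Import all_boot all_order all_algebra.
From mathcomp Require Import all_classical all_reals all_analysis.
From mathcomp Require Import measurable_realfun complex zify ring lra.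
Set Implicit Arguments.
Unset Strict Implicit.
Import Order.TTheory GRing.Theory Num.Theory.
Import numFieldNormedType.Exports.
Local Open Scope classical_set_scope.
Local Open Scope ring_scope.

(** * Calculus on the line *)

(** [E0] is the infimum of a spectrum defined directly from the graph of the operator, so both
    inclusions are argued on functions whose derivatives are only weak. The tool is the Wronskian
    psi f' - psi' f of a domain element f with an explicit positive solution psi: it is absolutely
    continuous in each cell, and since both functions satisfy the same delta condition its one-sided
    limits at each node agree. Mollification and primitives serve to justify this identity for weak
    derivatives and, conversely, to place the constructed solution in the domain. Decay of psi in
    one direction is enough for the resolvent: both integrals of the factorization have kernels of
    the form psi (t) / psi (x) with x <= t, up to exchange of the variables. Sturm comparison
    supplies psi because the two quantities whose positivity puts the Floquet multiplier in (0, 1)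
    become, after multiplication by the value of c at the ground level, twice the compared
    expressions. As [u_sol] is an arbitrary choice, the periodic solution must also be shown unique
    up to a factor before [c_crit] can be computed. *)

Section DerivativeRules.
Context {R : realType}.
Implicit Types (f g : R -> R) (x a b : R).

Lemma is_derive1D f g x a b : is_derive x 1 f a -> is_derive x 1 g b ->
  is_derive x 1 (fun t => f t + g t) (a + b).
Proof. move=> fa gb; exact: is_deriveD. Qed.

Lemma is_derive1N f x a : is_derive x 1 f a -> is_derive x 1 (fun t => - f t) (- a).
Proof. move=> fa; exact: is_deriveN. Qed.

Lemma is_derive1B f g x a b : is_derive x 1 f a -> is_derive x 1 g b ->
  is_derive x 1 (fun t => f t - g t) (a - b).
Proof. move=> fa gb; exact: is_deriveB. Qed.

Lemma is_derive1M f g x a b : is_derive x 1 f a -> is_derive x 1 g b ->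
  is_derive x 1 (fun t => f t * g t) (a * g x + f x * b).
Proof.
move=> fa gb; have fg := is_deriveM fa gb; apply: (trigger_derive fg).
by rewrite /GRing.scale/= addrC [a * _]mulrC.
Qed.

Lemma is_derive1V f x a : f x != 0 -> is_derive x 1 f a ->
  is_derive x 1 (fun t => (f t)^-1) (- a / f x ^+ 2).
Proof.
move=> fx fa; have fV := is_deriveV fx fa; apply: (trigger_derive fV).
by rewrite /GRing.scale/= mulNr mulrC mulNr.
Qed.

Lemma is_derive1X f x a n : is_derive x 1 f a ->
  is_derive x 1 (fun t => f t ^+ n) (n%:R * f x ^+ n.-1 * a).
Proof.
move=> fa; rewrite (_ : (fun t => _) = f ^+ n); last by apply/funext => t; rewrite exprfctE.
by have H := @is_deriveX _ _ f n x 1 a fa; apply: (trigger_derive H).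
Qed.

Lemma is_derive1_div f g x a b : g x != 0 ->
  is_derive x 1 f a -> is_derive x 1 g b ->
  is_derive x 1 (fun t => f t / g t) ((a * g x - f x * b) / g x ^+ 2).
Proof.
move=> gx fa gb; apply: (trigger_derive (is_derive1M fa (is_derive1V gx gb))).
by field.
Qed.

Lemma is_derive1_scale f x a c : is_derive x 1 f a ->
  is_derive x 1 (fun t => c * f t) (c * a).
Proof. move=> fa; exact: (@is_deriveZ _ _ _ f c). Qed.

Lemma is_derive1_cst x (k : R) : is_derive x 1 (fun=> k) 0.
Proof. exact: is_derive_cst. Qed.

Lemma is_derive1_affine x (p q : R) : is_derive x 1 (fun t => p * t + q) p.
Proof.
have D := is_derive1D (is_derive1_scale p (is_derive_id x 1)) (is_derive1_cst x q).
by apply: (trigger_derive D); rewrite mulr1 addr0.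
Qed.

Lemma is_derive1_comp_affine f x a (p q : R) : is_derive (p * x + q) 1 f a ->
  is_derive x 1 (fun t => f (p * t + q)) (p * a).
Proof.
move=> fa; rewrite mulrC.
exact: (@is_derive1_comp _ f (fun t => p * t + q) x a p fa (is_derive1_affine x p q)).
Qed.

Lemma is_derive1_comp_subr f x a (q : R) : is_derive (x - q) 1 f a ->
  is_derive x 1 (fun t => f (t - q)) a.
Proof.
move=> fa; have := @is_derive1_comp_affine f x a 1 (- q).
rewrite !mul1r => /(_ fa).
by rewrite (_ : (fun t => f (1 * t - q)) = fun t => f (t - q))//;
  apply/funext => t; rewrite mul1r.
Qed.

Lemma is_derive1_continuous f x a : is_derive x 1 f a -> {for x, continuous f}.
Proof. by move=> [fa _]; exact/differentiable_continuous/derivable1_diffP. Qed.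

Lemma is_derive1E f x a : is_derive x 1 f a -> (derive1 f) x = a.
Proof. by move=> [_ <-]; rewrite derive1E. Qed.

Lemma derivable1_is_derive f x : derivable f x 1 -> is_derive x 1 f (derive1 f x).
Proof. by move=> fx; split=> //; rewrite derive1E. Qed.

Lemma near_gt a x : a < x -> \forall z \near x, a < z.
Proof. exact: lt_nbhsr. Qed.

Lemma near_lt x b : x < b -> \forall z \near x, z < b.
Proof. exact: lt_nbhsl. Qed.

Lemma is_derive1_near f g x a : (\forall z \near x, f z = g z) ->
  is_derive x 1 f a -> is_derive x 1 g a.
Proof. exact: near_eq_is_derive. Qed.

Lemma MVT_le f df a b : a <= b -> (forall x, is_derive x 1 f (df x)) ->
  exists2 c, a <= c <= b & f b - f a = df c * (b - a).
Proof.
move=> ab fdf; have [] := @MVT_segment R f df a b ab.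
- by apply: continuous_subspaceT => x; exact: is_derive1_continuous (fdf x).
- by move=> c; rewrite in_itv/= => cab fab; exists c.
Qed.

Lemma MVT_lt f df a b : a < b -> (forall x, is_derive x 1 f (df x)) ->
  exists2 c, a < c < b & f b - f a = df c * (b - a).
Proof.
move=> ab fdf; have [] := @MVT R f df a b ab.
- by apply: continuous_subspaceT => x; exact: is_derive1_continuous (fdf x).
- by move=> c; rewrite in_itv/= => cab fab; exists c.
Qed.

(** The difference quotient at x is at most C |z - x|, so the slope function set to 0 at x is
    continuous there. This handles the point where [exp_inv] is glued to zero. *)
Lemma is_derive1_flat f x C : (\forall z \near x, `|f z| <= C * (z - x) ^+ 2) ->
  is_derive x 1 f 0.
Proof.
move=> fC.
have C0 : f x = 0.
  by have := nbhs_singleton fC; rewrite subrr expr0n/= mulr0 normr_le0 => /eqP.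
apply/is_derive1_caratheodory.
exists (fun z => if z == x then 0 else f z / (z - x)); split => //=.
- move=> z; case: eqP => [->|/eqP zx]; first by rewrite !subrr mulr0.
  by rewrite divfK ?subr_eq0// C0 subr0.
- apply/cvgrPdist_le => /= e e0; rewrite eqxx.
  near=> z; case: eqP => [_|/eqP zx]; first by rewrite subrr normr0 ltW.
  rewrite sub0r normrN normrM normfV ler_pdivrMr ?normr_gt0 ?subr_eq0//.
  apply: (@le_trans _ _ (C * (z - x) ^+ 2)); first by near: z.
  rewrite -real_normK ?num_real// expr2 mulrA ler_wpM2r//.
  (* The sign of [C] is not assumed; |C| + 1 is a majorant by which one can divide. *)
  apply: (@le_trans _ _ ((`|C| + 1) * `|z - x|)).
    by rewrite ler_wpM2r// (le_trans (ler_norm _))// lerDl.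
  rewrite mulrC -ler_pdivlMr ?ltr_wpDl//; near: z.
  have e0' : 0 < e / (`|C| + 1) by rewrite divr_gt0// ltr_wpDl.
  apply: filterS (nbhsx_ballx x _ e0') => z.
  by rewrite /ball/= distrC => /ltW.
- by rewrite eqxx.
Unshelve. all: by end_near. Qed.

End DerivativeRules.

(** * Smooth functions and a compactly supported bump *)

Section SmoothFunctions.
Context {R : realType}.
Implicit Types (f g : R -> R) (A : set (R -> R)).

(** Same form as the first clause of [test_function], so a proof of one is a proof of the other. *)
Definition smooth f := forall n x, derivable (derive1n n f) x 1.

(** Iterated derivatives never have to be computed: it is enough to exhibit a class that contains f
    and is stable under differentiation. *)
Lemma smooth_closed A :
  (forall f, A f -> (forall x, derivable f x 1) /\ A (derive1 f)) ->
  forall f, A f -> smooth f.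
Proof.
move=> AA f Af n; suff : A (derive1n n f) by case/AA.
by elim: n => [//|n /AA[_]]; rewrite derive1nS.
Qed.

Lemma smoothP f : smooth f <-> (forall x, derivable f x 1) /\ smooth (derive1 f).
Proof.
split=> [sf|[df sf] [//|n] x]; last by rewrite derive1Sn; exact: sf.
by split=> [|n x]; [exact: (sf 0%N)|rewrite -derive1Sn; exact: sf].
Qed.

Lemma smooth_derivable {f} : smooth f -> forall x, derivable f x 1.
Proof. by move=> /(_ 0%N). Qed.

Lemma smooth_derive {f} : smooth f -> smooth (derive1 f).
Proof. by case/smoothP. Qed.

Lemma smooth_continuous {f} : smooth f -> continuous f.
Proof.
by move=> /smooth_derivable df x; exact/differentiable_continuous/derivable1_diffP.
Qed.

Lemma smoothB f g : smooth f -> smooth g -> smooth (fun x => f x - g x).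
Proof.
move=> sf sg; apply: (@smooth_closed [set h | exists f g,
  [/\ smooth f, smooth g & h = fun x => f x - g x]]); last by exists f, g.
move=> _ [{sf sg}f [{}g [sf sg ->]]].
have D (x : R) : is_derive x 1 (fun x => f x - g x) ((derive1 f) x - (derive1 g) x).
  by apply: is_derive1B; apply: derivable1_is_derive; exact: smooth_derivable.
split=> [x|]; first by case: (D x).
exists (derive1 f), (derive1 g); split; [exact: smooth_derive..|].
by apply/funext => x; exact: is_derive1E.
Qed.

Lemma smooth_affine f (c p q : R) : smooth f -> smooth (fun x => c * f (p * x + q)).
Proof.
move=> sf; apply: (@smooth_closed [set h | exists f c,
  smooth f /\ h = fun x => c * f (p * x + q)]); last by exists f, c.
move=> _ [{sf}f [{}c [sf ->]]].
have D (x : R) : is_derive x 1 (fun x => c * f (p * x + q)) (c * p * (derive1 f) (p * x + q)).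
  rewrite -mulrA; apply: is_derive1_scale; apply: is_derive1_comp_affine.
  by apply: derivable1_is_derive; exact: smooth_derivable.
split=> [x|]; first by case: (D x).
exists (derive1 f), (c * p); split; first exact: smooth_derive.
by apply/funext => x; exact: is_derive1E.
Qed.

(** The negative powers y^-k are included because differentiating e^(-1/y) produces them; the family
    is closed under differentiation up to linear combinations. *)
Definition exp_inv k (y : R) : R := if 0 < y then y^-1 ^+ k * expR (- y^-1) else 0.

(** Raise z / n <= e^(z / n) to the n-th power. *)
Lemma exprn_le_expR (n : nat) (z : R) : 0 <= z -> z ^+ n <= n%:R ^+ n * expR z.
Proof.
move=> z0; have [->|n0] := posnP n; first by rewrite !expr0 mul1r -expR0 ler_expR.
have -> : z = n%:R * (z / n%:R) by rewrite mulrCA divff ?mulr1// pnatr_eq0 -lt0n.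
rewrite exprMn expRM_natl ler_wpM2l ?exprn_ge0//.
rewrite lerXn2r ?nnegrE ?divr_ge0 ?expR_ge0//.
by apply: le_trans (expR_ge1Dx _); rewrite lerDr.
Qed.

(** The preceding bound at z = 1 / y with exponent k + 2: two of the powers give the factor y^2
    required by [is_derive1_flat]. *)
Lemma exp_inv_le k y : `|exp_inv k y| <= k.+2%:R ^+ k.+2 * y ^+ 2.
Proof.
rewrite /exp_inv; case: ifPn => y0; last by rewrite normr0 mulr_ge0 ?sqr_ge0 ?exprn_ge0.
have Y0 : 0 <= y^-1 by rewrite invr_ge0 ltW.
rewrite ger0_norm ?mulr_ge0 ?expR_ge0 ?exprn_ge0// expRN.
rewrite ler_pdivrMr ?expR_gt0// mulrAC -ler_pdivrMr ?exprn_gt0//.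
by rewrite -exprVn -exprD addn2 exprn_le_expR.
Qed.

Lemma is_derive_exp_inv k (y : R) :
  is_derive y 1 (exp_inv k) (exp_inv k.+2 y - k%:R * exp_inv k.+1 y).
Proof.
have [y0|y0|<-] := ltgtP 0 y; last 1 first.
- rewrite {2 3}/exp_inv ltxx mulr0 subr0.
  apply: (@is_derive1_flat _ _ _ (k.+2%:R ^+ k.+2)).
  by near=> z; rewrite subr0 exp_inv_le.
- apply: (@is_derive1_near _ (fun z => z^-1 ^+ k * expR (- z^-1))).
    by near=> z; rewrite /exp_inv ifT//; near: z; exact: near_gt.
  have yn0 : y != 0 by rewrite gt_eqF.
  have DV : is_derive y 1 (fun z : R => z^-1) (- 1 / y ^+ 2).
    by apply: is_derive1V => //; exact: is_derive_id.
  have DX : is_derive y 1 (fun z : R => z^-1 ^+ k) (k%:R * y^-1 ^+ k.-1 * (- 1 / y ^+ 2)).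
    exact: is_derive1X.
  have DE : is_derive y 1 (fun z : R => expR (- z^-1)) (expR (- y^-1) * - (- 1 / y ^+ 2)).
    exact: (@is_derive1_comp _ expR (fun z => - z^-1) y _ _ (is_derive_expR _) (is_derive1N DV)).
  apply: (trigger_derive (is_derive1M DX DE)).
  rewrite /exp_inv y0.
  case: k {DX} => [|k]; first by rewrite expr0 !mul0r !expr2; field.
  by rewrite -exprVn !exprS /=; field.
- apply: (@is_derive1_near _ (fun=> 0)).
    near=> z; rewrite /exp_inv ifF//; apply/negbTE; rewrite -leNgt ltW//; near: z.
    exact: near_lt.
  rewrite /exp_inv ltNge (ltW y0)/= mulr0 subr0; exact: is_derive1_cst.
Unshelve. all: by end_near. Qed.

Lemma exp_invS k (y : R) : y * exp_inv k.+1 y = exp_inv k y.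
Proof.
rewrite /exp_inv; case: ifPn => y0; last by rewrite mulr0.
by rewrite exprS !mulrA divff ?mul1r// gt_eqF.
Qed.

Definition bump (t : R) : R := exp_inv 0 (t * (1 - t)).

(** Derivatives of the bump stay in the class of polynomials times [exp_inv k] at q (t) = t (1 - t):
    by [exp_invS] a factor q lowers the index by one, so all terms can be brought to the index k +
    2. *)
Lemma smooth_bump : smooth bump.
Proof.
pose q : {poly R} := 'X * (1 - 'X).
have qE t : q.[t] = t * (1 - t) by rewrite /q !hornerE.
apply: (@smooth_closed [set h | exists (p : {poly R}) k,
  h = fun t => p.[t] * exp_inv k q.[t]]); last first.
  by exists 1, 0%N; apply/funext => t; rewrite hornerE mul1r qE.
move=> _ [p [k ->]].
pose r := p^`() * q ^+ 2 + p * q^`() - k%:R *: (p * q^`() * q).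
have D (t : R) : is_derive t 1 (fun t => p.[t] * exp_inv k q.[t])
    (r.[t] * exp_inv k.+2 q.[t]).
  have DE := @is_derive1_comp _ (exp_inv k) (horner q) t _ _
    (is_derive_exp_inv k q.[t]) (is_derive_poly q t).
  apply: (trigger_derive (is_derive1M (is_derive_poly p t) DE)).
  rewrite /= -(exp_invS k) -(exp_invS k.+1) /r !(hornerD, hornerN, hornerM, hornerZ, horner_exp); ring.
split=> [x|]; first by case: (D x).
by exists r, k.+2; apply/funext => x; exact: is_derive1E.
Qed.

Lemma bump_ge0 t : 0 <= bump t.
Proof. by rewrite /bump /exp_inv; case: ifP => // _; rewrite mul1r expR_ge0. Qed.

Lemma bump_gt0 t : 0 < t < 1 -> 0 < bump t.
Proof.
move=> /andP[t0 t1].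
by rewrite /bump /exp_inv mulr_gt0 ?subr_gt0// mul1r expR_gt0.
Qed.

Lemma bump_eq0 t : ~~ (0 < t < 1) -> bump t = 0.
Proof.
move=> t01; rewrite /bump /exp_inv ifF//; apply: contraNF t01 => t01.
have [t0|t0] := leP t 0; last by move: t01; rewrite pmulr_rgt0// subr_gt0.
by move: t01; rewrite ltNge mulr_le0_ge0// subr_ge0 (le_trans t0).
Qed.

Lemma continuous_bump : continuous bump.
Proof. exact: smooth_continuous smooth_bump. Qed.

End SmoothFunctions.

Section ContinuousIntegrable.
Context {R : realType}.
Notation mu := (@lebesgue_measure R).
Implicit Types (f g : R -> R) (a b : R).

Lemma continuous_integrable f a b : continuous f ->
  mu.-integrable `[a, b] (EFin \o f).
Proof.
move=> cf; apply: continuous_compact_integrable; first exact: segment_compact.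
exact: continuous_subspaceT.
Qed.

Lemma integrable_supp f a b : (forall x, ~~ (a <= x <= b) -> f x = 0) ->
  mu.-integrable `[a, b] (EFin \o f) -> mu.-integrable setT (EFin \o f).
Proof.
move=> f0 /(@integrable_mkcond _ _ _ mu _ (EFin \o f) (measurable_itv _)).1.
apply: eq_integrable => // x _; rewrite patchE; case: ifPn => //.
by rewrite notin_setE/= in_itv/= => /negP /f0 ->.
Qed.

Lemma continuous_supp_integrable f a b : continuous f ->
  (forall x, ~~ (a <= x <= b) -> f x = 0) -> mu.-integrable setT (EFin \o f).
Proof. by move=> cf f0; apply: integrable_supp f0 _; exact: continuous_integrable. Qed.

Lemma Rintegral_supp f a b : (forall x, ~~ (a <= x <= b) -> f x = 0) ->
  \int[mu]_x f x = \int[mu]_(x in `[a, b]) f x.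
Proof.
move=> f0; rewrite [RHS]Rintegral_mkcond; apply: eq_Rintegral => x _.
rewrite patchE; case: ifPn => //.
by rewrite notin_setE/= in_itv/= => /negP /f0 ->.
Qed.

Lemma Rintegral_derive f g a b : a <= b -> (forall x : R, is_derive x 1 f (g x)) ->
  continuous g -> \int[mu]_(x in `[a, b]) g x = f b - f a.
Proof.
rewrite le_eqVlt => /predU1P[<-|ab] fg cg.
  by rewrite set_itv1 Rintegral_set1 subrr.
have cf : continuous f by move=> x; exact: is_derive1_continuous (fg x).
rewrite /Rintegral (@continuous_FTC2 _ g f a b ab)//.
- exact: continuous_subspaceT.
- split; [by move=> x _; case: (fg x)| |].
    exact/cvg_at_right_filter/cf.
  exact/cvg_at_left_filter/cf.
- by move=> x _; exact: is_derive1E.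
Qed.

End ContinuousIntegrable.

(** * A smooth step function *)

Section SmoothStep.
Context {R : realType}.
Notation mu := (@lebesgue_measure R).

Lemma bump_integrable : mu.-integrable setT (EFin \o (@bump R)).
Proof.
apply: (@continuous_supp_integrable _ _ 0 1); first exact: continuous_bump.
by move=> x x01; apply: bump_eq0; apply: contraNN x01 => /andP[/ltW -> /ltW ->].
Qed.

Let F (x : R) : R := \int[mu]_(t in `]-oo, x]) bump t.

Let FE (x : R) : is_derive x 1 F (bump x).
Proof.
have [] := @continuous_FTC1 R bump -oo%O x (x + 1).
- by rewrite ltrDl.
- by apply: integrableS bump_integrable.
- by rewrite ltNyr.
- exact: continuous_bump.
- by move=> dF <-; exact: derivable1_is_derive.
Qed.

Let F0 x : x <= 0 -> F x = 0.
Proof.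
move=> x0; rewrite /F (@eq_Rintegral _ _ _ _ _ (fun=> 0)) ?Rintegral_cst ?mul0r//.
move=> t; rewrite inE/= in_itv/= => tx; apply: bump_eq0.
by rewrite ltNge (le_trans tx x0).
Qed.

Let F1 x : 1 <= x -> F x = F 1.
Proof.
move=> x1; have [c /andP[c1 _]] := MVT_le x1 FE.
rewrite bump_eq0 ?mul0r; first by move/eqP; rewrite subr_eq0 => /eqP.
by rewrite [c < 1]ltNge c1 andbF.
Qed.

Let F1_gt0 : 0 < F 1.
Proof.
have [c c01] := MVT_lt ltr01 FE.
by rewrite (F0 (lexx _)) !subr0 mulr1 => ->; exact: bump_gt0.
Qed.

(** [s] is the normalised primitive of the bump. Differences of rescaled copies of [s] will be test
    functions, and rescaled copies of [r] one-sided mollifiers, whose error estimate uses the upper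
    bound on [r]. *)
Lemma smooth_step : exists s r : R -> R,
  [/\ [/\ smooth s, smooth r & forall x : R, is_derive x 1 s (r x)],
      [/\ forall x, 0 <= r x, forall x, ~~ (0 < x < 1) -> r x = 0 &
        exists M, forall x, r x <= M] &
      [/\ forall x, x <= 0 -> s x = 0, forall x, 1 <= x -> s x = 1 &
        forall x, 0 <= s x <= 1]].
Proof.
exists (fun x => (F 1)^-1 * F x), (fun x => (F 1)^-1 * bump x).
have sr (x : R) : is_derive x 1 (fun x => (F 1)^-1 * F x) ((F 1)^-1 * bump x).
  exact: is_derive1_scale.
have smr : smooth (fun x : R => (F 1)^-1 * bump x).
  have := @smooth_affine R bump (F 1)^-1 1 0 smooth_bump.
  by under eq_fun do rewrite mul1r addr0.
have r0 x : 0 <= (F 1)^-1 * bump x by rewrite mulr_ge0 ?bump_ge0// invr_ge0 ltW// F1_gt0.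
have s0 (x : R) : x <= 0 -> (F 1)^-1 * F x = 0 by move=> /F0 ->; rewrite mulr0.
have s1 x : 1 <= x -> (F 1)^-1 * F x = 1 by move=> /F1 ->; rewrite mulVf ?gt_eqF.
have ndecr (x y : R) : x <= y -> (F 1)^-1 * F x <= (F 1)^-1 * F y.
  by move=> xy; have [c _] := MVT_le xy sr; rewrite -subr_ge0 => ->;
    rewrite mulr_ge0// subr_ge0.
split; split => //.
- apply/smoothP; split=> [x|]; first by case: (sr x).
  by rewrite (_ : derive1 _ = fun x => (F 1)^-1 * bump x)//; apply/funext => x;
    exact: is_derive1E.
- by move=> x x01; rewrite bump_eq0// mulr0.
- have [c _ cmax] : exists2 c, c \in `[0:R, 1]%R & forall t, t \in `[0:R, 1]%R -> bump t <= bump c.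
    by apply: EVT_max => //; exact: continuous_subspaceT continuous_bump.
  exists ((F 1)^-1 * bump c) => x; have [x01|x01] := boolP (0 < x < 1); last first.
    by rewrite (bump_eq0 x01) mulr0.
  rewrite ler_wpM2l ?invr_ge0 ?(ltW F1_gt0)// cmax// in_itv/=.
  by case/andP: x01 => /ltW -> /ltW ->.
- move=> x; apply/andP; split.
    by have [/s0->//|/ltW x0] := leP x 0; rewrite -(s0 0)// ndecr.
  by have [/s1->//|/ltW x0] := leP 1 x; rewrite -[leRHS](s1 _ (lexx 1)) ndecr.
Qed.

End SmoothStep.

(** * Integrals over segments and Lebesgue points *)

Section SegmentIntegral.
Context {R : realType}.
Notation mu := (@lebesgue_measure R).
Implicit Types (f g h : R -> R) (a b c x y : R).
Local Notation intb f a b := (mu.-integrable `[a, b] (EFin \o f)).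

Lemma integrable_segmentD f g a b : intb f a b -> intb g a b ->
  intb (fun t => f t + g t) a b.
Proof. move=> fi gi; exact: (integrableD _ fi gi). Qed.

Lemma integrable_segmentB f g a b : intb f a b -> intb g a b ->
  intb (fun t => f t - g t) a b.
Proof. move=> fi gi; exact: (integrableB _ fi gi). Qed.

Lemma integrable_segmentZ f k a b : intb f a b -> intb (fun t => k * f t) a b.
Proof. move=> fi; exact: (integrableZl _ k fi). Qed.

Lemma integrable_segment_norm f a b : intb f a b -> intb (fun t => `|f t|) a b.
Proof. exact: integrable_norm. Qed.

Lemma integrable_segmentM f g a b : intb f a b -> {within `[a, b], continuous g} ->
  intb (fun t => f t * g t) a b.
Proof.
move=> fi gc; apply: (@integrableMl _ _ _ mu _ _ (EFin \o f) g) => //.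
  apply/measurable_EFinP; apply: (measurable_int mu).
  by apply: continuous_compact_integrable => //; exact: segment_compact.
have /compact_bounded[M [Mr HM]] := continuous_compact gc (@segment_compact _ a b).
exists M; split=> // x Mx y /= aby; apply: HM => //=; by exists y.
Qed.

Lemma integrable_segmentMc f g a b : intb f a b -> continuous g ->
  intb (fun t => f t * g t) a b.
Proof. by move=> fi cg; apply: integrable_segmentM => //; exact: continuous_subspaceT. Qed.

Lemma integrable_segmentS f a b x y : a <= x -> y <= b -> intb f a b -> intb f x y.
Proof.
move=> ax yb; apply: integrableS => //.
by apply: subset_itv; rewrite bnd_simp.
Qed.

Lemma Rintegral_split f a c b : a <= c <= b -> intb f a b ->
  \int[mu]_(t in `[a, b]) f t =
  \int[mu]_(t in `[a, c]) f t + \int[mu]_(t in `[c, b]) f t.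
Proof.
move=> /andP[ac cb] fi.
have := @Rintegral_itvB _ f (BLeft a) (BRight b) c fi.
rewrite !bnd_simp => /(_ ac cb) H.
rewrite -[X in _ = _ + X]Rintegral_itv_obnd_cbnd; last first.
  apply: integrableS fi => //; apply: subset_itv; by rewrite bnd_simp.
by rewrite -H addrC subrK.
Qed.

Lemma Rintegral_norm_mono f a b x y : a <= x -> y <= b -> intb f a b ->
  \int[mu]_(t in `[x, y]) `|f t| <= \int[mu]_(t in `[a, b]) `|f t|.
Proof.
move=> ax yb fi.
have [xy|yx] := leP x y; last first.
  by rewrite set_itv_ge ?bnd_simp -?ltNge// Rintegral_set0 Rintegral_ge0.
have fi' := integrable_segment_norm fi.
rewrite (@Rintegral_split _ a x b)//; last by rewrite ax (le_trans xy).
rewrite (@Rintegral_split _ x y b) ?xy//; last exact: integrable_segmentS fi'.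
rewrite addrCA lerDl addr_ge0// Rintegral_ge0//.
Qed.

(** The one-sided integral is dominated by the centred average over the open ball of radius 2 r,
    which contains the closed segment [x, x + r]; its measure 4 r explains the tolerance e / 4. *)
Lemma lebesgue_pt_Rintegral f a b x e : a < x < b -> intb f a b ->
  lebesgue_pt f x -> 0 < e ->
  \forall r \near 0^'+, \int[mu]_(t in `[x, x + r]) `|f t - f x| <= e * r.
Proof.
move=> /andP[ax xb] fi /fine_cvgP[fin /cvgrPdist_lt fx] e0.
have e4 : 0 < e / 4 by rewrite divr_gt0.
have {fx}fx := fx _ e4.
have H2 (P : set R) : (\forall r \near 0^'+, P r) -> \forall r \near 0^'+, P (2 * r).
  move=> [d /= d0 dP]; exists (d / 2) => /=; first by rewrite divr_gt0.
  move=> r /=; rewrite sub0r normrN => rd r0; apply: dP; rewrite /= ?mulr_gt0//.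
  by rewrite sub0r normrN normrM ger0_norm// mulrC -ltr_pdivlMr.
have {}fx := H2 _ fx; have {}fin := H2 _ fin.
near=> r.
have r0 : 0 < r by near: r; exact: nbhs_right_gt.
have rb : x + 2 * r < b.
  rewrite -ltrBrDl mulrC -ltr_pdivlMr//; near: r; apply: nbhs_right_lt.
  by rewrite divr_gt0// subr_gt0.
have ra : a < x - 2 * r.
  rewrite ltrBrDr -ltrBrDl mulrC -ltr_pdivlMr//; near: r; apply: nbhs_right_lt.
  by rewrite divr_gt0// subr_gt0.
have : fine (davg f x (2 * r)) < e / 4.
  have H : `|0 - (fine \o (davg f x)) (2 * r)| < e / 4 by near: r.
  by move: H; rewrite sub0r normrN; apply: le_lt_trans; exact: ler_norm.
have fc : intb (fun t => `|f t - f x|) a b.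
  apply: integrable_segment_norm; apply: integrable_segmentB => //.
  by apply: (@continuous_integrable _ (fun=> f x)) => z; exact: cvg_cst.
rewrite /davg /iavg lebesgue_measure_ball ?mulr_ge0 ?(ltW r0)//.
have br : ball x (2 * r) = `]x - 2 * r, x + 2 * r[%classic by rewrite ball_itv.
have fb : mu.-integrable (ball x (2 * r)) (fun t => `|f t - f x|%:E).
  rewrite br; apply: integrableS fc => //; apply: subset_itv; rewrite bnd_simp ltW//.
rewrite inver ifF; last by apply/negbTE; rewrite gt_eqF// mulrn_wgt0// mulr_gt0.
have fbf : (\int[mu]_(y in ball x (2 * r)) `|f y - f x|%:E)%E \is a fin_num.
  by apply: (integrable_fin_num _ fb); rewrite br.
rewrite fineM//.
rewrite /= ltr_pdivrMl ?pmulrn_lgt0 ?mulr_gt0// => H.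
apply: le_trans (le_trans _ (ltW H)) _; last by rewrite -mulr_natr; lra.
rewrite -/(Rintegral mu _ (fun t => `|f t - f x|)).
rewrite [leRHS]Rintegral_mkcond [leLHS]Rintegral_mkcond.
apply: le_Rintegral => //=.
- rewrite -restrict_EFin; apply/integrable_restrict => //; rewrite setTI.
  by apply: integrable_segmentS fc; [rewrite ltW|rewrite (le_trans _ (ltW rb))// lerD2l ler_peMl ?ler1n// ltW].
- by rewrite -restrict_EFin; apply/integrable_restrict => //; rewrite ?setTI// br.
- move=> t _; rewrite !patchE; case: ifPn => [|_]; last by case: ifPn => // _; exact: normr_ge0.
  rewrite inE/= in_itv/= => /andP[xt tr]; rewrite ifT// inE br/= in_itv/=; apply/andP; split; lra.
Unshelve. all: by end_near. Qed.

End SegmentIntegral.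

(** * Weak derivatives *)

Section WeakDerivative.
Context {R : realType}.
Notation mu := (@lebesgue_measure R).
Implicit Types (f g h : R -> R) (a b c x y : R).
Local Notation intb f a b := (mu.-integrable `[a, b] (EFin \o f)).

Lemma is_derive1_rescale (s r : R -> R) (x e t : R) :
  (forall z : R, is_derive z 1 s (r z)) ->
  is_derive t 1 (fun t => s ((t - x) / e)) (r ((t - x) / e) / e).
Proof.
move=> sr; rewrite (_ : (fun t => _) = fun t => s (e^-1 * t + - x / e)); last first.
  by apply/funext => z; congr s; ring.
have := @is_derive1_comp_affine _ s t _ e^-1 (- x / e) (sr _).
by move=> H; apply: (trigger_derive H); rewrite mulrC; congr (r _ * _); ring.
Qed.

Lemma continuous_rescale (r : R -> R) (x e : R) : continuous r ->
  continuous (fun t : R => r ((t - x) / e) / e).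
Proof.
move=> cr t; apply: cvgM; last exact: cvg_cst.
apply: (@continuous_comp _ _ _ (fun t : R => (t - x) / e) r); last exact: cr.
by apply: cvgM; [apply: cvgB; [exact: cvg_id|exact: cvg_cst]|exact: cvg_cst].
Qed.

(** The kernel is supported to the right of x, in ]x, x + e[, and bounded by M / e. The error is
    thus at most M / e times the integral of |f - f x| over [x, x + e], which is o(e) at a Lebesgue
    point. *)
Lemma cvg_mollify (r : R -> R) f a b x :
  continuous r -> (forall t, 0 <= r t) -> (forall t, ~~ (0 < t < 1) -> r t = 0) ->
  (exists M, forall t, r t <= M) ->
  (\forall e \near 0^'+, \int[mu]_(t in `[a, b]) (r ((t - x) / e) / e) = 1) ->
  a < x < b -> intb f a b -> lebesgue_pt f x ->
  \int[mu]_(t in `[a, b]) (f t * (r ((t - x) / e) / e)) @[e --> 0^'+] --> f x.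
Proof.
move=> cr r0 r01 [M rM] rI xab fi fx; apply/cvgrPdist_le => /= eps eps0.
have M0 : 0 <= M by exact: le_trans (rM 0).
have M1 : 0 < M + 1 by rewrite ltr_wpDl.
near=> e.
have crs : continuous (fun t : R => r ((t - x) / e) / e) by exact: continuous_rescale.
have e0 : 0 < e by near: e; exact: nbhs_right_gt.
have I1 : \int[mu]_(t in `[a, b]) (r ((t - x) / e) / e) = 1 by near: e.
have IL : \int[mu]_(t in `[x, x + e]) `|f t - f x| <= eps / (M + 1) * e.
  by near: e; apply: lebesgue_pt_Rintegral xab fi fx _; rewrite divr_gt0.
have xb : x + e <= b.
  rewrite -lerBrDl; near: e; apply: nbhs_right_ltW.
  by rewrite subr_gt0 (andP xab).2.
have ci : intb (fun=> f x) a b.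
  by apply: (@continuous_integrable _ (fun=> f x)) => z; exact: cvg_cst.
have ri : intb (fun t => r ((t - x) / e) / e) a b by exact: continuous_integrable.
have fri : intb (fun t => f t * (r ((t - x) / e) / e)) a b by exact: integrable_segmentMc.
have -> : f x - \int[mu]_(t in `[a, b]) (f t * (r ((t - x) / e) / e)) =
    - \int[mu]_(t in `[a, b]) ((f t - f x) * (r ((t - x) / e) / e)).
  under [in RHS]eq_Rintegral do rewrite mulrBl.
  rewrite RintegralB//; last exact: integrable_segmentMc.
  by rewrite RintegralZl// I1 mulr1 opprB.
rewrite normrN.
have di : intb (fun t => f t - f x) a b by exact: integrable_segmentB.
have dri : intb (fun t => (f t - f x) * (r ((t - x) / e) / e)) a b.
  exact: integrable_segmentMc.
apply: le_trans (le_normr_Rintegral _ dri) _ => //.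
have xi : intb (fun t => `|f t - f x|) x (x + e).
  apply: integrable_segmentS (integrable_segment_norm di) => //.
  exact: ltW (andP xab).1.
apply: (@le_trans _ _ (\int[mu]_(t in `[x, x + e]) (M / e * `|f t - f x|))).
  rewrite Rintegral_mkcond [leRHS]Rintegral_mkcond; apply: le_Rintegral => //=.
  - rewrite -restrict_EFin; apply/integrable_restrict => //; rewrite setTI.
    exact: integrable_segment_norm.
  - rewrite -restrict_EFin; apply/integrable_restrict => //; rewrite setTI.
    exact: integrable_segmentZ.
  - move=> t _; rewrite !patchE; case: (boolP (t \in `[x, x + e]%classic)) => tx.
      have -> : t \in `[a, b]%classic.
        move: tx; rewrite !inE/= !in_itv/= => /andP[xt te].
        by rewrite (le_trans (ltW (andP xab).1))// (le_trans te).
      rewrite normrM mulrC ler_wpM2r// normrM ger0_norm// normfV (gtr0_norm e0).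
      by rewrite ler_pM2r// invr_gt0.
    case: ifP => // _; rewrite r01 ?mul0r ?mulr0 ?normr0//.
    move: tx; rewrite notin_setE/= in_itv/=; apply: contra_notN => /andP[t0 t1].
    move: t0 t1; rewrite pmulr_lgt0 ?invr_gt0// subr_gt0 => /ltW ->.
    by rewrite ltr_pdivrMr// mul1r ltrBlDl => /ltW.
rewrite RintegralZl//.
apply: le_trans (ler_wpM2l _ IL) _; first by rewrite divr_ge0// ltW.
rewrite mulrACA -!mulrA [e^-1 * e]mulVf ?gt_eqF// mulr1 mulrA ler_pdivrMr//.
rewrite [leRHS]mulrC ler_wpM2r ?(ltW eps0)// lerDl.
Unshelve. all: by end_near. Qed.

(* Test against smoothed indicators of [x, y]. *)
Lemma weak_derivative_increment (U : set R) f g a b x y :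
  weak_derivative U f g -> `]a, b[ `<=` U -> intb f a b -> intb g a b ->
  a < x -> x <= y -> y < b -> lebesgue_pt f x -> lebesgue_pt f y ->
  f y - f x = \int[mu]_(t in `[x, y]) g t.
Proof.
move=> fg abU fi gi ax xy yb fx fy.
have [s [r [[ss sr sr'] [r0 r01 rM] [s0 s1 s01]]]] := @smooth_step R.
have cr : continuous r by exact: smooth_continuous.
have cs : continuous s by exact: smooth_continuous.
(* A step up just right of x minus a step up just right of y; the derivative is the difference of
   the mollifiers at x and at y. *)
pose phi e t := s ((t - x) / e) - s ((t - y) / e).
have Dphi e (t : R) : is_derive t 1 (phi e) (r ((t - x) / e) / e - r ((t - y) / e) / e).
  by apply: is_derive1B; exact: is_derive1_rescale.
have sphi e : smooth (phi e).
  have H z : (fun t => 1 * s (e^-1 * t + - z / e)) = fun t => s ((t - z) / e).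
    by apply/funext => t; rewrite mul1r; congr s; ring.
  by apply: smoothB; rewrite -H; exact: smooth_affine.
have cphi e : continuous (phi e) := smooth_continuous (sphi e).
have dphi e : derive1 (phi e) = fun t => r ((t - x) / e) / e - r ((t - y) / e) / e.
  by apply/funext => t; exact: is_derive1E.
have sle e t z : 0 < e -> t <= z -> s ((t - z) / e) = 0.
  by move=> e0 tz; rewrite s0// pmulr_lle0 ?invr_gt0// subr_le0.
have sge e t z : 0 < e -> z + e <= t -> s ((t - z) / e) = 1.
  by move=> e0 tz; rewrite s1// ler_pdivlMr// mul1r lerBrDl.
have phi0 e t : 0 < e -> ~~ (x <= t <= y + e) -> phi e t = 0.
  move=> e0; rewrite negb_and -!ltNge /phi => /orP[tx|ty].
    by rewrite !sle ?subrr// (le_trans (ltW tx)).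
  by rewrite !sge ?subrr// ?(ltW ty)// (le_trans _ (ltW ty))// lerD2r.
have phi1 e t : `|phi e t| <= 1.
  by rewrite ler_norml; have := s01 ((t - x) / e); have := s01 ((t - y) / e);
    rewrite /phi; lra.
have phiab e t : 0 < e -> y + e < b -> ~~ (a <= t <= b) -> phi e t = 0.
  move=> e0 yeb tab; apply: phi0 => //; apply: contraNN tab => /andP[xt tye].
  by rewrite (le_trans (ltW ax))//= (le_trans tye)// ltW.
have near_b : \forall e \near 0^'+, y + e < b.
  near=> e; rewrite -ltrBrDl; near: e; apply: nbhs_right_lt; by rewrite subr_gt0.
have key : \forall e \near 0^'+,
    \int[mu]_(t in `[a, b]) (f t * (r ((t - x) / e) / e)) -
    \int[mu]_(t in `[a, b]) (f t * (r ((t - y) / e) / e)) =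
    - \int[mu]_(t in `[a, b]) (g t * phi e t).
  near=> e.
  have e0 : 0 < e by near: e; exact: nbhs_right_gt.
  have yeb : y + e < b by near: e.
  have crs (z : R) : continuous (fun t : R => r ((t - z) / e) / e) by exact: continuous_rescale.
  have := fg (phi e); rewrite /test_function => /(_ _)/wrap[].
    split; first exact: sphi.
    exists `[x, y + e]%classic; split; first exact: segment_compact.
      apply: subset_trans abU; apply: subset_itv; rewrite bnd_simp//.
    by move=> t; rewrite /= in_itv/= => /negP; exact: phi0.
  rewrite (@Rintegral_supp _ (fun t => g t * phi e t) a b); last first.
    by move=> t tab; rewrite phiab// mulr0.
  rewrite (@Rintegral_supp _ (fun t => f t * derive1 (phi e) t) a b); last first.
    move=> t tab; rewrite dphi !r01 ?mul0r ?subr0 ?mulr0//; apply: contraNN tab => /andP[];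
      rewrite pmulr_lgt0 ?invr_gt0// subr_gt0 ltr_pdivrMr// mul1r ltrBlDl => zt tz; lra.
  move=> <-; rewrite dphi.
  under [in RHS]eq_Rintegral do rewrite mulrBr.
  by rewrite RintegralB//; exact: integrable_segmentMc.
(* Dominated convergence needs a sequence; the denominator n + 2 keeps y + e_n strictly below b. *)
pose e_ (n : nat) := (b - y) / n.+2%:R.
have e_gt0 n : 0 < e_ n by rewrite divr_gt0// subr_gt0.
have e_lt n : y + e_ n < b.
  by rewrite -ltrBrDl /e_ gtr_pMr ?subr_gt0// invf_lt1// ltr1n.
have e_cvg : e_ n @[n --> \oo] --> 0.
  rewrite -[X in _ --> X](mulr0 (b - y)); apply: cvgM; first exact: cvg_cst.
  have : (@harmonic R n.+1) @[n --> \oo] --> (0 : R).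
    by have := @cvg_harmonic R; rewrite -(cvg_shiftS (@harmonic R)).
  exact.
have e_right (F : R -> R) (l : R) : F e @[e --> 0^'+] --> l -> F (e_ n) @[n --> \oo] --> l.
  by move=> /cvg_at_rightP; apply; split.
have norm1 z : a < z -> z < b ->
    \forall e \near 0^'+, \int[mu]_(t in `[a, b]) (r ((t - z) / e) / e) = 1.
  move=> az zb; near=> e.
  have e0 : 0 < e by near: e; exact: nbhs_right_gt.
  have zeb : z + e < b by rewrite -ltrBrDl; near: e; apply: nbhs_right_lt; rewrite subr_gt0.
  have := @Rintegral_derive _ (fun t => s ((t - z) / e)) _ a b
    (ltW (lt_trans az zb)) (fun t => is_derive1_rescale z e t sr') (continuous_rescale cr).
  by move=> ->; rewrite sge ?(ltW zeb)// sle ?subr0// ltW.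
have lim1 : \int[mu]_(t in `[a, b]) (g t * phi (e_ n) t) @[n --> \oo] --> f y - f x.
  have xb : x < b by exact: le_lt_trans yb.
  have ay : a < y by exact: lt_le_trans xy.
  have axb : a < x < b by rewrite ax.
  have ayb : a < y < b by rewrite ay.
  have Hy := cvg_mollify cr r0 r01 rM (norm1 _ ay yb) ayb fi fy.
  have Hx := cvg_mollify cr r0 r01 rM (norm1 _ ax xb) axb fi fx.
  have H : (\int[mu]_(t in `[a, b]) (f t * (r ((t - y) / e) / e)) -
      \int[mu]_(t in `[a, b]) (f t * (r ((t - x) / e) / e))) @[e --> 0^'+] --> f y - f x.
    exact: cvgB.
  apply: (e_right (fun e => \int[mu]_(t in `[a, b]) (g t * phi e t))).
  apply: cvg_trans H; apply: near_eq_cvg; near=> e.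
  have : \int[mu]_(t in `[a, b]) (f t * (r ((t - x) / e) / e)) -
    \int[mu]_(t in `[a, b]) (f t * (r ((t - y) / e) / e)) =
    - \int[mu]_(t in `[a, b]) (g t * phi e t) by near: e.
  by move=> Ke; rewrite -[LHS]opprB Ke opprK.
have lim2 : \int[mu]_(t in `[a, b]) (g t * phi (e_ n) t) @[n --> \oo] -->
    \int[mu]_(t in `[x, y]) g t.
  (* Each step still vanishes at its left end, so the pointwise limit is the indicator of ]x, y],
     open at x and closed at y. *)
  pose G t := g t * (x < t <= y)%R%:R.
  have -> : \int[mu]_(t in `[x, y]) g t = \int[mu]_(t in `[a, b]) G t.
    have gxy : intb g x y by apply: integrable_segmentS gi; exact/ltW.
    rewrite -Rintegral_itv_obnd_cbnd; last by apply: integrableS gxy => //; exact: subset_itv_oc_cc.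
    rewrite Rintegral_mkcond [RHS]Rintegral_mkcond; apply: eq_Rintegral => t _.
    rewrite !patchE /G; case: ifPn.
      rewrite inE/= in_itv/= => xty; rewrite xty mulr1 ifT// inE/= in_itv/=.
      by case/andP: xty => xt ty; rewrite (le_trans (ltW ax) (ltW xt)) (le_trans ty (ltW yb)).
    rewrite notin_setE/= in_itv/= => /negP/negbTE ->; rewrite mulr0; by case: ifP.
  have gp n : intb (fun t => g t * phi (e_ n) t) a b by exact: integrable_segmentMc.
  have pw t : phi (e_ n) t @[n --> \oo] --> ((x < t <= y)%R%:R : R).
    have [tx|xt] := leP t x => /=.
      apply: cvg_near_cst; near=> n; rewrite /phi !sle ?subrr//.
      by rewrite (le_trans tx).
    have Hx : \forall n \near \oo, x + e_ n <= t.
      have d0 : 0 < t - x by rewrite subr_gt0.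
      near=> n; rewrite -lerBrDl; near: n; apply: (cvgr_le _ e_cvg) => //.
    have [ty|yt] := leP t y => /=.
      apply: cvg_near_cst; near=> n; rewrite /phi sge ?sle ?subr0//.
      by near: n.
    apply: cvg_near_cst; near=> n; rewrite /phi !sge ?subrr//; last by near: n.
    rewrite -lerBrDl; near: n; apply: (cvgr_le _ e_cvg) => //; by rewrite subr_gt0.
  have [] := @dominated_convergence _ _ _ mu `[a, b] _
    (fun n t => (g t * phi (e_ n) t)%:E) (EFin \o G) (fun t => (`|g t|)%:E).
  - exact: measurable_itv.
  - by move=> n; exact: measurable_int (gp n).
  - apply/measurable_EFinP; apply: measurable_funM.
      by apply/measurable_EFinP; exact: (measurable_int mu).
    apply: (measurable_funS measurableT) => //.
    rewrite (_ : (fun t => _) = \1_(`]x, y]%classic : set R)); last first.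
      apply/funext => t; rewrite indicE; congr ((nat_of_bool _)%:R).
      by apply/idP/idP; rewrite inE/= in_itv.
    exact: measurable_indic.
  - apply: aeW => t _; apply: cvg_EFin; first by near=> n.
    by apply: cvgM; [exact: cvg_cst|exact: pw].
  - exact: integrable_segment_norm.
  - by apply: aeW => t n _; rewrite lee_fin normrM ler_piMr.
  move=> Gi _; rewrite /Rintegral => H.
  have fG : (\int[mu]_(t in `[a, b]) (G t)%:E)%E \is a fin_num.
    by apply: integrable_fin_num Gi.
  by move: H; rewrite -(fineK fG) => /fine_cvg.
by apply: cvg_unique lim1 lim2.
Unshelve. all: by end_near. Qed.

End WeakDerivative.

(** * Absolutely continuous functions as primitives *)

Section Primitive.
Context {R : realType}.
Notation mu := (@lebesgue_measure R).
Implicit Types (f g h k D W : R -> R) (a b c x y z : R).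
Local Notation intb f a b := (mu.-integrable `[a, b] (EFin \o f)).

Lemma Rintegral_segmentD f g a b : intb f a b -> intb g a b ->
  \int[mu]_(t in `[a, b]) (f t + g t) =
  \int[mu]_(t in `[a, b]) f t + \int[mu]_(t in `[a, b]) g t.
Proof. by move=> fi gi; rewrite RintegralD. Qed.

Lemma Rintegral_segmentB f g a b : intb f a b -> intb g a b ->
  \int[mu]_(t in `[a, b]) (f t - g t) =
  \int[mu]_(t in `[a, b]) f t - \int[mu]_(t in `[a, b]) g t.
Proof. by move=> fi gi; rewrite RintegralB. Qed.

Lemma Rintegral_segmentZ f c a b : intb f a b ->
  \int[mu]_(t in `[a, b]) (c * f t) = c * \int[mu]_(t in `[a, b]) f t.
Proof. by move=> fi; rewrite RintegralZl. Qed.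

Lemma integrable_segment_cst c a b : intb (fun=> c) a b.
Proof. by apply: (@continuous_integrable _ (fun=> c)) => z; exact: cvg_cst. Qed.

Lemma Rintegral_segment_cst c a b : a <= b -> \int[mu]_(t in `[a, b]) c = c * (b - a).
Proof.
move=> ab; rewrite Rintegral_cst//= lebesgue_measure_itv/= lte_fin.
by case: ltgtP ab => [ab _|//|-> _]; rewrite ?subrr.
Qed.

(* [D] has zero increments because a subdivision into n steps bounds them by C (b - a) (W b - W a) / n. *)
Lemma eq_of_quadratic_increment D W a b C : a <= b -> 0 <= C ->
  (forall x y, a <= x -> x <= y -> y <= b ->
    `|D y - D x| <= C * (y - x) * (W y - W x)) -> D b = D a.
Proof.
move=> ab C0 DW; apply/eqP; rewrite -subr_eq0 -normr_le0.
have key n : `|D b - D a| <= C * ((b - a) / n.+1%:R) * (W b - W a).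
  set e := (b - a) / n.+1%:R.
  have e0 : 0 <= e by rewrite divr_ge0// subr_ge0.
  have eb : e * n.+1%:R = b - a by rewrite divfK.
  have H i : (i <= n.+1)%N ->
      `|D (a + e * i%:R) - D a| <= C * e * (W (a + e * i%:R) - W a).
    elim: i => [_|i IH lei]; first by rewrite mulr0 addr0 !subrr normr0 mulr0.
    have Hi : e * i.+1%:R = e * i%:R + e by rewrite -natr1 mulrDr mulr1.
    have := DW (a + e * i%:R) (a + e * i.+1%:R).
    rewrite lerDl mulr_ge0// => /(_ isT).
    rewrite lerD2l Hi lerDl e0 => /(_ isT).
    have -> : a + (e * i%:R + e) <= b.
      rewrite -lerBrDl -eb -Hi ler_wpM2l// ler_nat//.
    move=> /(_ isT); have -> : a + (e * i%:R + e) - (a + e * i%:R) = e by ring.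
    move=> H2; have {}IH := IH (ltnW lei).
    rewrite (_ : D _ - D a = (D (a + (e * i%:R + e)) - D (a + e * i%:R)) +
      (D (a + e * i%:R) - D a)); last by ring.
    apply: le_trans (ler_normD _ _) _; apply: le_trans (lerD H2 IH) _.
    by rewrite -mulrDr addrA subrK.
  by have := H n.+1 (leqnn _); rewrite eb (_ : a + (b - a) = b)//; ring.
apply/ler_addgt0Pl => e e0; rewrite addr0.
pose A := C * (b - a) * (W b - W a).
have [n An] : exists n : nat, `|A| / e < n.+1%:R.
  exists (Num.truncn (`|A| / e)); apply: truncnS_gt.
apply: le_trans (key n) _.
rewrite mulrA [_ * _^-1 * _]mulrAC -/A ler_pdivrMr//.
apply: le_trans (ler_norm _) _.
by move: An; rewrite ltr_pdivrMr// mulrC => /ltW.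
Qed.

Lemma Rintegral_derive_segment f g a b : a <= b ->
  (forall t, a <= t <= b -> is_derive t 1 f (g t)) ->
  {within `[a, b], continuous g} -> \int[mu]_(x in `[a, b]) g x = f b - f a.
Proof.
rewrite le_eqVlt => /predU1P[<-|ab] fg cg.
  by rewrite set_itv1 Rintegral_set1 subrr.
have cf t : a <= t <= b -> {for t, continuous f}.
  by move=> tab; exact: is_derive1_continuous (fg t tab).
rewrite /Rintegral (@continuous_FTC2 _ g f a b ab)//.
- split; [by move=> x; rewrite in_itv/= => /andP[ax xb]; case: (fg x _) => //; rewrite !ltW| |].
    by apply/cvg_at_right_filter/cf; rewrite lexx ltW.
  by apply/cvg_at_left_filter/cf; rewrite lexx ltW.
- by move=> x; rewrite in_itv/= => /andP[ax xb]; apply/is_derive1E/fg; rewrite !ltW.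
Qed.

Lemma within_continuousS g a b x y : a <= x -> y <= b ->
  {within `[a, b], continuous g} -> {within `[x, y], continuous g}.
Proof.
by move=> ax yb; apply: continuous_subspaceW; apply: subset_itv; rewrite bnd_simp.
Qed.

Lemma primitive_within_continuous k h a b : a <= b -> intb h a b ->
  (forall x, a <= x -> x <= b -> k x - k a = \int[mu]_(t in `[a, x]) h t) ->
  {within `[a, b], continuous k}.
Proof.
move=> ab hi kh.
have := parameterized_integral_continuous ab hi.
rewrite /parameterized_integral => c.
have : {within `[a, b], continuous (fun x => k a + \int[mu]_(t in `[a, x]) h t)}.
  by move=> x; apply: cvgD; [exact: cvg_cst|exact: c].
apply: subspace_eq_continuous => x; rewrite inE/= in_itv/= => /andP[ax xb].
by rewrite /from_subspace/= -kh// addrC subrK.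
Qed.

Lemma within_continuous_bounded g a b : {within `[a, b], continuous g} ->
  exists2 M, 0 <= M & forall t, a <= t <= b -> `|g t| <= M.
Proof.
move=> gc; have /compact_bounded[M [Mr HM]] := continuous_compact gc (@segment_compact _ a b).
exists (`|M| + 1); first by rewrite addr_ge0.
move=> t tab; apply: HM => /=.
  by rewrite (le_lt_trans (ler_norm _))// ltrDl.
by exists t => //; rewrite /= in_itv.
Qed.

(** [k] is only absolutely continuous, so psi k is not differentiated. The defect D of the identity
    has increments bounded by a constant times (y - x) times the integral of |h| over [x, y], and
    [eq_of_quadratic_increment] gives D b = D a. *)
Lemma primitive_product_rule k h (psi psi1 : R -> R) a b : a <= b -> intb h a b ->
  (forall x y, a <= x -> x <= y -> y <= b -> k y - k x = \int[mu]_(t in `[x, y]) h t) ->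
  (forall t, a <= t <= b -> is_derive t 1 psi (psi1 t)) ->
  {within `[a, b], continuous psi1} ->
  psi b * k b - psi a * k a = \int[mu]_(t in `[a, b]) (psi1 t * k t + psi t * h t).
Proof.
move=> ab hi kh Dpsi cpsi1.
have ck : {within `[a, b], continuous k}.
  by apply: (primitive_within_continuous ab hi) => x ax xb; exact: kh.
have cpsi : {within `[a, b], continuous psi}.
  apply: derivable_within_continuous => t; rewrite in_itv/= => tab.
  by case: (Dpsi t tab).
have ci g : {within `[a, b], continuous g} -> intb g a b.
  by move=> gc; apply: continuous_compact_integrable => //; exact: segment_compact.
have i1 : intb (fun t => psi1 t * k t) a b by apply: integrable_segmentM => //; exact: ci.
have i2 : intb (fun t => psi t * h t) a b.
  have := integrable_segmentM hi cpsi.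
  by apply: eq_integrable => // t _; rewrite /= mulrC.
have [M M0 HM] := within_continuous_bounded cpsi1.
pose I x := \int[mu]_(t in `[a, x]) (psi1 t * k t + psi t * h t).
pose W x := \int[mu]_(t in `[a, x]) `|h t|.
pose D x := psi x * k x - I x.
have hai := integrable_segment_norm hi.
have i12 := integrable_segmentD i1 i2.
have Isplit x y : a <= x -> x <= y -> y <= b ->
    I y = I x + \int[mu]_(t in `[x, y]) (psi1 t * k t + psi t * h t).
  move=> ax xy yb; apply: Rintegral_split; first by rewrite ax.
  exact: integrable_segmentS i12.
have Wsplit x y : a <= x -> x <= y -> y <= b ->
    W y = W x + \int[mu]_(t in `[x, y]) `|h t|.
  move=> ax xy yb; apply: Rintegral_split; first by rewrite ax.
  exact: integrable_segmentS hai.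
have : D b = D a.
  apply: (@eq_of_quadratic_increment _ W _ _ (2 * M)) => //; first by rewrite mulr_ge0.
  move=> x y ax xy yb.
  have hxy := integrable_segmentS ax yb hi.
  have psixy : \int[mu]_(t in `[x, y]) psi1 t = psi y - psi x.
    apply: Rintegral_derive_segment => //.
      by move=> t /andP[xt ty]; apply: Dpsi; rewrite (le_trans ax)// (le_trans ty).
    exact: within_continuousS cpsi1.
  have kc z : intb (fun=> z) x y by apply: (@continuous_integrable _ (fun=> z)) => ?; exact: cvg_cst.
  have j1 : intb (fun t => psi1 t * k x) x y.
    apply: integrable_segmentM; last by move=> ?; exact: cvg_cst.
    by apply: integrable_segmentS (ci _ cpsi1).
  have j2 : intb (fun t => psi y * h t) x y by exact: integrable_segmentZ.
  have j12 := integrable_segmentD j1 j2.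
  (* The increment of psi k is (psi y - psi x) k x + psi y (k y - k x), written as one integral;
     subtracting the integrand of I leaves only differences of k and of psi. *)
  have -> : D y - D x = \int[mu]_(t in `[x, y])
      ((psi1 t * k x + psi y * h t) - (psi1 t * k t + psi t * h t)).
    rewrite RintegralB//; last exact: integrable_segmentS i12.
    rewrite RintegralD// RintegralZl// RintegralZr//; last exact: integrable_segmentS (ci _ cpsi1).
    rewrite psixy -kh// /D (Isplit x y)//; ring.
  have -> : W y - W x = \int[mu]_(t in `[x, y]) `|h t|.
    by rewrite (Wsplit x y)// addrC addKr.
  have jj := integrable_segmentB j12 (integrable_segmentS ax yb i12).
  apply: le_trans (le_normr_Rintegral _ jj) _ => //.
  pose w := \int[mu]_(t in `[x, y]) `|h t|.
  have w0 : 0 <= w by exact: Rintegral_ge0.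
  have jh := integrable_segmentZ (M * (y - x)) (integrable_segment_norm hxy).
  apply: (@le_trans _ _ (\int[mu]_(t in `[x, y]) (M * w + M * (y - x) * `|h t|))).
    apply: le_Rintegral => //; first exact: integrable_segment_norm jj.
      by apply: integrable_segmentD => //; exact: kc.
    move=> t; rewrite /= in_itv/= => /andP[xt ty].
    have at' : a <= t by exact: le_trans xt.
    have tb : t <= b by exact: le_trans yb.
    rewrite (_ : _ - _ = psi1 t * (k x - k t) + (psi y - psi t) * h t); last by ring.
    apply: le_trans (ler_normD _ _) _; apply: lerD; rewrite normrM.
      apply: ler_pM => //; first by rewrite HM// at'.
      rewrite distrC kh//; apply: le_trans (le_normr_Rintegral _ _) _ => //.
        exact: integrable_segmentS hxy.
      exact: Rintegral_norm_mono hxy.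
    apply: ler_wpM2r => //.
    have [||c cty ->] := @MVT_segment _ psi psi1 t y ty.
    - move=> z; rewrite in_itv/= => /andP[tz zy]; apply: Dpsi.
      by rewrite (le_trans at' (ltW tz)) (le_trans (ltW zy)).
    - exact: within_continuousS cpsi.
    move: cty; rewrite in_itv/= => /andP[tc cy].
    rewrite normrM; apply: ler_pM => //; first by rewrite HM// (le_trans at')//= (le_trans cy).
    by rewrite ger0_norm ?subr_ge0// lerD2l lerN2.
  rewrite (Rintegral_segmentD (kc (M * w)) jh).
  rewrite (Rintegral_segmentZ _ (integrable_segment_norm hxy)) Rintegral_segment_cst// -/w.
  by rewrite le_eqVlt; apply/orP; left; apply/eqP; ring.
rewrite /D => H.
have -> : \int[mu]_(t in `[a, b]) (psi1 t * k t + psi t * h t) = I b by [].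
have Ia : I a = 0 by rewrite /I set_itv1 Rintegral_set1.
by move: H; rewrite Ia; lra.
Qed.

(** Follows from |f| <= 1 + f^2, the constant being integrable on a segment. *)
Lemma Lfun2_integrable_segment f a b : f \in Lfun mu 2%:E -> intb f a b.
Proof.
move=> f2; have fm : measurable_fun setT f by have := sub_Lfun_mfun f2; rewrite inE.
have f2i : mu.-integrable `[a, b] (EFin \o (fun x => f x ^+ 2)).
  have f2T := Lfun2_integrable_sqr f2.
  by refine (integrableS _ _ _ f2T).
apply: (le_integrable _ _ _ (integrable_segmentD (integrable_segment_cst 1 a b) f2i)) => //.
  by apply/measurable_EFinP; exact: measurable_funS fm.
move=> x _; rewrite /= lee_fin [leRHS]ger0_norm ?addr_ge0 ?sqr_ge0//.
by rewrite -[f x ^+ 2]real_normK ?num_real//; have := sqr_ge0 (`|f x| - 2^-1); nra.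
Qed.

Lemma Lfun2_locally_integrable f : f \in Lfun mu 2%:E -> locally_integrable setT f.
Proof.
move=> f2; have fm : measurable_fun setT f by have := sub_Lfun_mfun f2; rewrite inE.
split => //; first exact: openT.
move=> K _ cK; have [M [_ HM]] := compact_bounded cK.
have KM : K `<=` `[- (`|M| + 1), `|M| + 1]%classic.
  move=> x Kx; rewrite /= in_itv/= -ler_norml; apply: HM => //.
  by rewrite (le_lt_trans (ler_norm _))// ltrDl.
have /integrableP[_] := Lfun2_integrable_segment (- (`|M| + 1)) (`|M| + 1) f2.
apply: le_lt_trans; apply: ge0_subset_integral => //.
  exact: compact_measurable.
apply/measurable_EFinP; apply: measurableT_comp => //; exact: measurable_funS fm.
Qed.

End Primitive.

(** * Regularity of functions with two weak derivatives *)

Section Regularity.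
Context {R : realType}.
Notation mu := (@lebesgue_measure R).
Implicit Types (f g h k : R -> R) (a b c x y z : R).
Local Notation intb f a b := (mu.-integrable `[a, b] (EFin \o f)).

Lemma ae_imp (P Q : R -> Prop) : (forall x, P x -> Q x) ->
  {ae mu, forall x, P x} -> {ae mu, forall x, Q x}.
Proof.
move=> PQ [N [mN N0 PN]]; exists N; split=> // x nQ; apply: PN => Px.
by apply: nQ; exact: PQ.
Qed.

Lemma ae_imp2 (P Q S : R -> Prop) : (forall x, P x -> Q x -> S x) ->
  {ae mu, forall x, P x} -> {ae mu, forall x, Q x} -> {ae mu, forall x, S x}.
Proof.
move=> PQS [N [mN N0 PN]] [N' [mN' N'0 QN]]; exists (N `|` N'); split.
- exact: measurableU.
- exact: null_set_setU.
- move=> x nS; have [Px|/PN] := pselect (P x); last by left.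
  by right; apply: QN => Qx; apply: nS; exact: PQS.
Qed.

Lemma ae_segment_witness (P : R -> Prop) a b : a < b -> {ae mu, forall x, P x} ->
  exists2 c, a < c < b & P c.
Proof.
move=> ab [N [mN N0 PN]]; apply: contrapT => /forall2NP H.
have : `]a, b[%classic `<=` N.
  move=> x; rewrite /= in_itv/= => xab; apply: PN => Px.
  by case: (H x) => //; apply.
move=> abN; have : (mu `]a, b[ <= 0)%E by rewrite -N0; apply: le_measure => //; rewrite inE.
by rewrite lebesgue_measure_itv/= lte_fin ab -EFinB lee_fin leNgt subr_gt0 ab.
Qed.

Lemma Rintegral_ae_eq f g a b : intb f a b -> intb g a b ->
  {ae mu, forall x, a <= x <= b -> f x = g x} ->
  \int[mu]_(t in `[a, b]) f t = \int[mu]_(t in `[a, b]) g t.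
Proof.
move=> fi gi fg; rewrite /Rintegral; congr fine; apply: ae_eq_integral => //.
- exact: measurable_int fi.
- exact: measurable_int gi.
- move: fg; apply: ae_imp => x fgx; rewrite /= in_itv/= => /fgx ->//.
Qed.

Lemma Rintegral_continuous_is_derive g a b x : a < x < b ->
  (forall t, a < t < b -> {for t, continuous g}) ->
  (forall f, (forall y z, a < y -> y <= z -> z < b -> f z - f y = \int[mu]_(t in `[y, z]) g t) ->
   is_derive x 1 f (g x)).
Proof.
move=> /andP[ax xb] cg f fg.
pose c := (a + x) / 2; pose u := (x + b) / 2.
have gi : intb g c u.
  apply: continuous_compact_integrable; first exact: segment_compact.
  apply: (@continuous_in_subspaceT _ _ `[c, u]%classic) => t.
  rewrite inE/= in_itv/= => /andP[ct tu]; apply: cg; rewrite /c /u in ct tu; lra.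
have [] := @continuous_FTC1_closed R g c x u _ gi.
- rewrite /u; lra.
- rewrite /c; lra.
- by apply: cg; rewrite ax.
move=> dF FE.
apply: (@is_derive1_near _ (fun y => f c + \int[mu]_(t in `[c, y]) g t)).
  near=> y; rewrite -fg; first by rewrite addrC subrK.
  - rewrite /c; lra.
  - near: y; apply: lt_le_nbhsr; rewrite /c; lra.
  - by near: y; exact: near_lt.
have := is_derive1D (is_derive1_cst x (f c)) (derivable1_is_derive dF).
by rewrite FE add0r.
Unshelve. all: by end_near. Qed.

(** [f1] is determined only almost everywhere. Integrating [f2] from a Lebesgue point c of [f1]
    gives its continuous representative K. Every point is a Lebesgue point of the continuous f, so
    the increments of f are integrals of K and f' = K at every point of the interval. *)
Lemma weak_derivative2_regular (U : set R) f f1 f2 a b : a < b -> `]a, b[ `<=` U ->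
  f1 \in Lfun mu 2%:E -> f2 \in Lfun mu 2%:E -> continuous f ->
  weak_derivative U f f1 -> weak_derivative U f1 f2 ->
  [/\ forall x, a < x < b -> derivable f x 1,
      forall x y, a < x -> x <= y -> y < b ->
        derive1 f y - derive1 f x = \int[mu]_(t in `[x, y]) f2 t &
      {ae mu, forall x, a < x < b -> f1 x = derive1 f x}].
Proof.
move=> ab abU f1L f2L cf wf wf1.
have f1i x y := Lfun2_integrable_segment x y f1L.
have f2i x y := Lfun2_integrable_segment x y f2L.
have f_pt x : lebesgue_pt f x.
  apply: (@continuous_lebesgue_pt _ _ _ setT) => //; last exact: cf.
    by split; [exact: openT|].
  exact: continuous_measurable_fun.
have f1_pt := lebesgue_differentiation (Lfun2_locally_integrable f1L).
have [c /andP[ac cb] c_pt] := ae_segment_witness ab f1_pt.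
(* Both integrals start at a, so one formula covers the points on either side of c. *)
pose K x := f1 c + (\int[mu]_(t in `[a, x]) f2 t - \int[mu]_(t in `[a, c]) f2 t).
have KE x y : a < x -> x <= y -> y < b -> K y - K x = \int[mu]_(t in `[x, y]) f2 t.
  by move=> ax xy yb; rewrite /K (@Rintegral_split _ f2 a x y) ?(ltW ax)//; ring.
have Kae : {ae mu, forall x, a < x < b -> f1 x = K x}.
  move: f1_pt; apply: ae_imp => x x_pt /andP[ax xb].
  have [cx|xc] := leP c x.
    have := weak_derivative_increment wf1 abU (f1i a b) (f2i a b) ac cx xb c_pt x_pt.
    rewrite -KE// /K subrr addr0 => H.
    by apply/eqP; rewrite -subr_eq0; apply/eqP; move: H; lra.
  have := weak_derivative_increment wf1 abU (f1i a b) (f2i a b) ax (ltW xc) cb x_pt c_pt.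
  rewrite -KE// ?(ltW xc)// /K subrr addr0 => H.
  by apply/eqP; rewrite -subr_eq0; apply/eqP; move: H; lra.
have cK x : a < x < b -> {for x, continuous K}.
  move=> xab; have /(within_continuous_continuous ab) : {within `[a, b], continuous K}.
    apply: (@primitive_within_continuous _ K f2) => //; first exact: ltW.
    by move=> z az zb; rewrite /K set_itv1 Rintegral_set1; ring.
  by apply; rewrite in_itv.
have fK y z : a < y -> y <= z -> z < b -> f z - f y = \int[mu]_(t in `[y, z]) K t.
  move=> ay yz zb.
  rewrite (weak_derivative_increment wf abU _ (f1i a b) ay yz zb)//; last exact: continuous_integrable.
  apply: Rintegral_ae_eq => //.
    apply: continuous_compact_integrable; first exact: segment_compact.
    apply: (@continuous_in_subspaceT _ _ `[y, z]%classic) => t.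
    rewrite inE/= in_itv/= => /andP[yt tz]; apply: cK; lra.
  move: Kae; apply: ae_imp => x Kx /andP[yx xz]; apply: Kx; lra.
have Df x : a < x < b -> is_derive x 1 f (K x).
  by move=> xab; exact: Rintegral_continuous_is_derive xab cK f fK.
have f'K x : a < x < b -> derive1 f x = K x by move=> /Df; exact: is_derive1E.
split=> [x /Df[]//|x y ax xy yb|].
  by rewrite !f'K ?KE//; lra.
by move: Kae; apply: ae_imp => x H xab; rewrite f'K// H.
Qed.

End Regularity.

(** * Square-integrable functions *)

Section SquareIntegrable.
Context {R : realType}.
Notation mu := (@lebesgue_measure R).
Implicit Types (f g h y : R -> R).
Local Open Scope ereal_scope.

Lemma Lfun_measurable f p : f \in Lfun mu p -> measurable_fun setT f.
Proof. by move=> /sub_Lfun_mfun; rewrite inE. Qed.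

Lemma sqr_integral_ge0 f : 0 <= \int[mu]_x (f x ^+ 2)%:E.
Proof. by apply: integral_ge0 => x _; rewrite lee_fin sqr_ge0. Qed.

Lemma Lnorm2E f : 'N[mu]_2%:E[EFin \o f] = (\int[mu]_x (f x ^+ 2)%:E) `^ 2^-1.
Proof.
rewrite unlock; congr (_ `^ _); apply: eq_integral => x _.
by rewrite poweR_EFin -[2%R]/(2%:R)%R powR_mulrn// real_normK ?num_real.
Qed.

Lemma Lfun2P f : f \in Lfun mu 2%:E <->
  measurable_fun setT f /\ \int[mu]_x (f x ^+ 2)%:E < +oo.
Proof.
split=> [fL|[mf fi]].
  split; first exact: Lfun_measurable fL.
  have /integrableP[_] := Lfun2_integrable_sqr fL; apply: le_lt_trans.
  have mf := Lfun_measurable fL.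
  apply: ge0_le_integral => //.
  - by move=> x _; rewrite lee_fin sqr_ge0.
  - by apply/measurable_EFinP; exact: measurable_funX.
  - by apply/measurable_EFinP; apply: measurableT_comp => //; exact: measurable_funX.
  - by move=> x _; rewrite lee_fin ler_norm.
rewrite inE; apply/andP; rewrite !inE/=; split => //.
by rewrite /finite_norm Lnorm2E poweR_lty.
Qed.

Lemma Lfun2_le f g (C : R) : measurable_fun setT f -> g \in Lfun mu 2%:E ->
  (forall x, `|f x| <= C * `|g x|)%R -> f \in Lfun mu 2%:E.
Proof.
move=> mf /Lfun2P[mg gi] fg; apply/Lfun2P; split=> //.
apply: (@le_lt_trans _ _ (\int[mu]_x ((C ^+ 2)%:E * (g x ^+ 2)%:E))).
  apply: ge0_le_integral => //.
  - by move=> x _; rewrite lee_fin sqr_ge0.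
  - by apply/measurable_EFinP; exact: measurable_funX.
  - by apply/measurable_EFinP; apply: measurable_funM => //; exact: measurable_funX.
  - move=> x _; rewrite -EFinM lee_fin -exprMn -[leLHS]real_normK ?num_real//.
    rewrite -[leRHS]real_normK ?num_real//.
    rewrite ler_sqr ?nnegrE// normrM; apply: le_trans (fg x) _.
    by rewrite ler_wpM2r// ler_norm.
rewrite ge0_integralZl//; last 3 first.
- by apply/measurable_EFinP; exact: measurable_funX.
- by move=> x _; rewrite lee_fin sqr_ge0.
- by rewrite lee_fin sqr_ge0.
by rewrite lte_mul_pinfty ?lee_fin ?sqr_ge0.
Qed.

Lemma Lfun2D f g : f \in Lfun mu 2%:E -> g \in Lfun mu 2%:E ->
  (fun x => f x + g x)%R \in Lfun mu 2%:E.
Proof.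
have l12 : 1 <= 2%:E :> \bar R by rewrite lee_fin ler1n.
exact: (Lfun_addr_closed mu l12).2.
Qed.

Lemma Lfun2N f : f \in Lfun mu 2%:E -> (fun x => - f x)%R \in Lfun mu 2%:E.
Proof.
have l12 : 1 <= 2%:E :> \bar R by rewrite lee_fin ler1n.
exact: Lfun_oppr_closed.
Qed.

Lemma Lfun2Z f (c : R) : f \in Lfun mu 2%:E -> (fun x => c * f x)%R \in Lfun mu 2%:E.
Proof.
move=> fL; apply: (Lfun2_le _ fL) => [|x]; last by rewrite normrM.
by apply: measurable_funM => //; exact: Lfun_measurable fL.
Qed.

Lemma Lfun2M_integrable f g : f \in Lfun mu 2%:E -> g \in Lfun mu 2%:E ->
  mu.-integrable setT (fun x => (f x * g x)%:E).
Proof. by move=> fL gL; apply/Lfun1_integrable/Lfun2_mul_Lfun1. Qed.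

(** The form in which square-integrability will be contradicted: the interval may lie anywhere and
    have any length M, and the integral of f^2 over it is at least c^2 M. *)
Lemma Lfun2_not_bounded_below f (c : R) : (0 < c)%R ->
  (forall M : R, exists a : R, {ae mu, forall x, a <= x <= a + M -> c <= `|f x|}%R) ->
  f \notin Lfun mu 2%:E.
Proof.
move=> c0 H; apply/negP => /Lfun2P[mf].
rewrite ltNge => /negP; apply; rewrite leye_eq; apply/eqP/eqyP => A A0.
have c2 : (0 < c ^+ 2)%R by rewrite exprn_gt0.
have [a aH] := H (A / c ^+ 2)%R.
have AE : A%:E = \int[mu]_(x in `[a, (a + A / c ^+ 2)%R]) (c ^+ 2)%:E.
  rewrite integral_cst//= lebesgue_measure_itv/= lte_fin ltrDl divr_gt0//.
  by rewrite -EFinB -EFinM addrC addKr mulrC divfK// gt_eqF.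
rewrite AE.
apply: (@le_trans _ _ (\int[mu]_(x in `[a, (a + A / c ^+ 2)%R]) (f x ^+ 2)%:E)).
  apply: ae_ge0_le_integral => //.
  - by move=> x _; rewrite lee_fin ltW.
  - by move=> x _; rewrite lee_fin sqr_ge0.
  - by apply/measurable_EFinP; apply: measurable_funX; exact: measurable_funS mf.
  - move: aH; apply: ae_imp => x H1; rewrite /= in_itv/= => /H1 cf.
    by rewrite lee_fin -[leRHS]real_normK ?num_real// ler_sqr ?nnegrE// ltW.
apply: ge0_subset_integral => //; first by apply/measurable_EFinP; exact: measurable_funX.
by move=> x _; rewrite lee_fin sqr_ge0.
Qed.

End SquareIntegrable.

(** * Schur's test for an exponential kernel *)

Section ExponentialKernel.
Context {R : realType}.
Notation mu := (@lebesgue_measure R).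
Implicit Types (f g h y : R -> R) (m x t a : R).

Definition exp_kernel m x t : R := expR (- (m * `|x - t|)).

Lemma exp_kernel_ge0 m x t : 0 <= exp_kernel m x t.
Proof. exact: expR_ge0. Qed.

Lemma exp_kernelC m x t : exp_kernel m x t = exp_kernel m t x.
Proof. by rewrite /exp_kernel distrC. Qed.

Lemma exp_kernel_continuous m x : continuous (exp_kernel m x).
Proof.
move=> t; apply: (@continuous_comp _ _ _ (fun t => - (m * `|x - t|)) expR); last exact: continuous_expR.
apply: cvgN; apply: cvgM; first exact: cvg_cst.
by apply: cvg_norm; apply: cvgB; [exact: cvg_cst|exact: cvg_id].
Qed.

Lemma exp_kernel_measurable m x : measurable_fun setT (exp_kernel m x).
Proof. by apply: continuous_measurable_fun; exact: exp_kernel_continuous. Qed.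

Lemma integral_exp_ray m a : 0 < m ->
  (\int[mu]_(t in `[a, +oo[) (expR (- (m * (t - a))))%:E = (m^-1)%:E)%E.
Proof.
move=> m0.
pose F t : R := - m^-1 * expR (- m * t + m * a).
have DE (t : R) : is_derive t 1 (fun t => expR (- m * t + m * a)) (- m * expR (- m * t + m * a)).
  exact: is_derive1_comp_affine.
have DF (t : R) : is_derive t 1 F (expR (- (m * (t - a)))).
  apply: (trigger_derive (is_derive1_scale (- m^-1) (DE t))).
  rewrite mulrA mulrNN mulVf ?gt_eqF// mul1r; congr expR; ring.
have cE : continuous (fun t => expR (- (m * (t - a)))).
  move=> t; have := is_derive1_continuous (DE t).
  rewrite (_ : (fun t => expR (- m * t + m * a)) = fun t => expR (- (m * (t - a))))//.
  by apply/funext => z; congr expR; ring.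
rewrite (@ge0_continuous_FTC2y _ _ F a 0).
- rewrite /F (_ : - m * a + m * a = 0); last by ring.
  by rewrite expR0 mulr1 -EFinB sub0r opprK.
- by move=> x _; exact: expR_ge0.
- exact: continuous_subspaceT.
- rewrite -[X in _ --> X](mulr0 (- m^-1)); apply: cvgM; first exact: cvg_cst.
  have := @cvgr_expR R => H.
  have : (m * t - m * a) @[t --> +oo] --> +oo.
    apply/cvgryPge => A; near=> t.
    rewrite lerBrDr [m * t]mulrC -ler_pdivrMr//; near: t; apply: nbhs_pinfty_ge; exact: num_real.
  move=> H2; have := cvg_comp _ _ H2 H.
  rewrite (_ : (_ \o _) = fun t => expR (- m * t + m * a))//.
  by apply/funext => t /=; congr expR; ring.
- by move=> x _; case: (DF x).
- by apply/cvg_at_right_filter; exact: is_derive1_continuous (DF a).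
- by move=> x _; exact: is_derive1E.
Unshelve. all: by end_near. Qed.

Lemma integral_exp_kernel m x : 0 < m ->
  (\int[mu]_t (exp_kernel m x t)%:E = (2 / m)%:E)%E.
Proof.
move=> m0.
have mE : measurable_fun setT (exp_kernel m x).
  exact: exp_kernel_measurable.
rewrite -(@setUv _ `]-oo, x]%classic) ge0_integral_setU//=; last 4 first.
- exact: measurableC.
- by apply/measurable_EFinP; rewrite setUv.
- by move=> t _; rewrite lee_fin exp_kernel_ge0.
- exact/disj_setPCl.
have -> : (\int[mu]_(t in `]-oo, x]) (exp_kernel m x t)%:E = (m^-1)%:E)%E.
  rewrite -{1}(opprK x) ge0_integration_by_substitutionNy.
  - rewrite -(integral_exp_ray (- x) m0); apply: eq_integral => t.
    rewrite inE/= in_itv/= andbT => xt; rewrite /exp_kernel.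
    by rewrite ger0_norm; [congr (expR _)%:E; ring|lra].
  - by apply: continuous_subspaceT; exact: exp_kernel_continuous.
  - by move=> t _; exact: exp_kernel_ge0.
have -> : (~` `]-oo, x]%classic = `]x, +oo[%classic :> set R).
  by rewrite setCitvl.
rewrite (_ : (\int[mu]_(t in `]x, +oo[) (exp_kernel m x t)%:E = (m^-1)%:E)%E).
  by rewrite -EFinD; congr EFin; field; rewrite gt_eqF.
rewrite integral_itv_obnd_cbnd; last by apply/measurable_EFinP; exact: measurable_funS mE.
rewrite -(integral_exp_ray x m0); apply: eq_integral => t.
rewrite inE/= in_itv/= andbT => xt; rewrite /exp_kernel distrC ger0_norm//; lra.
Qed.

Lemma exp_kernel_Lfun2 m x : 0 < m -> exp_kernel m x \in Lfun mu 2%:E.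
Proof.
move=> m0; apply/Lfun2P; split.
  exact: exp_kernel_measurable.
have -> : (\int[mu]_t (exp_kernel m x t ^+ 2)%:E = \int[mu]_t (exp_kernel (m * 2) x t)%:E)%E.
  apply: eq_integral => t _; rewrite /exp_kernel -expRM_natl; congr (expR _)%:E; ring.
by rewrite integral_exp_kernel ?mulr_gt0// ltry.
Qed.

(** Cauchy-Schwarz, with the kernel written as the square of the kernel of rate m / 2; the factor 2
    / m is the total mass of the kernel. *)
Lemma sqr_exp_kernel_integral m x h : 0 < m -> measurable_fun setT h ->
  ((\int[mu]_t (exp_kernel m x t * `|h t|)%:E) ^+ 2 <=
    (2 / m)%:E * \int[mu]_t (exp_kernel m x t * h t ^+ 2)%:E)%E.
Proof.
move=> m0 mh.
pose k t := exp_kernel (m / 2) x t.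
have mk : measurable_fun setT k by exact: exp_kernel_measurable.
have k2 t : k t ^+ 2 = exp_kernel m x t.
  by rewrite /k /exp_kernel -expRM_natl; congr expR; field.
have := @hoelder _ _ _ mu k (fun t => k t * h t) 2 2 mk (measurable_funM mk mh).
rewrite ltr0n => /(_ isT isT); have -> : (2^-1 + 2^-1 = 1 :> R) by field.
move=> /(_ erefl); rewrite Lnorm1 !Lnorm2E -poweRM ?sqr_integral_ge0//.
have -> : (\int[mu]_t `|(EFin \o (k \* (fun t => k t * h t))%R) t| =
    \int[mu]_t (exp_kernel m x t * `|h t|)%:E)%E.
  by apply: eq_integral => t _; rewrite /= mulrA -expr2 k2 normrM ger0_norm// exp_kernel_ge0.
have -> : (\int[mu]_t (k t ^+ 2)%:E = (2 / m)%:E)%E.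
  by rewrite -(integral_exp_kernel x m0); apply: eq_integral => t _; rewrite k2.
have -> : (\int[mu]_t ((k t * h t) ^+ 2)%:E = \int[mu]_t (exp_kernel m x t * h t ^+ 2)%:E)%E.
  by apply: eq_integral => t _; rewrite exprMn k2.
have I0 : (0 <= \int[mu]_t (exp_kernel m x t * h t ^+ 2)%:E)%E.
  by apply: integral_ge0 => t _; rewrite lee_fin mulr_ge0 ?sqr_ge0// exp_kernel_ge0.
have Z0 : (0 <= (2 / m)%:E * \int[mu]_t (exp_kernel m x t * h t ^+ 2)%:E)%E.
  by rewrite mule_ge0// lee_fin divr_ge0// ltW.
rewrite poweR12_sqrt// => H; rewrite -[leRHS]sqr_sqrte// lee_sqr//.
  by apply: integral_ge0 => t _; rewrite lee_fin mulr_ge0// exp_kernel_ge0.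
exact: sqrte_ge0.
Qed.

Lemma measurable_exp_kernel_sqr m h : measurable_fun setT h ->
  measurable_fun [set: R * R] (fun z => (exp_kernel m z.1 z.2 * h z.2 ^+ 2)%:E).
Proof.
move=> mh; apply/measurable_EFinP; apply: measurable_funM.
  apply: (@measurableT_comp _ _ _ _ _ _ (fun r : R => expR r)) => //.
  apply: measurableT_comp => //; apply: measurable_funM => //.
  apply: measurableT_comp => //.
  by apply: measurable_funB; [exact: measurable_fst|exact: measurable_snd].
by apply: measurable_funX; apply: measurableT_comp => //; exact: measurable_snd.
Qed.

(** By Tonelli and the symmetry of the kernel the inner integral becomes its total mass 2 / m. *)
Lemma integral_exp_kernel_swap m h : 0 < m -> measurable_fun setT h ->
  (\int[mu]_x \int[mu]_t (exp_kernel m x t * h t ^+ 2)%:E =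
    (2 / m)%:E * \int[mu]_t (h t ^+ 2)%:E)%E.
Proof.
move=> m0 mh.
have f0 z : (0 <= (exp_kernel m z.1 z.2 * h z.2 ^+ 2)%:E)%E.
  by rewrite lee_fin mulr_ge0 ?sqr_ge0// exp_kernel_ge0.
have := @fubini_tonelli _ _ _ _ R mu mu _ (measurable_exp_kernel_sqr m mh) f0.
rewrite /= => ->.
rewrite -ge0_integralZl//; last 3 first.
- by apply/measurable_EFinP; exact: measurable_funX.
- by move=> t _; rewrite lee_fin sqr_ge0.
- by rewrite lee_fin divr_ge0// ltW.
apply: eq_integral => t _.
under eq_integral do rewrite EFinM muleC.
rewrite ge0_integralZl//.
- under eq_integral do rewrite exp_kernelC.
  by rewrite integral_exp_kernel// muleC.
- by apply/measurable_EFinP; under eq_fun do rewrite exp_kernelC; exact: exp_kernel_measurable.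
- by move=> z _; rewrite lee_fin exp_kernel_ge0.
- by rewrite lee_fin sqr_ge0.
Qed.

(** Schur's test: Cauchy-Schwarz and the exchange of integrals contribute one factor 2 / m each. *)
Lemma sqr_integral_exp_kernel_le m C y h : 0 < m -> 0 <= C ->
  measurable_fun setT y -> measurable_fun setT h ->
  (forall x, (`|y x|%:E <= C%:E * \int[mu]_t (exp_kernel m x t * `|h t|)%:E)%E) ->
  (\int[mu]_x (y x ^+ 2)%:E <= ((C * (2 / m)) ^+ 2)%:E * \int[mu]_t (h t ^+ 2)%:E)%E.
Proof.
move=> m0 C0 my mh yh.
have c0 : 0 <= C ^+ 2 * (2 / m) by rewrite mulr_ge0 ?sqr_ge0// divr_ge0// ltW.
have mI : measurable_fun setT (fun x => \int[mu]_t (exp_kernel m x t * h t ^+ 2)%:E)%E.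
  have f0 z : (0 <= (exp_kernel m z.1 z.2 * h z.2 ^+ 2)%:E)%E.
    by rewrite lee_fin mulr_ge0 ?sqr_ge0// exp_kernel_ge0.
  exact: (@measurable_fun_fubini_tonelli_F _ _ _ _ R mu _ (measurable_exp_kernel_sqr m mh) f0).
apply: (@le_trans _ _ (\int[mu]_x ((C ^+ 2 * (2 / m))%:E *
    \int[mu]_t (exp_kernel m x t * h t ^+ 2)%:E)))%E.
  apply: ge0_le_integral => //.
  - by move=> x _; rewrite lee_fin sqr_ge0.
  - by apply/measurable_EFinP; exact: measurable_funX.
  - exact: measurable_funeM.
  - move=> x _; rewrite [in leRHS]EFinM -[in leRHS]muleA.
    apply: le_trans (lee_wpmul2l _ (sqr_exp_kernel_integral x m0 mh)); last by rewrite lee_fin sqr_ge0.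
    rewrite -[y x ^+ 2]real_normK ?num_real// !EFin_expe !expe2 muleACA -!expe2.
    by rewrite lee_sqr//; apply: le_trans (yh x); rewrite lee_fin.
have J0 x : (0 <= \int[mu]_t (exp_kernel m x t * h t ^+ 2)%:E)%E.
  by apply: integral_ge0 => t _; rewrite lee_fin mulr_ge0 ?sqr_ge0// exp_kernel_ge0.
rewrite ge0_integralZl//.
rewrite integral_exp_kernel_swap// muleA -EFinM.
by rewrite (_ : C ^+ 2 * (2 / m) * (2 / m) = (C * (2 / m)) ^+ 2)//; ring.
Qed.

End ExponentialKernel.

Lemma int_const (T : Type) (k : int -> T) :
  (forall n, k n = k (n + 1)) -> forall n, k n = k 0.
Proof.
move=> H; elim/int_rect => [//|n IH|n IH].
  by rewrite -IH (H n); congr k; rewrite -addn1 PoszD.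
by rewrite -IH (H (- n.+1%:Z)); congr k; lia.
Qed.

(** * The delta comb *)

Section Cells.
Context {R : realType}.
Notation mu := (@lebesgue_measure R).
Context (d : R) (d0 : 0 < d).
Implicit Types (n : int) (x y : R).

Lemma node_lt n m : (node d n < node d m) = (n < m)%R.
Proof. by rewrite /node ltr_pM2l// ltrD2r ltr_int. Qed.

Lemma node_succ n : node d (n + 1) = node d n + d.
Proof. by rewrite /node intrD; ring. Qed.

Lemma node_pred n : node d (n - 1) = node d n - d.
Proof. by rewrite /node intrD; ring. Qed.

(** Fixes the numbering of the cells: the n-th is centred at d n and has [node d n] as its right
    end. *)
Lemma cell_center n : node d (n - 1) < d * n%:~R < node d n.
Proof. by rewrite node_pred /node; apply/andP; split; have := d0; lra. Qed.

Lemma cell_off_nodes n x : node d (n - 1) < x < node d n -> off_nodes d x.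
Proof.
move=> /andP[nx xn] [m _ mx]; move: nx xn; rewrite -mx !node_lt => H1 H2.
lia.
Qed.

Lemma off_nodes_cell x : off_nodes d x -> exists n, node d (n - 1) < x < node d n.
Proof.
move=> ox; exists (Num.floor (x / d + 2^-1)).
set n := Num.floor _.
have H1 : n%:~R <= x / d + 2^-1 by exact: Num.Theory.floor_le.
have H2 : x / d + 2^-1 < n%:~R + 1.
  by have := Num.Theory.floorD1_gt (x / d + 2^-1); rewrite intrD.
have xE : x = d * (x / d) by field; rewrite gt_eqF.
rewrite node_pred /node; apply/andP; split.
  rewrite lt_neqAle; apply/andP; split.
    apply/eqP => H; apply: ox; exists (n - 1) => //.
    by rewrite node_pred /node.
  rewrite [leRHS]xE (_ : _ - d = d * (n%:~R - 2^-1)); last by field.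
  by rewrite ler_pM2l//; lra.
by rewrite [ltLHS]xE ltr_pM2l//; lra.
Qed.

Lemma open_off_nodes : open (off_nodes d).
Proof.
rewrite openE => x /off_nodes_cell[n /andP[nx xn]].
near=> z; apply: (@cell_off_nodes n); apply/andP; split; near: z.
- exact: near_gt.
- exact: near_lt.
Unshelve. all: by end_near. Qed.

Lemma near_off_nodes x : off_nodes d x -> \forall z \near x, off_nodes d z.
Proof. by move=> ox; have := open_off_nodes; rewrite openE => /(_ x ox). Qed.

Lemma ae_off_nodes : {ae mu, forall x, off_nodes d x}.
Proof.
have cN : countable (range (node d)).
  by apply: (sub_countable (card_image_le _ _)); exact: countableP.
exists (range (node d)); split.
- exact: countable_measurable.
- exact: countable_lebesgue_measure0.
- by move=> x /= ox; apply: contrapT => nx; exact: ox.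
Qed.

Lemma near_right_cell n : \forall z \near (node d n)^'+, node d n < z < node d (n + 1).
Proof.
near=> z; apply/andP; split; near: z; first exact: nbhs_right_gt.
by apply: nbhs_right_lt; rewrite node_succ ltrDl.
Unshelve. all: by end_near. Qed.

Lemma near_left_cell n : \forall z \near (node d n)^'-, node d (n - 1) < z < node d n.
Proof.
near=> z; apply/andP; split; near: z; last exact: nbhs_left_lt.
by apply: nbhs_left_gt; rewrite node_pred gtrDl oppr_lt0.
Unshelve. all: by end_near. Qed.

(** A quantity conserved in each cell is conserved globally once its one-sided limits at each node
    agree. No value at a node enters, since the derivatives in the Wronskian need not exist
    there. *)
Lemma glue_cells (K : R -> R) :
  (forall n x y, node d (n - 1) < x -> x <= y -> y < node d n -> K x = K y) ->
  (forall n, exists l : R, K y @[y --> (node d n)^'-] --> l /\ K y @[y --> (node d n)^'+] --> l) ->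
  forall x y, off_nodes d x -> off_nodes d y -> K x = K y.
Proof.
move=> cst lim.
have cell n x : node d (n - 1) < x < node d n -> K x = K (d * n%:~R).
  move=> /andP[nx xn]; have /andP[nc cn] := cell_center n.
  have [xc|/ltW cx] := leP x (d * n%:~R); first exact: (cst n).
  by apply/esym; exact: (cst n).
have H n : K (d * n%:~R) = K (d * (n + 1)%:~R).
  have [l [ll lr]] := lim n.
  have L1 : l = K (d * n%:~R).
    apply: (cvg_unique _ ll) => //.
    apply: cvg_near_cst; near=> z; apply: cell; near: z; exact: near_left_cell.
  have L2 : l = K (d * (n + 1)%:~R).
    apply: (cvg_unique _ lr) => //.
    apply: cvg_near_cst; near=> z; apply: cell; rewrite addrK; near: z; exact: near_right_cell.
  by rewrite -L1.
have {}H := @int_const R (fun n => K (d * n%:~R)) H.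
by move=> x y /off_nodes_cell[n /cell ->] /off_nodes_cell[m /cell ->]; rewrite H (H m).
Unshelve. all: by end_near. Qed.

Lemma glue_cells_continuous (K : R -> R) : continuous K ->
  (forall n x y, node d (n - 1) < x -> x <= y -> y < node d n -> K x = K y) ->
  forall x y, K x = K y.
Proof.
move=> cK cst.
have off : forall x y, off_nodes d x -> off_nodes d y -> K x = K y.
  apply: glue_cells => // n; exists (K (node d n)); split.
    by apply: cvg_at_left_filter; exact: cK.
  by apply: cvg_at_right_filter; exact: cK.
have o0 : off_nodes d (d * 0%:~R) by exact: cell_off_nodes (cell_center 0).
suff all0 x : K x = K (d * 0%:~R) by move=> x y; rewrite all0 (all0 y).
have [ox|/contrapT[n _ <-]] := pselect (off_nodes d x); first exact: off.
have L : K y @[y --> (node d n)^'-] --> K (node d n) by apply: cvg_at_left_filter; exact: cK.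
apply: (cvg_unique _ L) => //.
apply: cvg_near_cst; near=> z; apply: off => //; apply: (@cell_off_nodes n).
near: z; exact: near_left_cell.
Unshelve. all: by end_near. Qed.

End Cells.

(** * The Wronskian identity across the nodes *)

Section Wronskian.
Context {R : realType}.
Notation mu := (@lebesgue_measure R).
Context (d : R) (d0 : 0 < d) (beta : R).
Implicit Types (f g h psi : R -> R) (lam x y : R) (n : int).
Local Notation intb f a b := (mu.-integrable `[a, b] (EFin \o f)).

(** The operator on real functions: beta and the spectral parameter are real, so real and imaginary
    parts of a domain element decouple. *)
Definition h_real f g : Prop :=
  [/\ continuous f,
      exists f1, [/\ f \in Lfun mu 2%:E, f1 \in Lfun mu 2%:E,
        (fun x => - g x) \in Lfun mu 2%:E,
        weak_derivative (off_nodes d) f f1 &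
        weak_derivative (off_nodes d) f1 (fun x => - g x)] &
      forall n, derivative_jump f (node d n) (beta * f (node d n))].

(** A positive generalized solution, with no integrability required. [psi1] is a version of the
    derivative whose values at the nodes are arbitrary; only its one-sided limits there matter. *)
Definition comb_solution lam psi (psi1 : R -> R) : Prop :=
  [/\ continuous psi, forall x, 0 < psi x,
      forall x, off_nodes d x -> is_derive x 1 psi (psi1 x),
      forall x, off_nodes d x -> is_derive x 1 psi1 (- (lam * psi x)) &
      forall n, exists l r : R, [/\ psi1 y @[y --> (node d n)^'-] --> l,
        psi1 y @[y --> (node d n)^'+] --> r & r - l = beta * psi (node d n)]].

Lemma ae_forall_int (Q : int -> R -> Prop) : (forall n, {ae mu, forall x, Q n x}) ->
  {ae mu, forall x, forall n, Q n x}.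
Proof.
move=> H.
have N1 : mu.-negligible (\bigcup_(i : nat) ~` [set x | Q (Posz i) x]).
  by apply: negligible_bigcup => i; exact: H.
have N2 : mu.-negligible (\bigcup_(i : nat) ~` [set x | Q (Negz i) x]).
  by apply: negligible_bigcup => i; exact: H.
apply: negligibleS (negligibleU N1 N2) => x /= /existsNP[[i|i] nQ].
  by left; exists i.
by right; exists i.
Qed.

(** With a primitive J on the whole line, an identity for the increments of the Wronskian P becomes
    constancy of P + J, to which [glue_cells] applies. *)
Lemma global_primitive h : (forall a b, intb h a b) -> exists J : R -> R,
  continuous J /\ forall x y, x <= y -> J y - J x = \int[mu]_(t in `[x, y]) h t.
Proof.
move=> hi.
pose J x := if 0 <= x then \int[mu]_(t in `[0, x]) h t else - \int[mu]_(t in `[x, 0]) h t.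
have JE x y : x <= y -> J y - J x = \int[mu]_(t in `[x, y]) h t.
  move=> xy; rewrite /J; case: ifPn => [y0|]; case: ifPn => [x0|].
  - rewrite (@Rintegral_split _ h 0 x y) ?x0//; ring.
  - rewrite -ltNge => /ltW x0; rewrite (@Rintegral_split _ h x 0 y) ?x0//; ring.
  - by rewrite (le_trans x0 xy).
  - rewrite -ltNge => x0; rewrite -ltNge => /ltW y0.
    rewrite (@Rintegral_split _ h x y 0) ?xy//; ring.
exists J; split=> // x.
have xx : x - 1 < x + 1 by lra.
have : {within `[x - 1, x + 1], continuous J}.
  apply: (@primitive_within_continuous _ J h) => //; first exact: ltW.
  by move=> z z1 _; exact: JE.
move=> /(@within_continuous_continuous _ _ _ _ _ _ x xx); apply.
rewrite in_itv/=; apply/andP; split; lra.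
Qed.

Section Identity.
Context (lam : R) (psi psi1 f g : R -> R).
Hypotheses (psiS : comb_solution lam psi psi1) (fg : h_real f g).
Let P x := psi x * derive1 f x - psi1 x * f x.

Lemma comb_solution_within_continuous n x y :
  node d (n - 1) < x -> y < node d n -> {within `[x, y], continuous psi1}.
Proof.
case: psiS => _ _ _ D1 _ nx yn.
apply: derivable_within_continuous => t; rewrite in_itv/= => /andP[xt ty].
have ot : off_nodes d t.
  by apply: (@cell_off_nodes _ _ d0 n); rewrite (lt_le_trans nx)//= (le_lt_trans ty).
by case: (D1 t ot).
Qed.

(** Inside a cell f' is a primitive of - g by regularity. The product rules for psi f' and for psi'
    f share the term psi' f', which cancels. *)
Lemma wronskian_cell n x y : node d (n - 1) < x -> x <= y -> y < node d n ->
  P y - P x = - \int[mu]_(t in `[x, y]) (psi t * (g t - lam * f t)).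
Proof.
move=> nx xy yn; case: fg => cf [f1 [fL f1L gL wf wf1]] _.
have U : `]node d (n - 1), node d n[%classic `<=` off_nodes d.
  by move=> t; rewrite /= in_itv/=; exact: cell_off_nodes.
have nn : node d (n - 1) < node d n by rewrite node_lt//; lia.
have [Df k' _] := weak_derivative2_regular nn U f1L gL cf wf wf1.
case: psiS => cpsi psi0 D0 D1 _.
have ot t : x <= t <= y -> off_nodes d t.
  move=> /andP[xt ty]; apply: (@cell_off_nodes _ _ d0 n).
  by rewrite (lt_le_trans nx)//= (le_lt_trans ty).
have gi := Lfun2_integrable_segment x y gL.
have cpsi1 := comb_solution_within_continuous nx yn.
have kE a b : x <= a -> a <= b -> b <= y ->
    derive1 f b - derive1 f a = \int[mu]_(t in `[a, b]) (- g t).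
  by move=> xa ab b_y; apply: k' => //; [exact: lt_le_trans xa|exact: le_lt_trans yn].
have ck : {within `[x, y], continuous (derive1 f)}.
  by apply: (primitive_within_continuous xy gi) => z xz zy; exact: kE.
have R1 := primitive_product_rule xy gi kE (fun t ht => D0 t (ot t ht)) cpsi1.
have ci q : {within `[x, y], continuous q} -> intb q x y.
  by move=> cq; apply: continuous_compact_integrable => //; exact: segment_compact.
have fE a b : x <= a -> a <= b -> b <= y -> f b - f a = \int[mu]_(t in `[a, b]) (derive1 f t).
  move=> xa ab b_y; apply/esym; apply: Rintegral_derive_segment => //.
    move=> t /andP[at' tb]; apply/derivable1_is_derive/Df.
    by rewrite (lt_le_trans nx (le_trans xa at'))//= (le_lt_trans tb (le_lt_trans b_y yn)).
  exact: within_continuousS ck.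
have cpsiw : {within `[x, y], continuous psi} by exact: continuous_subspaceT.
have clpsi : {within `[x, y], continuous (fun t => - (lam * psi t))}.
  by apply: continuous_subspaceT => t; apply: cvgN; apply: cvgM; [exact: cvg_cst|exact: cpsi].
have R2 := primitive_product_rule xy (ci _ ck) fE (fun t ht => D1 t (ot t ht)) clpsi.
have cfw : {within `[x, y], continuous f} by exact: continuous_subspaceT.
have i1 : intb (fun t => psi1 t * derive1 f t) x y.
  by apply: integrable_segmentM => //; exact: ci.
have i2 : intb (fun t => psi t * (- g t)) x y.
  by have := integrable_segmentM gi cpsiw; apply: eq_integrable => // t _; rewrite /= mulrC.
have i3 : intb (fun t => - (lam * psi t) * f t) x y.
  by apply: integrable_segmentM => //; exact: ci.
have -> : P y - P x = (psi y * derive1 f y - psi x * derive1 f x) - (psi1 y * f y - psi1 x * f x).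
  by rewrite /P; ring.
rewrite R1 R2 -Rintegral_segmentB; [|exact: integrable_segmentD..].
rewrite -mulN1r -Rintegral_segmentZ; last first.
  have := integrable_segmentB i3 i2; apply: eq_integrable => // t _ /=; congr EFin; ring.
by apply: eq_Rintegral => t _; ring.
Qed.

(** At a node f' jumps by beta f and psi' by beta psi, so the jumps of psi f' and psi' f cancel in
    the Wronskian. *)
Lemma wronskian_increment x y : off_nodes d x -> off_nodes d y -> x <= y ->
  P y - P x = - \int[mu]_(t in `[x, y]) (psi t * (g t - lam * f t)).
Proof.
move=> ox oy xy.
have cpsi : continuous psi by case: psiS.
have cf : continuous f by case: fg.
have qi a b : intb (fun t => psi t * (g t - lam * f t)) a b.
  case: fg => _ [f1 [fL f1L gL _ _]] _.
  have q2 : intb (fun t => (g t - lam * f t)) a b.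
    have := Lfun2_integrable_segment a b (Lfun2N (Lfun2D gL (Lfun2Z lam fL))).
    by apply: eq_integrable => // t _ /=; congr EFin; ring.
  by have := integrable_segmentMc q2 cpsi; apply: eq_integrable => // t _; rewrite /= mulrC.
have [J [cJ JE]] := global_primitive qi.
suff K : forall x y, off_nodes d x -> off_nodes d y -> P x + J x = P y + J y.
  by rewrite -JE//; have := K x y ox oy; lra.
apply: (glue_cells d0) => [n a b na ab bn|n].
  by have := wronskian_cell na ab bn; rewrite -JE//; lra.
case: psiS => _ _ _ _ /(_ n)[pl [pr [cpl cpr plr]]].
case: fg => _ _ /(_ n)[fl [fr [cfl cfr flr]]].
exists (psi (node d n) * fl - pl * f (node d n) + J (node d n)).
have Cl (q : R -> R) : continuous q -> q y @[y --> (node d n)^'-] --> q (node d n).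
  by move=> cq; apply: cvg_at_left_filter; exact: cq.
have Cr (q : R -> R) : continuous q -> q y @[y --> (node d n)^'+] --> q (node d n).
  by move=> cq; apply: cvg_at_right_filter; exact: cq.
split.
  by apply: cvgD; [apply: cvgB; apply: cvgM|]; try exact: Cl.
have -> : psi (node d n) * fl - pl * f (node d n) = psi (node d n) * fr - pr * f (node d n).
  have -> : fr = fl + beta * f (node d n) by rewrite -flr; ring.
  have -> : pr = pl + beta * psi (node d n) by rewrite -plr; ring.
  by ring.
by apply: cvgD; [apply: cvgB; apply: cvgM|]; try exact: Cr.
Qed.

(** Divided by psi, the Wronskian is dominated by |f'| + |K| |f|, which is in L^2. This excludes a
    nonzero constant Wronskian wherever psi stays bounded on arbitrarily long intervals. *)
Lemma wronskian_ae_bound K : (forall x, off_nodes d x -> `|psi1 x| <= K * psi x) ->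
  exists2 F, F \in Lfun mu 2%:E & {ae mu, forall x, off_nodes d x /\ `|P x| / psi x <= `|F x|}.
Proof.
move=> HK; case: (fg) => cf [f1 [fL f1L gL wf wf1]] _.
have psi0 : forall x, 0 < psi x by case: psiS.
have nL (q : R -> R) : q \in Lfun mu 2%:E -> (fun x => `|q x|) \in Lfun mu 2%:E.
  move=> qL; apply: (@Lfun2_le _ _ q 1) => //.
    by apply: measurableT_comp => //; exact: Lfun_measurable qL.
  by move=> x; rewrite normr_id mul1r.
exists (fun x => `|f1 x| + `|K| * `|f x|).
  by apply: Lfun2D; [exact: nL|apply: Lfun2Z; exact: nL].
have f1ae : {ae mu, forall x, off_nodes d x -> f1 x = derive1 f x}.
  have cell (n : int) : {ae mu, forall x, node d (n - 1) < x < node d n -> f1 x = derive1 f x}.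
    have U : `]node d (n - 1), node d n[%classic `<=` off_nodes d.
      by move=> t; rewrite /= in_itv/=; exact: cell_off_nodes.
    have nn : node d (n - 1) < node d n by rewrite node_lt//; lia.
    by have [] := weak_derivative2_regular nn U f1L gL cf wf wf1.
  have := ae_forall_int cell; apply: ae_imp => x Hx /(off_nodes_cell d0)[n nx].
  exact: Hx nx.
have := ae_off_nodes d; move: f1ae; apply: ae_imp2 => x f1x ox; split=> //.
have px := psi0 x.
rewrite ler_pdivrMr// /P -f1x// [leRHS]mulrC.
have s0 : 0 <= `|f1 x| + `|K| * `|f x| by rewrite addr_ge0 ?mulr_ge0.
rewrite (ger0_norm s0).
apply: le_trans (ler_normB _ _) _; rewrite mulrDr !normrM (gtr0_norm px).
rewrite lerD2l mulrCA mulrA ler_wpM2r//.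
by apply: le_trans (HK x ox) _; rewrite ler_pM2r// ler_norm.
Qed.

End Identity.

Lemma derive0_off_nodes_cst (K : R -> R) : continuous K ->
  (forall x : R, off_nodes d x -> is_derive x 1 K 0) -> forall x y, K x = K y.
Proof.
move=> cK DK; apply: (glue_cells_continuous d0) => // n x y nx xy yn.
have [] := @MVT_segment _ K (fun=> 0) x y xy.
- move=> t; rewrite in_itv/= => /andP[xt ty]; apply: DK; apply: (@cell_off_nodes _ _ d0 n).
  by rewrite (lt_trans nx xt)/= (lt_trans ty yn).
- exact: continuous_subspaceT.
- by move=> c _; rewrite mul0r => /eqP; rewrite subr_eq0 => /eqP.
Qed.

(** The bound compares any two points. It therefore also keeps psi above a positive constant on the
    left half-line, and it controls both kernels of the factorization. *)
Definition decaying psi := exists m C : R, [/\ 0 < m, 0 < C &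
  forall x t, x <= t -> psi t <= C * expR (- (m * (t - x))) * psi x].

(** The Wronskian is constant, and since psi is bounded on the right half-line [wronskian_ae_bound]
    forces it to be 0. Then f is a multiple of psi, which is bounded below on the left half-line, so
    the multiple is 0. *)
Lemma h_real_injective lam psi (psi1 : R -> R) K f g : comb_solution lam psi psi1 ->
  (forall x, off_nodes d x -> `|psi1 x| <= K * psi x) -> decaying psi ->
  h_real f g -> {ae mu, forall x, g x = lam * f x} -> forall x, f x = 0.
Proof.
move=> psiS HK [m [C [m0 C0 dec]]] fg gf.
have [cpsi psi0 D0 D1 _] := psiS.
have cf : continuous f by case: fg.
pose P x := psi x * derive1 f x - psi1 x * f x.
have PE x y : off_nodes d x -> off_nodes d y -> x <= y -> P x = P y.
  move=> ox oy xy; apply/eqP; rewrite eq_sym -subr_eq0 /P (wronskian_increment psiS fg)//.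
  rewrite oppr_eq0; apply/eqP.
  have [f1 [fL f1L gL _ _]] : exists f1, [/\ f \in Lfun mu 2%:E, f1 \in Lfun mu 2%:E,
        (fun x => - g x) \in Lfun mu 2%:E,
        weak_derivative (off_nodes d) f f1 &
        weak_derivative (off_nodes d) f1 (fun x => - g x)] by case: fg.
  have i0 : intb (fun=> 0) x y by exact: integrable_segment_cst.
  rewrite (@Rintegral_ae_eq _ _ (fun=> 0) x y) ?Rintegral_segment_cst ?mul0r//.
    have := Lfun2_integrable_segment x y (Lfun2N (Lfun2D gL (Lfun2Z lam fL))) => q2.
    have := integrable_segmentMc q2 cpsi; apply: eq_integrable => // t _ /=; congr EFin; ring.
  by move: gf; apply: ae_imp => t -> _; rewrite subrr mulr0.
have o0 : off_nodes d (d * 0%:~R) by exact: cell_off_nodes (cell_center d0 0).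
pose c := P (d * 0%:~R).
have Pc x : off_nodes d x -> P x = c.
  by move=> ox; have [h|/ltW h] := leP x (d * 0%:~R); [apply: PE|apply/esym/PE].
have c0 : c = 0.
  apply/eqP; apply: contraT => cn0.
  have [F FL Fae] := wronskian_ae_bound psiS fg HK.
  have dlt : 0 < `|c| / (C * psi 0) by rewrite divr_gt0 ?normr_gt0// mulr_gt0.
  suff : F \notin Lfun mu 2%:E by rewrite FL.
  apply: (Lfun2_not_bounded_below dlt).
  move=> M; exists 0; move: Fae; apply: ae_imp => x [ox Fx] /andP[x0 _].
  apply: le_trans Fx; rewrite -/(P x) Pc// ler_pM2l ?normr_gt0// lef_pV2 ?posrE ?mulr_gt0//.
  apply: le_trans (dec 0 x x0) _; rewrite ler_pM2r// ler_piMr ?(ltW C0)// expR_le1.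
  by rewrite oppr_le0 mulr_ge0 ?(ltW m0)// subr0.
have Df x : off_nodes d x -> is_derive x 1 f (derive1 f x).
  move=> ox; apply: derivable1_is_derive.
  have [n nx] := off_nodes_cell d0 ox.
  case: fg => _ [f1 [fL f1L gL wf wf1]] _.
  have U : `]node d (n - 1), node d n[%classic `<=` off_nodes d.
    by move=> t; rewrite /= in_itv/=; exact: cell_off_nodes.
  have nn : node d (n - 1) < node d n by rewrite node_lt//; lia.
  by have [Df _ _] := weak_derivative2_regular nn U f1L gL cf wf wf1; exact: Df.
have psin0 x : psi x != 0 by rewrite gt_eqF.
have qc : forall x y, f x / psi x = f y / psi y.
  apply: (@derive0_off_nodes_cst (fun x => f x / psi x)).
    by move=> x; apply: cvgM; [exact: cf|apply: cvgV => //; exact: cpsi].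
  move=> x ox; apply: (trigger_derive (is_derive1_div (psin0 x) (Df x ox) (D0 x ox))).
  have := Pc x ox; rewrite c0 /P => H.
  by rewrite (_ : _ - _ = 0) ?mul0r// -H; ring.
have fE x : f x = f 0 / psi 0 * psi x by rewrite -(qc x) divfK.
suff a0 : f 0 / psi 0 = 0 by move=> x; rewrite fE a0 mul0r.
apply/eqP; apply: contraT => an0.
have fL : f \in Lfun mu 2%:E by case: fg => _ [f1 []].
have dlt : 0 < `|f 0 / psi 0| * (psi 0 / C) by rewrite mulr_gt0 ?normr_gt0// divr_gt0.
suff : f \notin Lfun mu 2%:E by rewrite fL.
apply: (Lfun2_not_bounded_below dlt).
move=> M; exists (- M); apply: aeW => x; rewrite addNr => /andP[_ x0].
have -> : `|f x| = `|f 0 / psi 0| * psi x by rewrite {1}(fE x) normrM (gtr0_norm (psi0 x)).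
rewrite ler_pM2l ?normr_gt0// ler_pdivrMr// mulrC.
apply: le_trans (dec x 0 x0) _; rewrite ler_pM2r// ler_piMr ?(ltW C0)// expR_le1.
by rewrite oppr_le0 mulr_ge0 ?(ltW m0)// sub0r oppr_ge0.
Qed.

End Wronskian.

(** * Integrals against exponentially bounded kernels *)

Section KernelIntegral.
Context {R : realType}.
Notation mu := (@lebesgue_measure R).
Implicit Types (k h : R -> R) (m C x : R) (A : set R).

Lemma kernel_integrable A m C x k h : measurable A -> measurable_fun setT k ->
  h \in Lfun mu 2%:E -> 0 < m -> 0 <= C ->
  (forall t, A t -> `|k t| <= C * exp_kernel m x t) ->
  mu.-integrable A (EFin \o (fun t => k t * h t)).
Proof.
move=> mA mk hL m0 C0 kC; have mh := Lfun_measurable hL.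
have I := integrableZl measurableT C (Lfun2M_integrable (exp_kernel_Lfun2 x m0) hL).
have IA : mu.-integrable A (fun t => C%:E * (exp_kernel m x t * h t)%:E)%E.
  exact: integrableS I.
apply: (le_integrable _ _ _ IA) => //.
  apply/measurable_EFinP; apply: measurable_funS (measurable_funM mk mh) => //.
move=> t At; rewrite /= lee_fin !normrM mulrA ler_wpM2r//.
by rewrite (le_trans (kC t At))// !ger0_norm// exp_kernel_ge0.
Qed.

Lemma kernel_Rintegral_le A m C x k h : measurable A -> measurable_fun setT k ->
  h \in Lfun mu 2%:E -> 0 < m -> 0 <= C ->
  (forall t, A t -> `|k t| <= C * exp_kernel m x t) ->
  (`|\int[mu]_(t in A) (k t * h t)|%:E <=
    C%:E * \int[mu]_t (exp_kernel m x t * `|h t|)%:E)%E.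
Proof.
move=> mA mk hL m0 C0 kC; have mh := Lfun_measurable hL.
have I := kernel_integrable mA mk hL m0 C0 kC.
rewrite EFin_normr_Rintegral//.
apply: le_trans (le_abse_integral _ _ _) _ => //; first exact: measurable_int I.
have mEh : measurable_fun setT (fun t => exp_kernel m x t * `|h t|).
  apply: measurable_funM; first exact: exp_kernel_measurable.
  exact: measurableT_comp.
rewrite -ge0_integralZl//; last 2 first.
- by apply/measurable_EFinP.
- by move=> t _; rewrite lee_fin mulr_ge0// exp_kernel_ge0.
apply: (@le_trans _ _ (\int[mu]_(t in A) (C%:E * (exp_kernel m x t * `|h t|)%:E))%E).
  apply: ge0_le_integral => //.
  - by apply: measurableT_comp => //; exact: measurable_int I.
  - by apply/measurable_EFinP; apply: measurable_funM => //; exact: measurable_funS mEh.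
  - move=> t At; rewrite /= lee_fin normrM mulrA ler_wpM2r//; exact: kC.
apply: ge0_subset_integral => //.
- by apply/measurable_EFinP; exact: measurable_funM.
- by move=> t _; rewrite -EFinM lee_fin !mulr_ge0// exp_kernel_ge0.
Qed.

End KernelIntegral.

(** * The resolvent below the spectrum *)

Section Resolvent.
Context {R : realType}.
Notation mu := (@lebesgue_measure R).
Context (d : R) (d0 : 0 < d) (beta : R).
Local Notation intb f a b := (mu.-integrable `[a, b] (EFin \o f)).

(** A test function vanishes near each node, so its product with a function that is continuously
    differentiable off the nodes is so on the whole line, whatever the jumps. *)
Lemma test_function_near_zero (phi : R -> R) : test_function (off_nodes d) phi ->
  forall x, off_nodes d x \/ \forall z \near x, phi z = 0.
Proof.
move=> [_ [K [cK KU phi0]]] x.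
have [|ox] := pselect (off_nodes d x); first by left.
right; have oK : open (~` K) by apply: closed_openC; exact: compact_closed.
have Kx : (~` K) x by move=> /KU.
by move: oK; rewrite openE => /(_ x Kx); apply: filterS => z; exact: phi0.
Qed.

Lemma test_function_support (phi : R -> R) (U : set R) : test_function U phi ->
  exists2 N : R, 0 < N & forall x, N < `|x| -> \forall z \near x, phi z = 0.
Proof.
move=> [_ [K [cK KU phi0]]]; have [M [_ HM]] := compact_bounded cK.
exists (`|M| + 1); first by rewrite ltr_wpDl.
move=> x Nx; have oK : open (~` K) by apply: closed_openC; exact: compact_closed.
have Kx : (~` K) x.
  move=> Kx; have := HM (`|M| + 1); rewrite (le_lt_trans (ler_norm _)) ?ltrDl//.
  by move=> /(_ isT x Kx)/=; rewrite leNgt Nx.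
by move: oK; rewrite openE => /(_ x Kx); apply: filterS => z; exact: phi0.
Qed.

Lemma near_eq_continuous (F G : R -> R) (x : R) : (\forall z \near x, F z = G z) ->
  {for x, continuous F} -> {for x, continuous G}.
Proof.
move=> FG cF; rewrite /prop_for /continuous_at -(nbhs_singleton FG).
by apply: cvg_trans cF; apply: near_eq_cvg; apply: filterS FG => z ->.
Qed.

Lemma near_zero_is_derive (F : R -> R) (x : R) : (\forall z \near x, F z = 0) -> is_derive x 1 F 0.
Proof.
move=> Fz; apply: (is_derive1_near _ (is_derive1_cst x 0)).
by apply: filterS Fz => z ->.
Qed.

Lemma near_zero_derive1 (F : R -> R) (x : R) : (\forall z \near x, F z = 0) ->
  \forall z \near x, derive1 F z = 0.
Proof.
by move=> /near_join; apply: filterS => z /near_zero_is_derive/is_derive1E.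
Qed.

Lemma near_zero_continuous (F : R -> R) (x : R) : (\forall z \near x, F z = 0) ->
  {for x, continuous F}.
Proof. by move=> /near_zero_is_derive/is_derive1_continuous. Qed.

Lemma Rintegral_derive_supp (F F' : R -> R) (N : R) : 0 < N ->
  (forall x : R, is_derive x 1 F (F' x)) -> continuous F' ->
  (forall x, N <= `|x| -> F x = 0) -> \int[mu]_(t in `[- N, N]) F' t = 0.
Proof.
move=> N0 DF cF' F0; rewrite (@Rintegral_derive _ F F')//; last by lra.
by rewrite !F0 ?subrr// ?normrN ger0_norm// ltW.
Qed.

Section Construction.
Context (lam K m C : R) (psi psi1 h : R -> R).
Hypotheses (psiS : comb_solution d beta lam psi psi1).
Hypothesis psiK : forall x, off_nodes d x -> `|psi1 x| <= K * psi x.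
Hypotheses (m0 : 0 < m) (C0 : 0 < C).
Hypothesis dec : forall x t : R, x <= t -> psi t <= C * expR (- (m * (t - x))) * psi x.
Hypothesis hL : h \in Lfun mu 2%:E.

(* Reduction of order: f / psi = Q solves (psi^2 Q')' = - psi h. *)
Let P x := \int[mu]_(t in `[x, +oo[) (psi t * h t).
Let y x := P x / psi x.
Let Q x := \int[mu]_(t in `]-oo, x]) ((psi t)^-1 * y t).
Let f x := psi x * Q x.
(** [psi1] is arbitrary at the nodes; the value 0 there makes the candidate derivative measurable
    and dominated by |K| |f| + |y| everywhere. *)
Let f1 : R -> R := (fun x => psi1 x * Q x + y x) \_ (off_nodes d).

Let psi_gt0 x : 0 < psi x. Proof. by case: psiS. Qed.

Let psi_neq0 x : psi x != 0. Proof. by rewrite gt_eqF. Qed.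

Let cpsi : continuous psi. Proof. by case: psiS. Qed.

Let mpsi : measurable_fun setT psi. Proof. exact: continuous_measurable_fun. Qed.

Let cpsiV : continuous (fun x => (psi x)^-1).
Proof. by move=> x; apply: cvgV => //; exact: cpsi. Qed.

Let mpsiV : measurable_fun setT (fun x => (psi x)^-1).
Proof. exact: continuous_measurable_fun. Qed.

(** This bound and the next read [dec] in either variable: psi (t) / psi (x) for t >= x and psi (x)
    / psi (t) for t <= x have the same exponential majorant. *)
Let psi_kernel x t : t \in `[x, +oo[ -> `|psi t| <= C * psi x * exp_kernel m x t.
Proof.
rewrite in_itv/= andbT => xt; rewrite gtr0_norm//.
apply: le_trans (dec xt) _; rewrite /exp_kernel distrC ger0_norm ?subr_ge0//.
by rewrite -mulrA [expR _ * _]mulrC mulrA.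
Qed.

Let psiV_kernel x t : t \in `]-oo, x] -> `|(psi t)^-1| <= C / psi x * exp_kernel m x t.
Proof.
rewrite in_itv/= => tx; rewrite gtr0_norm ?invr_gt0//.
rewrite /exp_kernel ger0_norm ?subr_ge0//.
rewrite mulrAC ler_pdivlMr// ler_pdivrMl//.
by apply: le_trans (dec tx) _; rewrite mulrC.
Qed.

Let psih_int x : mu.-integrable `[x, +oo[ (EFin \o (fun t => psi t * h t)).
Proof.
apply: (@kernel_integrable _ _ m (C * psi x) x) => //; first by rewrite mulr_ge0 ?ltW.
by move=> t; exact: psi_kernel.
Qed.

Let psih_intb a b : intb (fun t => psi t * h t) a b.
Proof.
by have := integrable_segmentMc (Lfun2_integrable_segment a b hL) cpsi;
  apply: eq_integrable => // t _; rewrite /= mulrC.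
Qed.

Let PE x z : x <= z -> P z - P x = - \int[mu]_(t in `[x, z]) (psi t * h t).
Proof.
move=> xz; have := @Rintegral_itvB R (fun t => psi t * h t) (BLeft x) +oo%O z (psih_int x).
rewrite !bnd_simp => /(_ xz isT) H.
rewrite /P -(Rintegral_itv_obnd_cbnd (r := z)); last first.
  by apply: integrableS (psih_int z) => //; apply: subset_itv; rewrite bnd_simp.
by rewrite -H; ring.
Qed.

Let cP : continuous P.
Proof.
have [J [cJ JE]] := global_primitive psih_intb.
have PJ x : P x = P 0 + J 0 - J x.
  have [x0|/ltW x0] := leP 0 x; [have := PE x0|have := PE x0]; rewrite -JE//; lra.
rewrite (_ : P = fun x => P 0 + J 0 - J x); last exact/funext.
by move=> x; apply: cvgB; [exact: cvg_cst|exact: cJ].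
Qed.

Let cy : continuous y.
Proof. by move=> x; apply: cvgM; [exact: cP|exact: cpsiV]. Qed.

Let my : measurable_fun setT y. Proof. exact: continuous_measurable_fun. Qed.

Let A := C * (2 / m).

Let A_ge0 : 0 <= A. Proof. by rewrite mulr_ge0 ?divr_ge0// ltW. Qed.

Let y_le : (\int[mu]_x (y x ^+ 2)%:E <= (A ^+ 2)%:E * \int[mu]_t (h t ^+ 2)%:E)%E.
Proof.
apply: sqr_integral_exp_kernel_le => //; [exact: ltW|exact: Lfun_measurable hL|].
move=> x; rewrite /y normrM normfV (gtr0_norm (psi_gt0 x)) mulrC EFinM.
rewrite [C](_ : C = (psi x)^-1 * (C * psi x)); last by field.
rewrite EFinM -muleA lee_wpmul2l ?lee_fin ?invr_ge0 ?(ltW (psi_gt0 x))//.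
apply: (@kernel_Rintegral_le _ _ m (C * psi x) x) => //; first by rewrite mulr_ge0 ?ltW.
by move=> t; exact: psi_kernel.
Qed.

Let yL : y \in Lfun mu 2%:E.
Proof.
apply/Lfun2P; split=> //; apply: le_lt_trans y_le _.
by rewrite lte_mul_pinfty ?lee_fin ?sqr_ge0//; case/Lfun2P: hL.
Qed.

Let Qint x : mu.-integrable `]-oo, x] (EFin \o (fun t => (psi t)^-1 * y t)).
Proof.
apply: (@kernel_integrable _ _ m (C / psi x) x) => //; first by rewrite divr_ge0 ?ltW.
by move=> t; exact: psiV_kernel.
Qed.

Let cq : continuous (fun t => (psi t)^-1 * y t).
Proof. by move=> x; apply: cvgM; [exact: cpsiV|exact: cy]. Qed.

Let DQ (x : R) : is_derive x 1 Q ((psi x)^-1 * y x).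
Proof.
have [] := @continuous_FTC1 R (fun t => (psi t)^-1 * y t) -oo%O x (x + 1).
- by rewrite ltrDl.
- exact: Qint.
- by rewrite ltNyr.
- exact: cq.
- by move=> DF <-; exact: derivable1_is_derive.
Qed.

Let cQ : continuous Q. Proof. by move=> x; exact: is_derive1_continuous (DQ x). Qed.

Let cf : continuous f. Proof. by move=> x; apply: cvgM; [exact: cpsi|exact: cQ]. Qed.

Let mf : measurable_fun setT f. Proof. exact: continuous_measurable_fun. Qed.

Let f_le : (\int[mu]_x (f x ^+ 2)%:E <= (A ^+ 2)%:E * \int[mu]_t (y t ^+ 2)%:E)%E.
Proof.
apply: sqr_integral_exp_kernel_le => //; first exact: ltW.
move=> x; rewrite /f normrM (gtr0_norm (psi_gt0 x)) EFinM.
rewrite [C](_ : C = psi x * (C / psi x)); last by field.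
rewrite EFinM -muleA lee_wpmul2l ?lee_fin ?(ltW (psi_gt0 x))//.
apply: (@kernel_Rintegral_le _ _ m (C / psi x) x) => //; first by rewrite divr_ge0 ?ltW.
by move=> t; exact: psiV_kernel.
Qed.

Let fL : f \in Lfun mu 2%:E.
Proof.
apply/Lfun2P; split=> //; apply: le_lt_trans f_le _.
by rewrite lte_mul_pinfty ?lee_fin ?sqr_ge0//; case/Lfun2P: yL.
Qed.

Let Df (x : R) : off_nodes d x -> is_derive x 1 f (psi1 x * Q x + y x).
Proof.
move=> ox; have D0 : is_derive x 1 psi (psi1 x) by case: psiS => _ _ + _ _; exact.
apply: (trigger_derive (is_derive1M D0 (DQ x))).
by rewrite mulrA divff// mul1r.
Qed.

Let f1E x : off_nodes d x -> f1 x = psi1 x * Q x + y x.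
Proof. by move=> ox; rewrite /f1 patchE mem_set. Qed.

Let cpsi1 x : off_nodes d x -> {for x, continuous psi1}.
Proof. by move=> ox; case: psiS => _ _ _ D1 _; exact: is_derive1_continuous (D1 x ox). Qed.

Let f1L : f1 \in Lfun mu 2%:E.
Proof.
have oU := open_off_nodes d0.
have mf1 : measurable_fun setT f1.
  apply/(measurable_restrictT _ _).1; first exact: open_measurable.
  apply: open_continuous_measurable_fun => // x; rewrite inE => ox.
  by apply: cvgD; [apply: cvgM; [exact: cpsi1|exact: cQ]|exact: cy].
have nL (q : R -> R) : q \in Lfun mu 2%:E -> (fun x => `|q x|) \in Lfun mu 2%:E.
  move=> qL; apply: (@Lfun2_le _ _ q 1) => //.
    by apply: measurableT_comp => //; exact: Lfun_measurable qL.
  by move=> x; rewrite normr_id mul1r.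
apply: (@Lfun2_le _ _ (fun x => `|K| * `|f x| + `|y x|) 1) => //.
  by apply: Lfun2D; [apply: Lfun2Z; exact: nL|exact: nL].
move=> x; rewrite mul1r [leRHS]ger0_norm ?addr_ge0 ?mulr_ge0//.
rewrite /f1 patchE; case: ifPn => [|_]; last by rewrite normr0 addr_ge0 ?mulr_ge0.
rewrite inE => ox; apply: le_trans (ler_normD _ _) _; rewrite lerD2r !normrM mulrA ler_wpM2r//.
apply: le_trans (psiK ox) _; rewrite (gtr0_norm (psi_gt0 x)) ler_pM2r//; exact: ler_norm.
Qed.

(** f phi is continuously differentiable with compact support, so its derivative has integral 0. *)
Let wd1 : weak_derivative (off_nodes d) f f1.
Proof.
move=> phi tphi; have sphi : smooth phi by case: tphi.
have [N N0 phiN] := test_function_support tphi.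
have nz := test_function_near_zero tphi.
have cphi := smooth_continuous sphi.
have cphi' := smooth_continuous (smooth_derive sphi).
pose F x := f x * phi x.
pose F' x := f1 x * phi x + f x * derive1 phi x.
have phi00 x : N < `|x| -> phi x = 0 by move=> /phiN/nbhs_singleton.
have phi10 x : N < `|x| -> derive1 phi x = 0.
  by move=> /phiN/near_zero_derive1/nbhs_singleton.
have DF (x : R) : is_derive x 1 F (F' x).
  have [ox|zx] := nz x.
    rewrite /F' f1E//; apply: is_derive1M; first exact: Df.
    by apply: derivable1_is_derive; exact: smooth_derivable.
  rewrite /F' (nbhs_singleton zx) (nbhs_singleton (near_zero_derive1 zx)) !mulr0 addr0.
  by apply: near_zero_is_derive; apply: filterS zx => z zz; rewrite /F zz mulr0.
have cF' : continuous F'.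
  move=> x; have [ox|zx] := nz x; last first.
    apply: near_zero_continuous; have := near_zero_derive1 zx.
    by apply: filterS2 zx => z zz zz'; rewrite /F' zz zz' !mulr0 addr0.
  have C1 : {for x, continuous (fun x => (psi1 x * Q x + y x) * phi x + f x * derive1 phi x)}.
    apply: cvgD; apply: cvgM; [|exact: cphi|exact: cf|exact: cphi'].
    by apply: cvgD; [apply: cvgM; [exact: cpsi1|exact: cQ]|exact: cy].
  have E : \forall z \near x, (psi1 z * Q z + y z) * phi z + f z * derive1 phi z = F' z.
    by apply: filterS (near_off_nodes d0 ox) => z oz; rewrite /F' f1E.
  exact: near_eq_continuous E C1.
have N1 : 0 < N + 1 by lra.
have FN (x : R) : N + 1 <= `|x| -> F x = 0.
  by move=> Nx; rewrite /F phi00 ?mulr0//; lra.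
have := Rintegral_derive_supp N1 DF cF' FN.
have supp (x : R) : ~~ (- (N + 1) <= x <= N + 1) -> N < `|x|.
  by rewrite -ler_norml -ltNge => ?; lra.
have i1 : intb (fun x => f1 x * phi x) (- (N + 1)) (N + 1).
  by apply: integrable_segmentMc => //; exact: Lfun2_integrable_segment.
have i2 : intb (fun x => f x * derive1 phi x) (- (N + 1)) (N + 1).
  by apply: integrable_segmentMc => //; exact: Lfun2_integrable_segment.
rewrite /F' Rintegral_segmentD//.
rewrite (@Rintegral_supp _ (fun x => f x * _) (- (N + 1)) (N + 1)); last first.
  by move=> x /supp /phi10 ->; rewrite mulr0.
rewrite (@Rintegral_supp _ (fun x => f1 x * _) (- (N + 1)) (N + 1)); last first.
  by move=> x /supp /phi00 ->; rewrite mulr0.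
by move=> H; lra.
Qed.

Let g (x : R) := lam * f x + h x.

(** Off the nodes f1 phi = a f + b P with b = phi / psi and a = psi1 b. The product a f is
    continuously differentiable; P is only a primitive of - psi h with h in L^2, so b P needs
    [primitive_product_rule]. Both products have compact support, and their derivatives add up to f1
    phi' - g phi. *)
Let wd2 : weak_derivative (off_nodes d) f1 (fun x => - g x).
Proof.
move=> phi tphi; have sphi : smooth phi by case: tphi.
have [N N0 phiN] := test_function_support tphi.
have nz := test_function_near_zero tphi.
have cphi := smooth_continuous sphi.
have cphi' := smooth_continuous (smooth_derive sphi).
have Dphi (x : R) : is_derive x 1 phi (derive1 phi x).
  by apply: derivable1_is_derive; exact: smooth_derivable.
have phi00 x : N < `|x| -> phi x = 0 by move=> /phiN/nbhs_singleton.
have phi10 x : N < `|x| -> derive1 phi x = 0.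
  by move=> /phiN/near_zero_derive1/nbhs_singleton.
pose b x := phi x / psi x.
pose b' x := (derive1 phi x * psi x - phi x * psi1 x) / psi x ^+ 2.
pose a x := psi1 x * b x.
pose a' x := - (lam * psi x) * b x + psi1 x * b' x.
have cb : continuous b by move=> x; apply: cvgM; [exact: cphi|exact: cpsiV].
have Db (x : R) : is_derive x 1 b (b' x).
  have [ox|zx] := nz x.
    by apply: is_derive1_div => //; case: psiS => _ _ + _ _; exact.
  rewrite /b' (nbhs_singleton zx) (nbhs_singleton (near_zero_derive1 zx)) !mul0r subrr mul0r.
  by apply: near_zero_is_derive; apply: filterS zx => z zz; rewrite /b zz mul0r.
have cb' : continuous b'.
  move=> x; have [ox|zx] := nz x; last first.
    apply: near_zero_continuous; have := near_zero_derive1 zx.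
    by apply: filterS2 zx => z zz zz'; rewrite /b' zz zz' !mul0r subrr mul0r.
  apply: cvgM.
    by apply: cvgB; apply: cvgM; [exact: cphi'|exact: cpsi|exact: cphi|exact: cpsi1].
  apply: cvgV; first by rewrite sqrf_eq0.
  by rewrite expr2; under eq_fun do rewrite expr2; apply: cvgM; exact: cpsi.
have Da (x : R) : is_derive x 1 a (a' x).
  have [ox|zx] := nz x.
    have D1 : is_derive x 1 psi1 (- (lam * psi x)) by case: psiS => _ _ _ + _; exact.
    exact: (is_derive1M D1 (Db x)).
  have b'0 : b' x = 0.
    by rewrite /b' (nbhs_singleton zx) (nbhs_singleton (near_zero_derive1 zx)) !mul0r subrr mul0r.
  rewrite /a' b'0 /b (nbhs_singleton zx) mul0r !mulr0 addr0.
  by apply: near_zero_is_derive; apply: filterS zx => z zz; rewrite /a /b zz mul0r mulr0.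
have ca' : continuous a'.
  move=> x; have [ox|zx] := nz x; last first.
    apply: near_zero_continuous; have := near_zero_derive1 zx.
    by apply: filterS2 zx => z zz zz'; rewrite /a' /b' /b zz zz' !mul0r subrr mul0r !mulr0 addr0.
  apply: cvgD.
    apply: cvgM; last exact: cb.
    by apply: cvgN; apply: cvgM; [exact: cvg_cst|exact: cpsi].
  by apply: cvgM; [exact: cpsi1|exact: cb'].
have ca : continuous a by move=> x; exact: is_derive1_continuous (Da x).
pose F x := a x * f x.
pose F' x := a' x * f x + a x * f1 x.
have DF (x : R) : is_derive x 1 F (F' x).
  have [ox|zx] := nz x.
    by rewrite /F' f1E//; exact: (is_derive1M (Da x) (Df ox)).
  have az : \forall z \near x, a z = 0 by apply: filterS zx => z zz; rewrite /a /b zz mul0r mulr0.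
  have a'0 : a' x = 0.
    by rewrite -(is_derive1E (Da x)) (nbhs_singleton (near_zero_derive1 az)).
  rewrite /F' a'0 (nbhs_singleton az) !mul0r addr0.
  by apply: near_zero_is_derive; apply: filterS az => z zz; rewrite /F zz mul0r.
have cF' : continuous F'.
  move=> x; have [ox|zx] := nz x; last first.
    apply: near_zero_continuous; have := near_zero_derive1 zx.
    apply: filterS2 zx => z zz zz'.
    by rewrite /F' /a' /a /b' /b zz zz' !mul0r subrr !mul0r !mulr0 addr0 !mul0r addr0.
  have C1 : {for x, continuous (fun x => a' x * f x + a x * (psi1 x * Q x + y x))}.
    apply: cvgD; apply: cvgM; [exact: ca'|exact: cf|exact: ca|].
    by apply: cvgD; [apply: cvgM; [exact: cpsi1|exact: cQ]|exact: cy].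
  have E : \forall z \near x, a' z * f z + a z * (psi1 z * Q z + y z) = F' z.
    by apply: filterS (near_off_nodes d0 ox) => z oz; rewrite /F' f1E.
  exact: near_eq_continuous E C1.
have N1 : 0 < N + 1 by lra.
have FN (x : R) : N + 1 <= `|x| -> F x = 0.
  by move=> Nx; rewrite /F /a /b phi00 ?mul0r ?mulr0 ?mul0r//; lra.
have I1 := Rintegral_derive_supp N1 DF cF' FN.
have NN : - (N + 1) <= N + 1 by lra.
have hi : intb (fun t => - (psi t * h t)) (- (N + 1)) (N + 1).
  have := integrable_segmentZ (-1) (psih_intb (- (N + 1)) (N + 1)).
  by apply: eq_integrable => // t _; rewrite /= mulN1r.
have Pinc x z : - (N + 1) <= x -> x <= z -> z <= N + 1 ->
    P z - P x = \int[mu]_(t in `[x, z]) (- (psi t * h t)).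
  move=> _ xz _; rewrite PE// -mulN1r -Rintegral_segmentZ//.
  by apply: eq_Rintegral => t _; rewrite mulN1r.
have I2 := primitive_product_rule NN hi Pinc (fun t _ => Db t) (continuous_subspaceT cb').
have bN : b (N + 1) = 0 by rewrite /b phi00 ?mul0r// gtr0_norm//; lra.
have bN' : b (- (N + 1)) = 0 by rewrite /b phi00 ?mul0r// normrN gtr0_norm//; lra.
rewrite bN bN' !mul0r subrr in I2.
have supp (x : R) : ~~ (- (N + 1) <= x <= N + 1) -> N < `|x|.
  by rewrite -ler_norml -ltNge => ?; lra.
rewrite (@Rintegral_supp _ (fun x => f1 x * _) (- (N + 1)) (N + 1)); last first.
  by move=> x /supp /phi10 ->; rewrite mulr0.
rewrite (@Rintegral_supp _ (fun x => - g x * _) (- (N + 1)) (N + 1)); last first.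
  by move=> x /supp /phi00 ->; rewrite mulr0.
have gi : intb g (- (N + 1)) (N + 1).
  apply: integrable_segmentD; last exact: Lfun2_integrable_segment hL.
  by apply: integrable_segmentZ; exact: Lfun2_integrable_segment fL.
have gpi : intb (fun x => - g x * phi x) (- (N + 1)) (N + 1).
  have := integrable_segmentZ (-1) (integrable_segmentMc gi cphi).
  by apply: eq_integrable => // t _ /=; congr EFin; ring.
have f1pi : intb (fun x => f1 x * derive1 phi x) (- (N + 1)) (N + 1).
  by apply: integrable_segmentMc cphi'; exact: Lfun2_integrable_segment.
have i1 : intb F' (- (N + 1)) (N + 1) by exact: continuous_integrable.
have i2 : intb (fun t => b' t * P t + b t * - (psi t * h t)) (- (N + 1)) (N + 1).
  apply: integrable_segmentD; first by apply: continuous_integrable => t; apply: cvgM; [exact: cb'|exact: cP].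
  by have := integrable_segmentMc hi cb; apply: eq_integrable => // t _; rewrite /= mulrC.
suff : \int[mu]_(t in `[- (N + 1), N + 1]) (f1 t * derive1 phi t) +
    \int[mu]_(t in `[- (N + 1), N + 1]) (- g t * phi t) = 0.
  by move=> H; apply/eqP; rewrite -subr_eq0 opprK H.
transitivity (\int[mu]_(t in `[- (N + 1), N + 1]) F' t +
  \int[mu]_(t in `[- (N + 1), N + 1]) (b' t * P t + b t * - (psi t * h t)));
  last by rewrite I1 -I2 addr0.
rewrite -!Rintegral_segmentD//.
apply: eq_Rintegral => t _.
have [ot|zt] := nz t; last first.
  rewrite (nbhs_singleton (near_zero_derive1 zt)) /F' /a' /a /b' /b (nbhs_singleton zt).
  rewrite (nbhs_singleton (near_zero_derive1 zt)) !mul0r subrr !mul0r !mulr0 addr0 !mul0r !addr0//.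
rewrite /F' /a' /a /b' /b f1E// /g /f /y; field.
exact: psi_neq0.
Qed.

(** Q and y are continuous, so in f' = psi1 Q + y only psi1 jumps, by beta psi; this contributes
    beta psi Q = beta f. *)
Let jump n : derivative_jump f (node d n) (beta * f (node d n)).
Proof.
case: psiS => _ _ _ _ /(_ n)[pl [pr [cpl cpr plr]]].
have Cl (q : R -> R) : continuous q -> q y @[y --> (node d n)^'-] --> q (node d n).
  by move=> c; apply: cvg_at_left_filter; exact: c.
have Cr (q : R -> R) : continuous q -> q y @[y --> (node d n)^'+] --> q (node d n).
  by move=> c; apply: cvg_at_right_filter; exact: c.
exists (pl * Q (node d n) + y (node d n)), (pr * Q (node d n) + y (node d n)); split.
- have L : psi1 z * Q z + y z @[z --> (node d n)^'-] --> pl * Q (node d n) + y (node d n).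
    by apply: cvgD; [apply: cvgM => //; exact: Cl|exact: Cl].
  apply: cvg_trans L; apply: near_eq_cvg; near=> z.
  apply/esym/is_derive1E/Df; apply: (@cell_off_nodes _ _ d0 n); near: z; exact: near_left_cell.
- have L : psi1 z * Q z + y z @[z --> (node d n)^'+] --> pr * Q (node d n) + y (node d n).
    by apply: cvgD; [apply: cvgM => //; exact: Cr|exact: Cr].
  apply: cvg_trans L; apply: near_eq_cvg; near=> z.
  apply/esym/is_derive1E/Df; apply: (@cell_off_nodes _ _ d0 (n + 1)); rewrite addrK.
  near: z; exact: near_right_cell.
- have -> : pr = pl + beta * psi (node d n) by rewrite -plr; ring.
  rewrite /f; ring.
Unshelve. all: by end_near. Qed.

(** Schur's test is applied twice, from h to y and from y to f, hence the fourth power of C (2 / m)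
    in a bound on squared norms. *)
Lemma h_real_solution : exists f : R -> R, h_real d beta f (fun x => lam * f x + h x) /\
  (\int[mu]_x (f x ^+ 2)%:E <= (((C * (2 / m)) ^+ 2) ^+ 2)%:E * \int[mu]_t (h t ^+ 2)%:E)%E.
Proof.
exists f; split.
  split=> //; exists f1; split=> //.
  by apply: Lfun2N; apply: Lfun2D => //; exact: Lfun2Z.
apply: le_trans f_le _; rewrite (_ : (((C * (2 / m)) ^+ 2) ^+ 2)%:E = ((A ^+ 2)%:E * (A ^+ 2)%:E)%E) -?EFinM//.
by rewrite EFinM -muleA; apply: lee_wpmul2l; rewrite ?lee_fin ?sqr_ge0.
Qed.

End Construction.

End Resolvent.

(** * The bottom of the spectrum *)

Section ComplexReduction.
Context {R : realType}.
Notation mu := (@lebesgue_measure R).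
Context (d : R) (d0 : 0 < d) (beta : R).
Local Notation C := (complex.complex R).
Local Notation Re := (@complex.Re R).
Local Notation Im := (@complex.Im R).
Implicit Types (F G H : R -> C) (z : C).

Lemma ReN z : Re (- z) = - Re z. Proof. by case: z. Qed.

Lemma ImN z : Im (- z) = - Im z. Proof. by case: z. Qed.

Lemma Re_subZ (lam : R) z w : Re (z - (complex.real_complex R lam) * w) = Re z - lam * Re w.
Proof. by case: z => a b; case: w => c e /=; rewrite mul0r subr0. Qed.

Lemma Im_subZ (lam : R) z w : Im (z - (complex.real_complex R lam) * w) = Im z - lam * Im w.
Proof. by case: z => a b; case: w => c e /=; rewrite mul0r addr0. Qed.

Lemma complex_eqP z w : z = w <-> Re z = Re w /\ Im z = Im w.
Proof. by split=> [->//|[]]; case: z => a b; case: w => c e /= -> ->. Qed.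

Lemma h_op_real F G : h_op d beta F G ->
  h_real d beta (Re \o F) (Re \o G) /\ h_real d beta (Im \o F) (Im \o G).
Proof.
move=> [cR cI [F1 [[FR FI] [F1R F1I] [F2R F2I] [wR wI] [w2R w2I]]] J].
have EN : (fun x => Re (- G x)) = (fun x => - Re (G x)) by apply/funext => x; rewrite ReN.
have EI : (fun x => Im (- G x)) = (fun x => - Im (G x)) by apply/funext => x; rewrite ImN.
rewrite EN in F2R w2R; rewrite EI in F2I w2I.
split; split => //.
- by exists (Re \o F1).
- by move=> n; case: (J n).
- by exists (Im \o F1).
- by move=> n; case: (J n).
Qed.

Lemma real_h_op (f g f' g' : R -> R) : h_real d beta f g -> h_real d beta f' g' ->
  h_op d beta (fun x => complex.Complex (f x) (f' x)) (fun x => complex.Complex (g x) (g' x)).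
Proof.
move=> [cf [f1 [fL f1L gL w w1]] J] [cf' [f1' [fL' f1L' gL' w' w1']] J'].
by split=> //; exists (fun x => complex.Complex (f1 x) (f1' x)); split; split.
Qed.

Lemma normL2E F : measurable_fun setT (Re \o F) -> measurable_fun setT (Im \o F) ->
  normL2 F = ((\int[mu]_x ((Re (F x)) ^+ 2)%:E + \int[mu]_x ((Im (F x)) ^+ 2)%:E) `^ 2^-1)%E.
Proof.
move=> mR mI; rewrite /normL2 Lnorm2E; congr (_ `^ _)%E.
rewrite -ge0_integralD//.
- apply: eq_integral => x _; rewrite -EFinD; congr EFin.
  by rewrite /=; case: (F x) => a b /=; rewrite sqr_sqrtr// addr_ge0 ?sqr_ge0.
- by move=> x _; rewrite lee_fin sqr_ge0.
- by apply/measurable_EFinP; exact: measurable_funX.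
- by move=> x _; rewrite lee_fin sqr_ge0.
- by apply/measurable_EFinP; exact: measurable_funX.
Qed.

Lemma resolvent_lt (lam K : R) psi (psi1 : R -> R) : comb_solution d beta lam psi psi1 ->
  (forall x, off_nodes d x -> `|psi1 x| <= K * psi x) -> decaying psi ->
  resolvent_set (h_op d beta) (complex.real_complex R lam).
Proof.
move=> S SK D; split.
  move=> F G /h_op_real[hR hI] GF.
  have FR := h_real_injective d0 S SK D hR; have FI := h_real_injective d0 S SK D hI.
  apply: aeW => x; apply/complex_eqP; split.
    apply: (FR _ x); move: GF; apply: ae_imp => t /complex_eqP[+ _].
    by rewrite Re_subZ => /eqP; rewrite subr_eq0 => /eqP.
  apply: (FI _ x); move: GF; apply: ae_imp => t /complex_eqP[_].
  by rewrite Im_subZ => /eqP; rewrite subr_eq0 => /eqP.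
have [m [C' [m0 C0 dec]]] := D.
(* [h_real_solution] bounds squared norms with the factor B^2, so B bounds the resolvent itself. *)
pose B := (C' * (2 / m)) ^+ 2.
have B0 : 0 <= B by exact: sqr_ge0.
exists B => H [HR HI].
have [f [hf fle]] := h_real_solution d0 S SK m0 C0 dec HR.
have [f' [hf' fle']] := h_real_solution d0 S SK m0 C0 dec HI.
exists (fun x => complex.Complex (f x) (f' x)).
exists (fun x => complex.Complex (lam * f x + Re (H x)) (lam * f' x + Im (H x))).
split; first exact: real_h_op.
  by apply: aeW => x; apply/complex_eqP; rewrite Re_subZ Im_subZ /=; split; ring.
have mf : measurable_fun setT f by case: hf => cf _ _; exact: continuous_measurable_fun.
have mf' : measurable_fun setT f' by case: hf' => cf _ _; exact: continuous_measurable_fun.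
rewrite (@normL2E (fun x => complex.Complex (f x) (f' x)) mf mf') (normL2E (Lfun_measurable HR) (Lfun_measurable HI)).
have -> : (B%:E = ((B ^+ 2)%:E `^ 2^-1))%E.
  by rewrite poweR_EFin powR12_sqrt ?sqr_ge0// sqrtr_sqr ger0_norm.
rewrite -poweRM; last 2 first.
- by rewrite lee_fin sqr_ge0.
- by apply: adde_ge0; exact: sqr_integral_ge0.
apply: gt0_ler_poweR; rewrite ?invr_ge0//.
- by rewrite in_itv/= leey andbT; apply: adde_ge0; exact: sqr_integral_ge0.
- rewrite in_itv/= leey andbT; apply: mule_ge0; first by rewrite lee_fin sqr_ge0.
  by apply: adde_ge0; exact: sqr_integral_ge0.
- by rewrite ge0_muleDr ?sqr_integral_ge0//; exact: leeD.
Qed.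

(* If f solved (h_beta - lam) f = u 1_I for one cell I, the Wronskian of u and f would be
   constant, hence by square-integrability zero, on either side of I; its increment
   across I is - \int_I u^2. *)
Lemma ground_state_spectrum (lam K : R) (u u1 : R -> R) (e M : R) : 0 < e ->
  (forall x, e <= u x <= M) -> comb_solution d beta lam u u1 ->
  (forall x, off_nodes d x -> `|u1 x| <= K * u x) ->
  spectrum (h_op d beta) (complex.real_complex R lam).
Proof.
move=> e0 uM S SK [_ [B HB]].
have M0 : 0 < M by have /andP[h1 h2] := uM 0; exact: lt_le_trans e0 (le_trans h1 h2).
have cu : continuous u by case: S.
have u0 x : 0 < u x by case: S.
pose I := `[node d (-1), node d 0]%classic : set R.
pose h : R -> R := u \_ I.
have mh : measurable_fun setT h.
  apply/(measurable_restrictT _ _).1; first exact: measurable_itv.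
  by apply: (measurable_funS measurableT) => //; exact: continuous_measurable_fun.
have hu x : `|h x| <= M.
  rewrite /h patchE; case: ifPn => _; last by rewrite normr0 ltW.
  by rewrite gtr0_norm//; case/andP: (uM x).
have mIy : (mu I < +oo)%E.
  by rewrite /I lebesgue_measure_itv/=; case: ifP => _; rewrite -?EFinB ltry.
have hL : h \in Lfun mu 2%:E.
  apply/Lfun2P; split=> //.
  apply: (@le_lt_trans _ _ (\int[mu]_(x in I) (M ^+ 2)%:E)%E); last first.
    by rewrite integral_cst; [apply: lte_mul_pinfty; rewrite ?lee_fin ?sqr_ge0|exact: measurable_itv].
  rewrite [leRHS]integral_mkcond; apply: ge0_le_integral => //.
  - by move=> x _; rewrite lee_fin sqr_ge0.
  - by apply/measurable_EFinP; exact: measurable_funX.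
  - by apply/(measurable_restrictT _ _).1; [exact: measurable_itv|exact: measurable_cst].
  - move=> x _; rewrite patchE; case: ifPn => xI.
      by rewrite lee_fin -[leLHS]real_normK ?num_real// ler_sqr ?nnegrE// ltW.
    by rewrite /h patchE (negbTE xI) expr0n.
have zL : (fun _ : R => 0 : R) \in Lfun mu 2%:E.
  apply: (Lfun2_le (C := 0) (measurable_cst _) hL) => x; by rewrite normr0 mul0r.
have [F [G [FG GF _]]] := HB (fun x => complex.Complex (h x) 0) (conj hL zL).
have [hR _] := h_op_real FG.
have gf : {ae mu, forall x, Re (G x) - lam * Re (F x) = h x}.
  by move: GF; apply: ae_imp => x /complex_eqP[+ _]; rewrite Re_subZ.
pose P x := u x * derive1 (Re \o F) x - u1 x * Re (F x).
have W := wronskian_increment d0 S hR.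
have [f fL fP] := wronskian_ae_bound d0 S hR SK.
have gi a b : mu.-integrable `[a, b] (EFin \o (fun t => u t * (Re (G t) - lam * Re (F t)))).
  case: hR => _ [f1 [FL _ GL _ _]] _.
  have q2 := Lfun2_integrable_segment a b (Lfun2N (Lfun2D GL (Lfun2Z lam FL))).
  have := integrable_segmentMc q2 cu.
  by apply: eq_integrable => // t _ /=; congr EFin; ring.
have uhi a b : mu.-integrable `[a, b] (EFin \o (fun t => u t * h t)).
  have := integrable_segmentMc (Lfun2_integrable_segment a b hL) cu.
  by apply: eq_integrable => // t _; rewrite /= mulrC.
have WE x y : off_nodes d x -> off_nodes d y -> x <= y ->
    P y - P x = - \int[mu]_(t in `[x, y]) (u t * h t).
  move=> ox oy xy; rewrite /P (W x y)//; congr (- _).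
  apply: Rintegral_ae_eq => //; move: gf; apply: ae_imp => t -> _//.
(* Since u <= M, a nonzero constant value c of P on a set containing arbitrarily long intervals
   would keep the L^2 function f above |c| / M there. *)
have zero c (Q : set R) : (forall x, off_nodes d x -> Q x -> P x = c) ->
    (forall N : R, exists a, forall x, a <= x <= a + N -> Q x) -> c = 0.
  move=> Pc HQ; apply/eqP; apply: contraT => cn0.
  have dl : 0 < `|c| / M by rewrite divr_gt0 ?normr_gt0.
  suff : f \notin Lfun mu 2%:E by rewrite fL.
  apply: (Lfun2_not_bounded_below dl) => N; have [a Ha] := HQ N; exists a.
  move: fP; apply: ae_imp => x [ox fx] xa; apply: le_trans fx.
  rewrite -/(P x) Pc//; last exact: Ha.
  rewrite ler_pM2l ?normr_gt0// lef_pV2 ?posrE//; by case/andP: (uM x).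
have hI0 x y : x <= y -> (forall t, x <= t <= y -> ~ I t) ->
    \int[mu]_(t in `[x, y]) (u t * h t) = 0.
  move=> xy nI; rewrite (@eq_Rintegral _ _ _ _ _ (fun=> 0)); last first.
    move=> t; rewrite inE/= in_itv/= => /nI nIt; rewrite /h patchE ifF ?mulr0//.
    by apply/negbTE; rewrite notin_setE.
  by rewrite Rintegral_segment_cst// mul0r.
have oL : off_nodes d (d * (-1)%:~R) by exact: cell_off_nodes (cell_center d0 (-1)).
have oR : off_nodes d (d * 1%:~R) by exact: cell_off_nodes (cell_center d0 1).
have nL : d * (-1)%:~R < node d (-1) by have /andP[] := cell_center d0 (-1).
have nR : node d 0 < d * 1%:~R by have /andP[] := cell_center d0 1.
have n0 : node d (-1) < node d 0 by rewrite node_lt.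
have PL : P (d * (-1)%:~R) = 0.
  apply: (zero _ [set x | x <= d * (-1)%:~R]) => [x ox /= xL|N].
    apply/eqP; rewrite eq_sym -subr_eq0 WE// oppr_eq0; apply/eqP/hI0 => // t /andP[_ tL].
    by rewrite /I /= in_itv/= => /andP[nt _]; have := lt_le_trans nL nt; rewrite ltNge tL.
  by exists (d * (-1)%:~R - N) => x /andP[_]; rewrite subrK.
have PR : P (d * 1%:~R) = 0.
  apply: (zero _ [set x | d * 1%:~R <= x]) => [x ox /= xL|N].
    apply/eqP; rewrite -subr_eq0 WE// oppr_eq0; apply/eqP/hI0 => // t /andP[tL _].
    by rewrite /I /= in_itv/= => /andP[_ nt]; have := lt_le_trans nR tL; rewrite ltNge nt.
  by exists (d * 1%:~R) => x /andP[].
have LR : d * (-1)%:~R <= d * 1%:~R by rewrite ler_pM2l// ler_int.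
have := WE _ _ oL oR LR; rewrite PL PR subrr => /eqP; rewrite eq_sym oppr_eq0 => /eqP I0.
have : e ^+ 2 * (node d 0 - node d (-1)) <= 0.
  rewrite -I0 -Rintegral_segment_cst; last exact: ltW.
  rewrite (@Rintegral_split _ (fun t => u t * h t) (d * (-1)%:~R) (node d (-1))) ?(ltW nL)/= ?(ltW (lt_trans n0 nR))//.
  rewrite (@Rintegral_split _ (fun t => u t * h t) (node d (-1)) (node d 0) (d * 1%:~R)) ?(ltW nR) ?(ltW n0)//.
  have uh0 t : 0 <= u t * h t.
    rewrite mulr_ge0 ?(ltW (u0 t))// /h patchE; case: ifP => // _; exact: ltW.
  apply: (@le_trans _ _ (\int[mu]_(t in `[node d (-1), node d 0]) (u t * h t))); last first.
    by rewrite addrCA lerDl addr_ge0// Rintegral_ge0.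
  apply: le_Rintegral => //; first exact: integrable_segment_cst.
  move=> t It; rewrite /h patchE mem_set// -expr2 ler_sqr ?nnegrE ?(ltW e0) ?(ltW (u0 t))//.
  by case/andP: (uM t).
by rewrite leNgt mulr_gt0// ?exprn_gt0// subr_gt0.
Qed.

Lemma E0_eq (lam0 K : R) (u u1 : R -> R) (e M : R) : 0 < e ->
  (forall x, e <= u x <= M) -> comb_solution d beta lam0 u u1 ->
  (forall x, off_nodes d x -> `|u1 x| <= K * u x) ->
  (forall lam, lam < lam0 -> exists psi psi1 K', [/\ comb_solution d beta lam psi psi1,
    forall x, off_nodes d x -> `|psi1 x| <= K' * psi x & decaying psi]) ->
  E0 d beta = lam0.
Proof.
move=> e0 uM S SK H.
have s0 := ground_state_spectrum e0 uM S SK.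
have lb : lbound [set lam | spectrum (h_op d beta) (complex.real_complex R lam)] lam0.
  move=> lam /= sl; rewrite leNgt; apply/negP => /H[psi [psi1 [K' [S' SK' D]]]].
  exact: (sl (resolvent_lt S' SK' D)).
rewrite /E0; apply/eqP; rewrite eq_le; apply/andP; split.
  by apply: ge_inf => //; exists lam0.
by apply: lb_le_inf => //; exists lam0.
Qed.

End ComplexReduction.

(** * Floquet solutions *)

Section Floquet.
Context {R : realType}.
Notation mu := (@lebesgue_measure R).
Context (d : R) (d0 : 0 < d).
Implicit Types (x t : R) (n : int).

(* The nearest node-free cell, centered at d * cell_index x. *)
Definition cell_index x : int := Num.floor (x / d + 2^-1).

Lemma cell_indexP x n : node d (n - 1) <= x < node d n -> cell_index x = n.
Proof.
move=> /andP[nx xn]; apply: Num.Theory.floor_def.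
have xE : x = d * (x / d) by field; rewrite gt_eqF.
apply/andP; split.
  move: nx; rewrite [leRHS]xE /node ler_pM2l// intrD; lra.
move: xn; rewrite [ltLHS]xE /node ltr_pM2l// intrD; lra.
Qed.

Lemma cell_index_bound x : - (d / 2) <= x - d * (cell_index x)%:~R <= d / 2.
Proof.
have H1 : (cell_index x)%:~R <= x / d + 2^-1 by exact: Num.Theory.floor_le.
have H2 : x / d + 2^-1 < (cell_index x)%:~R + 1.
  by have := Num.Theory.floorD1_gt (x / d + 2^-1); rewrite intrD.
have xE : x = d * (x / d) by field; rewrite gt_eqF.
rewrite [X in X - _]xE -mulrBr mulrC.
have hE : d / 2 = 2^-1 * d by rewrite mulrC.
by rewrite [d * (_ - _)]mulrC -mulNr !ler_pM2r//; apply/andP; split; lra.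
Qed.

Context (beta lam : R) (c s : R -> R).
Hypothesis Dc : forall x : R, is_derive x 1 c (- (lam * s x)).
Hypothesis Ds : forall x : R, is_derive x 1 s (c x).
Hypothesis cN : forall x, c (- x) = c x.
Hypothesis sN : forall x, s (- x) = - s x.
Hypothesis c_gt0 : forall x, 0 <= x <= d / 2 -> 0 < c x.
Context (b m : R).
Hypothesis m_ge0 : 0 <= m.
Hypothesis bS : `|b| * s (d / 2) < c (d / 2).
Hypothesis cell_continuity :
  c (d / 2) + b * s (d / 2) = expR (- (m * d)) * (c (d / 2) - b * s (d / 2)).
Hypothesis cell_jump :
  expR (- (m * d)) * (lam * s (d / 2) + b * c (d / 2)) - (- (lam * s (d / 2)) + b * c (d / 2))
  = beta * (c (d / 2) + b * s (d / 2)).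

Let v x := c x + b * s x.
Let v1 x := - (lam * s x) + b * c x.

(** The Floquet function with multiplier e^(-m d) per cell, equal to c + b s on the central cell.
    With m > 0 it is the decaying solution below the ground level, with b = m = 0 the periodic
    ground state. *)
Definition floquet x : R :=
  expR (- (m * d * (cell_index x)%:~R)) * v (x - d * (cell_index x)%:~R).
Definition floquet1 x : R :=
  expR (- (m * d * (cell_index x)%:~R)) * v1 (x - d * (cell_index x)%:~R).

Let Dv x : is_derive x 1 v (v1 x).
Proof. exact: (is_derive1D (Dc x) (is_derive1_scale b (Ds x))). Qed.

Let Dv1 x : is_derive x 1 v1 (- (lam * v x)).
Proof.
apply: (trigger_derive (is_derive1D (is_derive1N (is_derive1_scale lam (Ds x))) (is_derive1_scale b (Dc x)))).
by rewrite /v; ring.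
Qed.

Let cv : continuous v. Proof. by move=> x; exact: is_derive1_continuous (Dv x). Qed.
Let cv1 : continuous v1. Proof. by move=> x; exact: is_derive1_continuous (Dv1 x). Qed.

Let s0 : s 0 = 0.
Proof. by have := sN 0; rewrite oppr0 => H; lra. Qed.

(* s / c is increasing, so |b s| <= c (|b| s / c) (d / 2) < c on the half cell. *)
Let v_gt0 x : - (d / 2) <= x <= d / 2 -> 0 < v x.
Proof.
have half y e : 0 <= y <= d / 2 -> `|e| = `|b| -> 0 < c y + e * s y.
  move=> yd eb; have cy := c_gt0 yd.
  have [y0 yh] := andP yd.
  have sc t : 0 <= t <= d / 2 -> 0 <= s t.
    move=> /andP[t0 th]; have [z /andP[z0 zt]] := MVT_le t0 Ds; rewrite s0 !subr0 => ->.
    by rewrite mulr_ge0// ltW// c_gt0// z0 (le_trans zt).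
  have sy := sc _ yd.
  have cd : 0 < c (d / 2) by apply: c_gt0; rewrite lexx (le_trans y0).
  have key : s y * c (d / 2) <= s (d / 2) * c y.
    pose r t := s t / c t.
    have cr t : 0 <= t <= d / 2 -> c t != 0 by move=> /c_gt0 ct; rewrite gt_eqF.
    have Dr (t : R) : 0 <= t <= d / 2 -> is_derive t 1 r ((c t ^+ 2 + lam * s t ^+ 2) / c t ^+ 2).
      move=> td; apply: (trigger_derive (is_derive1_div (cr t td) (Ds t) (Dc t))).
      by congr (_ / _); ring.
    have W t : c t ^+ 2 + lam * s t ^+ 2 = c 0 ^+ 2.
      have Dw (z : R) : is_derive z 1 (fun t => c t ^+ 2 + lam * s t ^+ 2) 0.
        apply: (trigger_derive (is_derive1D (is_derive1X 2 (Dc z)) (is_derive1_scale lam (is_derive1X 2 (Ds z))))).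
        by rewrite /= !expr1; ring.
      by rewrite (is_derive_0_is_cst t 0 Dw) s0 expr0n/= mulr0 addr0.
    have [] := @MVT_segment _ r (fun t => (c t ^+ 2 + lam * s t ^+ 2) / c t ^+ 2) y (d / 2) yh.
    - by move=> t; rewrite in_itv/= => /andP[yt th]; apply: Dr; rewrite (le_trans y0 (ltW yt)) ltW.
    - apply: derivable_within_continuous => t; rewrite in_itv/= => /andP[yt th].
      by have [] := Dr t; rewrite ?(le_trans y0 yt).
    move=> z _ H; have : 0 <= r (d / 2) - r y.
      by rewrite H mulr_ge0 ?subr_ge0// W divr_ge0 ?sqr_ge0.
    by rewrite subr_ge0 /r ler_pdivrMr// mulrAC ler_pdivlMr.
  have : - (`|b| * s y) <= e * s y.
    rewrite -mulNr ler_wpM2r// lerNl -eb -normrN; exact: ler_norm.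
  move=> H; apply: lt_le_trans (_ : 0 < c y - `|b| * s y) _; last by rewrite lerD2l.
  rewrite subr_gt0 -(ltr_pM2r cd) -mulrA.
  apply: le_lt_trans (ler_wpM2l (normr_ge0 _) key) _.
  by rewrite mulrA [ltRHS]mulrC ltr_pM2r.
move=> /andP[xl xr]; have [x0|/ltW x0] := leP 0 x; first by apply: half => //; rewrite x0.
have -> : v x = c (- x) + (- b) * s (- x) by rewrite cN sN /v; ring.
by apply: half; rewrite ?normrN//; apply/andP; split; lra.
Qed.

Let v_lb : exists2 e : R, 0 < e & forall x, - (d / 2) <= x <= d / 2 -> e <= v x.
Proof.
have dd : - (d / 2) <= d / 2 by have := d0; lra.
have [z] := EVT_min dd (continuous_subspaceT cv).
rewrite in_itv/= => zd H; exists (v z); first exact: v_gt0.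
by move=> x xd; apply: H; rewrite in_itv.
Qed.

Let v_ub (w : R -> R) : continuous w ->
  exists2 M : R, 0 < M & forall x, - (d / 2) <= x <= d / 2 -> `|w x| <= M.
Proof.
move=> cw; have [M M0 H] := within_continuous_bounded (continuous_subspaceT cw : {within `[- (d / 2), d / 2], continuous w}).
exists (M + 1); first by rewrite ltr_wpDl.
by move=> x /H /le_trans; apply; rewrite lerDl.
Qed.

Let expS n : expR (- (m * d * (n + 1)%:~R)) = expR (- (m * d * n%:~R)) * expR (- (m * d)).
Proof. by rewrite -expRD intrD; congr expR; ring. Qed.

(** [cell_index] assigns [node d n] to the cell n + 1; [cell_continuity] makes the formula of cell n
    valid up to its right end. *)
Lemma floquet_cell n x : node d (n - 1) <= x <= node d n ->
  floquet x = expR (- (m * d * n%:~R)) * v (x - d * n%:~R).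
Proof.
move=> /andP[nx]; rewrite le_eqVlt => /predU1P[->|xn]; last first.
  by rewrite /floquet (@cell_indexP x n) ?nx.
have -> : floquet (node d n) =
    expR (- (m * d * (n + 1)%:~R)) * v (node d n - d * (n + 1)%:~R).
  rewrite /floquet (@cell_indexP (node d n) (n + 1)) ?addrK ?lexx//.
  by rewrite node_succ ltrDl.
have -> : node d n - d * (n + 1)%:~R = - (d / 2) by rewrite /node intrD; field.
have -> : node d n - d * n%:~R = d / 2 by rewrite /node; field.
rewrite /v cN sN expS -mulrA; congr (_ * _).
by rewrite cell_continuity; ring.
Qed.

Lemma floquet1_cell n x : node d (n - 1) <= x < node d n ->
  floquet1 x = expR (- (m * d * n%:~R)) * v1 (x - d * n%:~R).
Proof. by move=> H; rewrite /floquet1 (cell_indexP H). Qed.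

Lemma floquet_gt0 x : 0 < floquet x.
Proof. by rewrite /floquet mulr_gt0 ?expR_gt0// v_gt0// cell_index_bound. Qed.

Lemma cont_shift (w : R -> R) (k q : R) : continuous w -> continuous (fun x : R => k * w (x - q)).
Proof.
move=> cw x; apply: cvgM; first exact: cvg_cst.
apply: (@continuous_comp _ _ _ (fun x : R => x - q) w); last exact: cw.
by apply: cvgB; [exact: cvg_id|exact: cvg_cst].
Qed.

Lemma floquet_solution : comb_solution d beta lam floquet floquet1.
Proof.
have in_cell x n : node d (n - 1) < x < node d n ->
    \forall z \near x, node d (n - 1) <= z <= node d n /\ node d (n - 1) <= z < node d n.
  move=> /andP[nx xn]; near=> z.
  have h1 : node d (n - 1) < z by near: z; exact: near_gt.
  have h2 : z < node d n by near: z; exact: near_lt.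
  by rewrite !ltW//.
have D0 x : off_nodes d x -> is_derive x 1 floquet (floquet1 x).
  move=> /(off_nodes_cell d0)[n nx]; have [nx1 nx2] := nbhs_singleton (in_cell _ _ nx).
  rewrite (floquet1_cell nx2).
  apply: (@is_derive1_near _ (fun z => expR (- (m * d * n%:~R)) * v (z - d * n%:~R))).
    by apply: filterS (in_cell _ _ nx) => z [h1 h2]; rewrite (floquet_cell h1).
  by apply: is_derive1_scale; apply: is_derive1_comp_subr.
split.
- move=> x; have [/D0 ox|/contrapT[n _ <-]] := pselect (off_nodes d x).
    exact: is_derive1_continuous ox.
  have nn : node d (n - 1) < node d n by rewrite node_lt//; lia.
  apply/left_right_continuousP; split.
    have L : (expR (- (m * d * n%:~R)) * v (z - d * n%:~R)) @[z --> (node d n)^'-] -->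
        expR (- (m * d * n%:~R)) * v (node d n - d * n%:~R).
      by apply: cvg_at_left_filter; exact: cont_shift.
    rewrite (@floquet_cell n (node d n)) ?lexx ?(ltW nn)//.
    apply: cvg_trans L; apply: near_eq_cvg; near=> z; rewrite (@floquet_cell n)//.
    have : node d (n - 1) < z < node d n by near: z; exact: near_left_cell.
    by move=> /andP[/ltW -> /ltW ->].
  have L : (expR (- (m * d * (n + 1)%:~R)) * v (z - d * (n + 1)%:~R)) @[z --> (node d n)^'+] -->
      expR (- (m * d * (n + 1)%:~R)) * v (node d n - d * (n + 1)%:~R).
    by apply: cvg_at_right_filter; exact: cont_shift.
  rewrite (@floquet_cell (n + 1) (node d n)) ?addrK ?lexx ?node_succ ?lerDl ?(ltW d0)//.
  apply: cvg_trans L; apply: near_eq_cvg; near=> z; rewrite (@floquet_cell (n + 1))// addrK.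
  have : node d n < z < node d (n + 1) by near: z; exact: near_right_cell.
  by move=> /andP[/ltW -> /ltW ->].
- exact: floquet_gt0.
- exact: D0.
- move=> x /(off_nodes_cell d0)[n nx]; have [nx1 nx2] := nbhs_singleton (in_cell _ _ nx).
  rewrite (floquet_cell nx1).
  apply: (@is_derive1_near _ (fun z => expR (- (m * d * n%:~R)) * v1 (z - d * n%:~R))).
    by apply: filterS (in_cell _ _ nx) => z [h1 h2]; rewrite (floquet1_cell h2).
  have := is_derive1_scale (expR (- (m * d * n%:~R))) (is_derive1_comp_subr (Dv1 (x - d * n%:~R))).
  by move=> H; apply: (trigger_derive H); ring.
- move=> n; exists (expR (- (m * d * n%:~R)) * v1 (node d n - d * n%:~R)).
  exists (expR (- (m * d * (n + 1)%:~R)) * v1 (node d n - d * (n + 1)%:~R)); split.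
  + have L : (expR (- (m * d * n%:~R)) * v1 (z - d * n%:~R)) @[z --> (node d n)^'-] -->
        expR (- (m * d * n%:~R)) * v1 (node d n - d * n%:~R).
      by apply: cvg_at_left_filter; exact: cont_shift.
    apply: cvg_trans L; apply: near_eq_cvg; near=> z; rewrite (@floquet1_cell n)//.
    have : node d (n - 1) < z < node d n by near: z; exact: near_left_cell.
    by move=> /andP[/ltW -> ->].
  + have L : (expR (- (m * d * (n + 1)%:~R)) * v1 (z - d * (n + 1)%:~R)) @[z --> (node d n)^'+] -->
        expR (- (m * d * (n + 1)%:~R)) * v1 (node d n - d * (n + 1)%:~R).
      by apply: cvg_at_right_filter; exact: cont_shift.
    apply: cvg_trans L; apply: near_eq_cvg; near=> z; rewrite (@floquet1_cell (n + 1))// addrK.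
    have : node d n < z < node d (n + 1) by near: z; exact: near_right_cell.
    by move=> /andP[/ltW -> ->].
  + have nn : node d (n - 1) < node d n by rewrite node_lt//; lia.
    rewrite (@floquet_cell n (node d n)) ?lexx ?(ltW nn)//.
    have -> : node d n - d * (n + 1)%:~R = - (d / 2) by rewrite /node intrD; field.
    have -> : node d n - d * n%:~R = d / 2 by rewrite /node; field.
    rewrite /v1 /v cN sN expS -mulrA -mulrBr mulrCA; congr (_ * _).
    by rewrite -cell_jump; ring.
Unshelve. all: by end_near. Qed.

(** The multiplier cancels in the quotient of [floquet1] and [floquet], which is therefore periodic,
    and bounds on one cell suffice. *)
Lemma floquet1_le : exists K : R, forall x, `|floquet1 x| <= K * floquet x.
Proof.
have [e e0 He] := v_lb; have [M M0 HM] := v_ub cv1.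
exists (M / e) => x; rewrite /floquet /floquet1 normrM gtr0_norm ?expR_gt0// mulrCA.
have xb := cell_index_bound x.
rewrite ler_pM2l ?expR_gt0// mulrAC ler_pdivlMr//.
by apply: ler_pM; rewrite ?(ltW e0)//; [exact: HM|exact: He].
Qed.

(** The centre d n of the cell of x is within d / 2 of x, so replacing d n by x shifts the exponent
    by at most m d / 2. *)
Lemma floquet_bounds : exists e M : R, [/\ 0 < e, 0 < M & forall x,
  e * expR (- (m * (x + d / 2))) <= floquet x <= M * expR (- (m * (x - d / 2)))].
Proof.
have [e e0 He] := v_lb; have [M M0 HM] := v_ub cv.
exists e, M; split=> // x; have xb := cell_index_bound x.
have /andP[x1 x2] := xb.
rewrite /floquet; apply/andP; split.
  rewrite mulrC; apply: ler_pM; rewrite ?expR_ge0 ?(ltW e0)//; last exact: He.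
  by rewrite ler_expR lerN2 -mulrA ler_wpM2l//; lra.
rewrite [leRHS]mulrC; apply: ler_pM; rewrite ?expR_ge0//; first by rewrite ltW// v_gt0.
  by rewrite ler_expR lerN2 -mulrA ler_wpM2l//; lra.
by apply: le_trans (ler_norm _) (HM _ xb).
Qed.

Lemma floquet_decaying : 0 < m -> decaying floquet.
Proof.
move=> m0; have [e [M [e0 M0 H]]] := floquet_bounds.
(* The two half-cell shifts of [floquet_bounds] add up to the factor e^(m d). *)
exists m, (M / e * expR (m * d)); split=> //; first by rewrite !mulr_gt0 ?invr_gt0 ?expR_gt0.
move=> x t xt; have /andP[_ h2] := H t; have /andP[h1 _] := H x.
apply: le_trans h2 _.
have -> : M * expR (- (m * (t - d / 2))) =
    M / e * expR (m * d) * expR (- (m * (t - x))) * (e * expR (- (m * (x + d / 2)))).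
  transitivity (M * (expR (m * d) * expR (- (m * (t - x))) * expR (- (m * (x + d / 2))))).
    by rewrite -!expRD; congr (_ * expR _); field.
  by field; rewrite gt_eqF.
by rewrite ler_wpM2l// !mulr_ge0 ?invr_ge0 ?expR_ge0// ltW.
Qed.

End Floquet.

(** * Even and odd solutions on one cell *)

Section FundamentalSystem.
Context {R : realType}.
Context (d : R) (d0 : 0 < d).
Implicit Types (c s : R -> R) (lam beta k : R).

(** Stated by properties so that the trigonometric, affine and hyperbolic cases are treated at once.
    As s' = c, the normalization s'(0) = 1 is the clause on c 0. *)
Definition fundamental lam c s : Prop :=
  [/\ (forall x : R, is_derive x 1 c (- (lam * s x))) /\ (forall x : R, is_derive x 1 s (c x)),
      forall x, c (- x) = c x, forall x, s (- x) = - s x, c 0 = 1 &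
      forall x, 0 <= x <= d / 2 -> 0 < c x].

Lemma fundamental_wronskian lam c s : fundamental lam c s ->
  forall x, c x ^+ 2 + lam * s x ^+ 2 = 1.
Proof.
move=> [[Dc Ds] _ sN c0 _] x.
have s0 : s 0 = 0 by have := sN 0; rewrite oppr0 => H; lra.
have Dw (z : R) : is_derive z 1 (fun t => c t ^+ 2 + lam * s t ^+ 2) 0.
  apply: (trigger_derive (is_derive1D (is_derive1X 2 (Dc z)) (is_derive1_scale lam (is_derive1X 2 (Ds z))))).
  by rewrite /= !expr1; ring.
by rewrite (is_derive_0_is_cst x 0 Dw) s0 c0 expr0n/= mulr0 addr0 expr1n.
Qed.

Lemma fundamental_s_gt0 lam c s : fundamental lam c s -> forall x, 0 < x <= d / 2 -> 0 < s x.
Proof.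
move=> [[Dc Ds] _ sN c0 c_gt0] x /andP[x0 xh].
have s0 : s 0 = 0 by have := sN 0; rewrite oppr0 => H; lra.
have [z /andP[z0 zx]] := MVT_lt x0 Ds; rewrite s0 !subr0 => ->.
by rewrite mulr_gt0// c_gt0// (ltW z0)/= (le_trans (ltW zx)).
Qed.

Lemma half_cell : 0 < d / 2 <= d / 2.
Proof. by rewrite lexx andbT divr_gt0. Qed.

Lemma fundamental_c_gt0 lam c s : fundamental lam c s -> 0 < c (d / 2).
Proof. by move=> [_ _ _ _]; apply; have /andP[/ltW -> ->] := half_cell. Qed.

(** Matching c + b s across a node with a multiplier tau leaves a condition on b^2 alone. The two
    positivity hypotheses give it a real nonzero solution, and tau can then be taken in (0, 1). *)
Lemma decaying_solution_exists beta lam c s : fundamental lam c s ->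
  0 < beta * c (d / 2) - 2 * lam * s (d / 2) -> 0 < 2 * c (d / 2) + beta * s (d / 2) ->
  exists psi psi1 K, [/\ comb_solution d beta lam psi psi1,
    forall x, off_nodes d x -> `|psi1 x| <= K * psi x & decaying psi].
Proof.
move=> F; have S0 := fundamental_s_gt0 F half_cell; have C0 := fundamental_c_gt0 F.
have W := fundamental_wronskian F (d / 2).
case: F => [[Dc Ds] cN sN c0 cgt].
set C := c (d / 2) in C0 W *; set S := s (d / 2) in S0 W * => A0 B0.
(* Eliminating the multiplier from the matching conditions for c + b s gives b ^+ 2 = B. *)
pose B := C * (beta * C - 2 * lam * S) / (S * (2 * C + beta * S)).
have BP : 0 < B by rewrite divr_gt0 ?mulr_gt0.
(* The negative root gives tau < 1, hence decay to the right. *)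
pose b := - Num.sqrt B.
have b2 : b ^+ 2 = B by rewrite sqrrN sqr_sqrtr// ltW.
have b_lt0 : b < 0 by rewrite oppr_lt0 sqrtr_gt0.
have BE : b ^+ 2 * (S * (2 * C + beta * S)) = C * (beta * C - 2 * lam * S).
  by rewrite b2 /B divfK// mulf_neq0 ?gt_eqF.
(* After squaring and inserting [BE] the claim is 2 C (C^2 + lam S^2) > 0, where the bracket equals
   1. *)
have bSC : `|b| * S < C.
  rewrite -(@ltr_pXn2r _ 2) ?nnegrE ?mulr_ge0 ?(ltW S0) ?(ltW C0)//.
  rewrite exprMn real_normK ?num_real// -(ltr_pM2r B0).
  have -> : b ^+ 2 * S ^+ 2 * (2 * C + beta * S) = S * (b ^+ 2 * (S * (2 * C + beta * S))) by ring.
  rewrite BE -subr_gt0.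
  have -> : C ^+ 2 * (2 * C + beta * S) - S * (C * (beta * C - 2 * lam * S)) =
    2 * C * (C ^+ 2 + lam * S ^+ 2) by ring.
  by rewrite W mulr1 mulr_gt0.
have bN : `|b| = - b by rewrite ltr0_norm.
have p1 : 0 < C + b * S by move: bSC; rewrite bN mulNr; lra.
have p2 : 0 < C - b * S by have : b * S < 0; [rewrite nmulr_rlt0|lra].
pose tau := (C + b * S) / (C - b * S).
have tau0 : 0 < tau by rewrite divr_gt0.
have tau1 : tau < 1.
  by rewrite ltr_pdivrMr// mul1r; have : b * S < 0; [rewrite nmulr_rlt0|lra].
pose m := - ln tau / d.
have m0 : 0 < m by rewrite divr_gt0// oppr_gt0 ln_lt0// tau0.
have mE : expR (- (m * d)) = tau by rewrite /m divfK ?gt_eqF// opprK lnK.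
have cont : C + b * S = expR (- (m * d)) * (C - b * S) by rewrite mE divfK// gt_eqF.
have jump : expR (- (m * d)) * (lam * S + b * C) - (- (lam * S) + b * C) = beta * (C + b * S).
  rewrite mE; apply: (mulIf (lt0r_neq0 p2)).
  have -> : (tau * (lam * S + b * C) - (- (lam * S) + b * C)) * (C - b * S) =
    tau * (C - b * S) * (lam * S + b * C) - (- (lam * S) + b * C) * (C - b * S) by ring.
  rewrite divfK ?gt_eqF//; apply/eqP; rewrite -subr_eq0; apply/eqP.
  transitivity (b ^+ 2 * (S * (2 * C + beta * S)) - C * (beta * C - 2 * lam * S)); first by ring.
  by rewrite BE subrr.
have [K HK] := floquet1_le d0 Dc Ds cN sN cgt m bSC.
exists (floquet d c s b m), (floquet1 d lam c s b m), K; split.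
- exact: (floquet_solution d0 Dc Ds cN sN cgt (ltW m0) bSC cont jump).
- by move=> x _; exact: HK.
- exact: (floquet_decaying d0 Dc Ds cN sN cgt (ltW m0) bSC m0).
Qed.

(** The level equation is the degenerate case of the matching condition, solved by b = 0 with
    multiplier 1. *)
Lemma ground_state_exists beta lam c s : fundamental lam c s ->
  beta * c (d / 2) = 2 * lam * s (d / 2) ->
  exists u u1 K e M, [/\ comb_solution d beta lam u u1,
    forall x, off_nodes d x -> `|u1 x| <= K * u x,
    0 < e, forall x, e <= u x <= M &
    forall n x, node d (n - 1) <= x <= node d n -> u x = c (x - d * n%:~R)].
Proof.
move=> F; have S0 := fundamental_s_gt0 F half_cell; have C0 := fundamental_c_gt0 F.
case: F => [[Dc Ds] cN sN c0 cgt] E.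
have bSC : `|0 : R| * s (d / 2) < c (d / 2) by rewrite normr0 mul0r.
have ex : expR (- (0 * d)) = 1 :> R by rewrite mul0r oppr0 expR0.
have cont : c (d / 2) + 0 * s (d / 2) = expR (- (0 * d)) * (c (d / 2) - 0 * s (d / 2)).
  by rewrite ex; ring.
have jump : expR (- (0 * d)) * (lam * s (d / 2) + 0 * c (d / 2)) - (- (lam * s (d / 2)) + 0 * c (d / 2))
  = beta * (c (d / 2) + 0 * s (d / 2)).
  by rewrite ex !mul0r !addr0 E; ring.
have [K HK] := floquet1_le d0 Dc Ds cN sN cgt 0 bSC.
have [e [M [e0 M0 He]]] := floquet_bounds d0 Dc Ds cN sN cgt (lexx 0) bSC.
exists (floquet d c s 0 0), (floquet1 d lam c s 0 0), K, e, M; split.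
- exact: (floquet_solution d0 Dc Ds cN sN cgt (lexx 0) bSC cont jump).
- by move=> x _; exact: HK.
- exact: e0.
- by move=> x; have := He x; rewrite !mul0r oppr0 expR0 !mulr1.
- move=> n x nx; rewrite (floquet_cell d0 cN sN cont nx).
  by rewrite !mul0r oppr0 expR0 mul1r addr0.
Qed.

Lemma fundamental_cos k : 0 < k -> k * (d / 2) < pi / 2 ->
  fundamental (k ^+ 2) (fun x => cos (k * x)) (fun x => sin (k * x) / k).
Proof.
move=> k0 kd; split.
- have Dc (x : R) : is_derive x 1 (fun x => cos (k * x)) (- (k ^+ 2 * (sin (k * x) / k))).
    have := @is_derive1_comp_affine _ cos x _ k 0 (is_derive_cos _).
    under eq_fun do rewrite addr0.
    by move=> H; apply: (trigger_derive H); rewrite addr0; field; rewrite gt_eqF.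
  have Ds (x : R) : is_derive x 1 (fun x => sin (k * x) / k) (cos (k * x)).
    have := is_derive1_scale k^-1 (@is_derive1_comp_affine _ sin x _ k 0 (is_derive_sin _)).
    under eq_fun do rewrite addr0 mulrC.
    by move=> H; apply: (trigger_derive H); rewrite addr0; field; rewrite gt_eqF.
  by [].
- by move=> x; rewrite mulrN cosN.
- by move=> x; rewrite mulrN sinN mulNr.
- by rewrite mulr0 cos0.
- move=> x /andP[x0 xh]; apply: cos_gt0_pihalf; apply/andP; split.
    by apply: lt_le_trans (mulr_ge0 (ltW k0) x0); rewrite oppr_lt0 divr_gt0 ?pi_gt0.
  by apply: le_lt_trans kd; rewrite ler_pM2l.
Qed.

Definition cosh (x : R) : R := (expR x + expR (- x)) / 2.
Definition sinh (x : R) : R := (expR x - expR (- x)) / 2.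

Lemma is_derive_expRN (x : R) : is_derive x 1 (fun x => expR (- x)) (- expR (- x)).
Proof.
have := @is_derive1_comp_affine _ expR x _ (-1) 0 (is_derive_expR _).
under eq_fun do rewrite mulN1r addr0.
by move=> H; apply: (trigger_derive H); rewrite !mulN1r addr0.
Qed.

Lemma is_derive_cosh (x : R) : is_derive x 1 cosh (sinh x).
Proof.
have := is_derive1_scale 2^-1 (is_derive1D (is_derive_expR x) (is_derive_expRN x)).
rewrite (_ : (fun t => _) = cosh); last by apply/funext => t; rewrite /cosh mulrC.
by move=> H; apply: (trigger_derive H); rewrite /sinh mulrC.
Qed.

Lemma is_derive_sinh (x : R) : is_derive x 1 sinh (cosh x).
Proof.
have := is_derive1_scale 2^-1 (is_derive1B (is_derive_expR x) (is_derive_expRN x)).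
rewrite (_ : (fun t => _) = sinh); last by apply/funext => t; rewrite /sinh mulrC.
by move=> H; apply: (trigger_derive H); rewrite /cosh opprK mulrC.
Qed.

Lemma cosh_gt0 x : 0 < cosh x.
Proof. by rewrite divr_gt0// addr_gt0 ?expR_gt0. Qed.

Lemma fundamental_cosh k : 0 < k ->
  fundamental (- k ^+ 2) (fun x => cosh (k * x)) (fun x => sinh (k * x) / k).
Proof.
move=> k0; split.
- have Dc (x : R) : is_derive x 1 (fun x => cosh (k * x)) (- (- k ^+ 2 * (sinh (k * x) / k))).
    have := @is_derive1_comp_affine _ cosh x _ k 0 (is_derive_cosh _).
    under eq_fun do rewrite addr0.
    by move=> H; apply: (trigger_derive H); rewrite addr0; field; rewrite gt_eqF.
  have Ds (x : R) : is_derive x 1 (fun x => sinh (k * x) / k) (cosh (k * x)).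
    have := is_derive1_scale k^-1 (@is_derive1_comp_affine _ sinh x _ k 0 (is_derive_sinh _)).
    under eq_fun do rewrite addr0 mulrC.
    by move=> H; apply: (trigger_derive H); rewrite addr0; field; rewrite gt_eqF.
  by [].
- by move=> x; rewrite mulrN /cosh opprK addrC.
- by move=> x; rewrite mulrN /sinh opprK; field; rewrite gt_eqF.
- by rewrite mulr0 /cosh oppr0 expR0; field.
- by move=> x _; exact: cosh_gt0.
Qed.

Lemma fundamental_affine : fundamental 0 (fun=> 1) id.
Proof.
split=> //; split=> x; last exact: is_derive_id.
by rewrite mul0r oppr0; exact: is_derive1_cst.
Qed.

End FundamentalSystem.

(** * The ground level as a root of the matching equation *)

Section GroundLevel.
Context {R : realType}.
Context (d : R) (d0 : 0 < d).
Implicit Types (c s : R -> R) (lam beta k : R).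

Lemma fundamental_continuous lam c s : fundamental d lam c s -> continuous c /\ continuous s.
Proof.
move=> [[Dc Ds] _ _ _ _].
by split=> x; [exact: is_derive1_continuous (Dc x)|exact: is_derive1_continuous (Ds x)].
Qed.

Lemma fundamental_s0 lam c s : fundamental d lam c s -> s 0 = 0.
Proof. by move=> [_ _ sN _ _]; have := sN 0; rewrite oppr0 => H; lra. Qed.

Lemma fundamental_exists lam : lam < (pi / d) ^+ 2 -> exists c s, fundamental d lam c s.
Proof.
move=> lt; have [l0|l0|<-] := ltgtP 0 lam; last by exists (fun=> 1), id; exact: fundamental_affine.
- exists (fun x => cos (Num.sqrt lam * x)), (fun x => sin (Num.sqrt lam * x) / Num.sqrt lam).
  have q0 : 0 < Num.sqrt lam by rewrite sqrtr_gt0.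
  rewrite -[X in fundamental d X](sqr_sqrtr (ltW l0)); apply: fundamental_cos => //.
  rewrite mulrA ltr_pM2r ?invr_gt0// -ltr_pdivlMr//.
  by rewrite -(@ltr_pXn2r _ 2) ?nnegrE ?sqrtr_ge0 ?divr_ge0 ?pi_ge0 ?(ltW d0)// sqr_sqrtr// ltW.
- exists (fun x => cosh (Num.sqrt (- lam) * x)), (fun x => sinh (Num.sqrt (- lam) * x) / Num.sqrt (- lam)).
  have l1 : 0 < - lam by rewrite oppr_gt0.
  have E : lam = - Num.sqrt (- lam) ^+ 2 by rewrite sqr_sqrtr ?opprK// ltW.
  by rewrite [X in fundamental d X]E; apply: fundamental_cosh; rewrite sqrtr_gt0.
Qed.

(* Sturm comparison: the Wronskians c lam0 s0 - lam s c0 and s lam0 s0 + c c0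
   both increase on the half cell. *)
Lemma fundamental_sturm lam c s lam0 c0 s0 : fundamental d lam c s -> fundamental d lam0 c0 s0 ->
  lam < lam0 -> lam * s (d / 2) * c0 (d / 2) < lam0 * s0 (d / 2) * c (d / 2) /\
  0 < lam0 * s0 (d / 2) * s (d / 2) + c (d / 2) * c0 (d / 2).
Proof.
move=> F F0 lt; have S := fundamental_s_gt0 F; have z0 := fundamental_s0 F; have z00 := fundamental_s0 F0.
case: F => [[Dc Ds] _ _ e0 cgt]; case: F0 => [[Dc0 Ds0] _ _ e00 cgt0].
have h0 : 0 < d / 2 by rewrite divr_gt0.
split.
- have D (x : R) : is_derive x 1 (fun x => lam0 * s0 x * c x - lam * s x * c0 x) ((lam0 - lam) * (c0 x * c x)).
    apply: (trigger_derive (is_derive1B (is_derive1M (is_derive1_scale lam0 (Ds0 x)) (Dc x))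
      (is_derive1M (is_derive1_scale lam (Ds x)) (Dc0 x)))); ring.
  have [z /andP[zl zr]] := MVT_lt h0 D; rewrite z0 z00 !mulr0 !mul0r !subr0 => E.
  rewrite -subr_gt0 E mulr_gt0// mulr_gt0 ?subr_gt0// mulr_gt0 ?cgt0 ?cgt// (ltW zl)/= ltW//.
- have D (x : R) : is_derive x 1 (fun x => lam0 * s0 x * s x + c x * c0 x) ((lam0 - lam) * (s x * c0 x)).
    apply: (trigger_derive (is_derive1D (is_derive1M (is_derive1_scale lam0 (Ds0 x)) (Ds x))
      (is_derive1M (Dc x) (Dc0 x)))); ring.
  have [z /andP[zl zr]] := MVT_lt h0 D; rewrite z0 z00 !mulr0 add0r e0 e00 mulr1 subr0 => E.
  have : 0 < (lam0 - lam) * (s z * c0 z) * (d / 2).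
    rewrite mulr_gt0// mulr_gt0 ?subr_gt0// mulr_gt0 ?S ?cgt0//; first by rewrite zl ltW.
    by rewrite (ltW zl)/= ltW.
  by rewrite -E; lra.
Qed.

(** Multiplied by c0 (d / 2) and simplified with the level equation, the two hypotheses of
    [decaying_solution_exists] become twice the two inequalities of [fundamental_sturm]. *)
Lemma E0_ground beta lam0 c0 s0 : fundamental d lam0 c0 s0 -> lam0 < (pi / d) ^+ 2 ->
  beta * c0 (d / 2) = 2 * lam0 * s0 (d / 2) -> E0 d beta = lam0.
Proof.
move=> F0 l0 E; have C0 := fundamental_c_gt0 d0 F0.
have [u [u1 [K [e [M [sol HK e0 HM _]]]]]] := ground_state_exists d0 F0 E.
apply: (E0_eq d0 e0 HM sol HK) => lam lt.
have [c [s F]] := fundamental_exists (lt_trans lt l0).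
have [W1 W2] := fundamental_sturm F F0 lt.
apply: (decaying_solution_exists d0 F).
- rewrite -(pmulr_lgt0 _ C0).
  have -> : (beta * c (d / 2) - 2 * lam * s (d / 2)) * c0 (d / 2) =
    (beta * c0 (d / 2)) * c (d / 2) - 2 * (lam * s (d / 2) * c0 (d / 2)) by ring.
  rewrite E subr_gt0; have -> : 2 * lam0 * s0 (d / 2) * c (d / 2) = 2 * (lam0 * s0 (d / 2) * c (d / 2)) by ring.
  by rewrite ltr_pM2l.
- rewrite -(pmulr_lgt0 _ C0).
  have -> : (2 * c (d / 2) + beta * s (d / 2)) * c0 (d / 2) =
    (beta * c0 (d / 2)) * s (d / 2) + 2 * (c (d / 2) * c0 (d / 2)) by ring.
  rewrite E; have -> : 2 * lam0 * s0 (d / 2) * s (d / 2) + 2 * (c (d / 2) * c0 (d / 2)) =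
    2 * (lam0 * s0 (d / 2) * s (d / 2) + c (d / 2) * c0 (d / 2)) by ring.
  by rewrite mulr_gt0.
Qed.

Lemma IVT_zero (f : R -> R) (b : R) : 0 < b -> continuous f -> f 0 < 0 -> 0 < f b ->
  exists2 k, 0 < k < b & f k = 0.
Proof.
move=> b0 cf f0 fb.
have [] := @IVT R f 0 b 0 (ltW b0) (continuous_subspaceT cf).
  by rewrite ge_min le_max (ltW f0) (ltW fb) orbT.
move=> k; rewrite in_itv/= => /andP[k0 kb] fk; exists k => //.
rewrite !lt_neqAle k0 kb !andbT; apply/andP; split; apply/eqP.
  by move=> E; move: f0; rewrite {1}E fk ltxx.
by move=> E; move: fb; rewrite -E fk ltxx.
Qed.

(** With lam = k^2 and h = d / 2 the equation is 2 k sin (k h) = beta cos (k h). Its sides change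
    order between k = 0 and k = pi / d, where the cosine vanishes. *)
Lemma ground_level_pos beta : 0 < beta -> exists lam c s,
  [/\ fundamental d lam c s, lam < (pi / d) ^+ 2 & beta * c (d / 2) = 2 * lam * s (d / 2)].
Proof.
move=> b0; have p0 : 0 < pi / d by rewrite divr_gt0 ?pi_gt0.
pose f k := 2 * k * sin (k * (d / 2)) - beta * cos (k * (d / 2)).
have cf : continuous f.
  have ck : continuous (fun k : R => k * (d / 2)).
    by move=> k; apply: cvgM; [exact: cvg_id|exact: cvg_cst].
  move=> k; apply: cvgB; apply: cvgM; try exact: cvg_cst.
  - by apply: cvgM; [exact: cvg_cst|exact: cvg_id].
  - by apply: (continuous_comp (ck k)); exact: continuous_sin.
  - by apply: (continuous_comp (ck k)); exact: continuous_cos.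
have E : pi / d * (d / 2) = pi / 2 by field; rewrite gt_eqF.
have [||k /andP[k0 kd] fk] := IVT_zero p0 cf.
- by rewrite /f mulr0 !mul0r cos0 mulr1 sub0r oppr_lt0.
- by rewrite /f E sin_pihalf cos_pihalf mulr0 subr0 mulr1 mulr_gt0.
exists (k ^+ 2), (fun x => cos (k * x)), (fun x => sin (k * x) / k); split.
- by apply: fundamental_cos => //; rewrite -E ltr_pM2r// divr_gt0.
- by rewrite ltr_pXn2r ?nnegrE ?(ltW k0) ?(ltW p0).
- have -> : 2 * k ^+ 2 * (sin (k * (d / 2)) / k) = 2 * k * sin (k * (d / 2)).
    by field; rewrite gt_eqF.
  by move: fk => /eqP; rewrite subr_eq0 => /eqP.
Qed.

Lemma ground_level_neg beta : beta < 0 -> exists lam c s,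
  [/\ fundamental d lam c s, lam < (pi / d) ^+ 2 & beta * c (d / 2) = 2 * lam * s (d / 2)].
Proof.
move=> b0; have h0 : 0 < d / 2 by rewrite divr_gt0.
pose f k := 2 * k * sinh (k * (d / 2)) + beta * cosh (k * (d / 2)).
have cf : continuous f.
  have ck : continuous (fun k : R => k * (d / 2)).
    by move=> k; apply: cvgM; [exact: cvg_id|exact: cvg_cst].
  move=> k; apply: cvgD; apply: cvgM; try exact: cvg_cst.
  - by apply: cvgM; [exact: cvg_cst|exact: cvg_id].
  - apply: (continuous_comp (ck k)); exact: is_derive1_continuous (is_derive_sinh _).
  - apply: (continuous_comp (ck k)); exact: is_derive1_continuous (is_derive_cosh _).
(* With h = d / 2, K h >= 2 gives sinh (K h) >= 1, and cosh <= sinh + 1 on the positive axis. As 2 K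
   + beta > 0, this yields f K >= 2 K + 2 beta = 4 / h > 0. *)
pose K := - beta + 2 / (d / 2).
have K0 : 0 < K by rewrite addr_gt0 ?oppr_gt0 ?divr_gt0.
have [||k /andP[k0 _] fk] := IVT_zero K0 cf.
- by rewrite /f mulr0 !mul0r /cosh oppr0 expR0 add0r (_ : (1 + 1) / 2 = 1) ?mulr1//; field.
- have y2 : 2 <= K * (d / 2).
    have -> : K * (d / 2) = - beta * (d / 2) + 2 by rewrite /K; field; rewrite gt_eqF.
    by rewrite lerDr mulr_ge0 ?oppr_ge0 ?ltW.
  rewrite /f; set y := K * (d / 2) in y2 *.
  have e1 : 1 + y <= expR y by exact: expR_ge1Dx.
  have e2 : expR (- y) <= 1 by rewrite -expR0 ler_expR oppr_le0 (le_trans _ y2).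
  have s1 : 1 <= sinh y by rewrite /sinh ler_pdivlMr//; lra.
  have cs : cosh y <= sinh y + 1 by rewrite /cosh /sinh; lra.
  have H1 : beta * (sinh y + 1) <= beta * cosh y by rewrite ler_nM2l.
  have H2 : (2 * K + beta) * 1 <= (2 * K + beta) * sinh y.
    by rewrite ler_wpM2l//; rewrite /K; have : 0 < 2 / (d / 2); [rewrite divr_gt0|lra].
  have H3 : 0 < 2 / (d / 2) by rewrite divr_gt0.
  have H4 : 0 < 2 * K + 2 * beta by rewrite /K; lra.
  by lra.
exists (- k ^+ 2), (fun x => cosh (k * x)), (fun x => sinh (k * x) / k); split.
- exact: fundamental_cosh.
- by apply: lt_trans (_ : 0 < _); rewrite ?oppr_lt0 exprn_gt0// divr_gt0 ?pi_gt0.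
- have -> : 2 * - k ^+ 2 * (sinh (k * (d / 2)) / k) = - (2 * k * sinh (k * (d / 2))).
    by field; rewrite gt_eqF.
  by move: fk => /eqP; rewrite /f addrC addr_eq0 => /eqP.
Qed.

Lemma ground_level beta : beta != 0 -> exists lam c s,
  [/\ fundamental d lam c s, lam < (pi / d) ^+ 2 & beta * c (d / 2) = 2 * lam * s (d / 2)].
Proof. by rewrite neq_lt => /orP[]; [exact: ground_level_neg|exact: ground_level_pos]. Qed.

End GroundLevel.

(** * The ground state *)

Section GroundState.
Context {R : realType}.
Notation mu := (@lebesgue_measure R).
Context (d : R) (d0 : 0 < d).
Context (beta lam : R) (c s : R -> R).
Hypothesis F : fundamental d lam c s.
Hypothesis lam_lt : lam < (pi / d) ^+ 2.
Hypothesis E : beta * c (d / 2) = 2 * lam * s (d / 2).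

Let E0lam : E0 d beta = lam := E0_ground d0 F lam_lt E.
Let cN x : c (- x) = c x. Proof. by case: F. Qed.
Let cgt x : - (d / 2) <= x <= d / 2 -> 0 < c x.
Proof.
have [_ _ _ _ H] := F; move=> /andP[xl xr].
have [x0|/ltW x0] := leP 0 x; first by rewrite H ?x0.
by rewrite -cN H// oppr_ge0 x0/= lerNl.
Qed.

Lemma ground_state_periodic : exists u, periodic_solution d beta u.
Proof.
have [u [u1 [K [e [M [[cu u0 Du Du1 Ju] HK e0 HM uc]]]]]] := ground_state_exists d0 F E.
exists u; split=> //.
- by exists 0; rewrite gt_eqF.
- move=> x; have /andP[b1 b2] := cell_index_bound d0 x; set n := cell_index d x in b1 b2.
  rewrite (uc n x) ?(uc (n + 1) (x + d)).
  + by congr c; rewrite intrD; ring.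
  + by rewrite addrK node_succ lerD2r /node; apply/andP; split; lra.
  + by rewrite node_pred /node; apply/andP; split; lra.
- move=> x ox; have D x' (ox' : off_nodes d x') := is_derive1E (Du x' ox').
  have near1 : \forall z \near x, u1 z = derive1 u z.
    have [n /andP[nx xn]] := off_nodes_cell d0 ox; near=> z; rewrite D//.
    apply: (@cell_off_nodes _ _ d0 n); apply/andP; split; near: z; [exact: near_gt|exact: near_lt].
  have D2 := is_derive1_near near1 (Du1 x ox).
  split; [by have [] := Du x ox|by have [] := D2|].
  by rewrite /derive1n/= (is_derive1E D2) opprK E0lam.
- move=> n; have [l [r [Jl Jr J]]] := Ju n; exists l, r; split=> //.
  + apply: cvg_trans Jl; apply: near_eq_cvg; near=> z; rewrite (is_derive1E (Du z _))//.
    by apply: (@cell_off_nodes _ _ d0 n); near: z; exact: near_left_cell.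
  + apply: cvg_trans Jr; apply: near_eq_cvg; near=> z; rewrite (is_derive1E (Du z _))//.
    by apply: (@cell_off_nodes _ _ d0 (n + 1)); rewrite addrK; near: z; exact: near_right_cell.
Unshelve. all: by end_near. Qed.

(* v / c takes equal values at both ends of the cell, so by Rolle the (constant)
   Wronskian of v and c vanishes, and v / c is constant. *)
Lemma periodic_solution_cell v : periodic_solution d beta v ->
  exists2 a, a != 0 & forall x, - (d / 2) <= x <= d / 2 -> v x = a * c x.
Proof.
move=> [cv [y vy] vd Dv _]; have h0 : 0 < d / 2 by rewrite divr_gt0.
have [[Dc Ds] _ _ c0 _] := F; have [cc _] := fundamental_continuous F.
have ih x : - (d / 2) < x < d / 2 -> off_nodes d x.
  move=> xh; apply: (@cell_off_nodes _ _ d0 0); rewrite node_pred /node.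
  by move: xh => /andP[x1 x2]; apply/andP; split; lra.
have D1 x (xh : - (d / 2) < x < d / 2) : is_derive x 1 v (derive1 v x).
  by apply: derivable1_is_derive; have [] := Dv x (ih x xh).
have D2 x (xh : - (d / 2) < x < d / 2) : is_derive x 1 (derive1 v) (- (lam * v x)).
  have [_ H] := Dv x (ih x xh); rewrite E0lam => <-; rewrite opprK.
  exact: derivable1_is_derive.
pose P x := derive1 v x * c x + v x * (lam * s x).
have DP x : - (d / 2) < x < d / 2 -> is_derive x 1 P 0.
  move=> xh; apply: (trigger_derive (is_derive1D (is_derive1M (D2 x xh) (Dc x))
    (is_derive1M (D1 x xh) (is_derive1_scale lam (Ds x))))); ring.
have Pcst x y' : - (d / 2) < x -> x <= y' -> y' < d / 2 -> P x = P y'.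
  move=> xh xy yh.
  have [] := @MVT_segment _ P (fun=> 0) x y' xy.
  - move=> t; rewrite in_itv/= => /andP[xt ty]; apply: DP.
    by rewrite (lt_trans xh xt) (lt_trans ty yh).
  - apply: derivable_within_continuous => t; rewrite in_itv/= => /andP[xt ty].
    by have [] := DP t; rewrite ?(lt_le_trans xh xt) ?(le_lt_trans ty yh).
  by move=> z _ /eqP; rewrite mul0r subr_eq0 => /eqP.
pose r x := v x / c x.
have Dr x : - (d / 2) < x < d / 2 -> is_derive x 1 r (P x / c x ^+ 2).
  move=> xh; have cx : c x != 0 by rewrite gt_eqF// cgt// !ltW//; case/andP: xh.
  by apply: (trigger_derive (is_derive1_div cx (D1 x xh) (Dc x))); rewrite /P; congr (_ / _); ring.
have cr a b : - (d / 2) <= a -> b <= d / 2 -> {within `[a, b], continuous r}.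
  move=> al bl; apply: continuous_in_subspaceT => x; rewrite inE/= in_itv/= => /andP[ax xb].
  apply: cvgM; first exact: cv.
  by apply: cvgV; [rewrite gt_eqF// cgt// (le_trans al ax) (le_trans xb bl)|exact: cc].
have hh : - (d / 2) < d / 2 by lra.
have Dr' x : x \in `](- (d / 2)), (d / 2)[ -> is_derive x 1 r (P x / c x ^+ 2).
  by rewrite in_itv/= => xh; exact: Dr.
have [z] := MVT hh Dr' (cr _ _ (lexx _) (lexx _)).
rewrite in_itv/= => zh.
have -> : r (- (d / 2)) = r (d / 2).
  by rewrite /r cN; congr (_ / _); rewrite -vd; congr v; field.
have dd : d / 2 - - (d / 2) != 0 by rewrite subr_eq0 gt_eqF.
have cz : c z != 0 by rewrite gt_eqF// cgt// !ltW//; case/andP: zh.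
rewrite subrr => /esym/eqP; rewrite !mulf_eq0 (negbTE dd) orbF invr_eq0 expf_eq0/= (negbTE cz) orbF => /eqP Pz.
have P0 x : - (d / 2) < x < d / 2 -> P x = 0.
  move=> /andP[x1 x2]; have /andP[z1 z2] := zh; rewrite -Pz.
  by have [xz|/ltW zx] := leP x z; [exact: Pcst|apply/esym/Pcst].
have rc x : - (d / 2) <= x <= d / 2 -> r x = r (- (d / 2)).
  move=> /andP[x1 x2].
  have Dr0 t : t \in `](- (d / 2)), x[ -> is_derive t 1 r 0.
    rewrite in_itv/= => /andP[t1 t2].
    have th : - (d / 2) < t < d / 2 by rewrite t1 (lt_le_trans t2 x2).
    by have := Dr t th; rewrite P0// mul0r.
  have [t _ /eqP] := MVT_segment x1 Dr0 (cr _ _ (lexx _) x2).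
  by rewrite mul0r subr_eq0 => /eqP.
exists (r (- (d / 2))).
- apply: contra_neq vy => r0.
  have vx x : - (d / 2) <= x <= d / 2 -> v x = 0.
    move=> xh; have := rc x xh; rewrite r0 => /eqP; rewrite mulf_eq0 invr_eq0.
    by rewrite (gt_eqF (cgt xh)) orbF => /eqP.
  have per n : v (y - d * n%:~R) = v y.
    have := @int_const R (fun n : int => v (y - d * n%:~R)) _ n; rewrite mulr0 subr0; apply.
    by move=> k; rewrite -[RHS]vd intrD; congr v; ring.
  by rewrite -(per (cell_index d y)) vx// cell_index_bound.
- move=> x xh; rewrite -(rc x xh) /r divfK// gt_eqF// cgt//.
Qed.

(** The segment [0, d] of [c_crit] has a node at its midpoint. Reflecting the second half onto the
    first, a primitive on the half cell [0, d / 2] is enough. *)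
Lemma Rintegral_symmetric (f G : R -> R) : {within `[0, d], continuous f} ->
  (forall t, 0 <= t <= d / 2 -> is_derive t 1 G (f t)) ->
  (forall t, 0 <= t <= d / 2 -> f (d - t) = f t) ->
  \int[mu]_(t in `[0, d]) f t = 2 * (G (d / 2) - G 0).
Proof.
move=> cf DG fs; have h0 : 0 < d / 2 by rewrite divr_gt0.
have hd : d / 2 <= d by lra.
rewrite (@Rintegral_split _ f 0 (d / 2) d) ?(ltW h0)//; last first.
  by apply: continuous_compact_integrable => //; exact: segment_compact.
rewrite (@Rintegral_derive_segment _ G f) ?(ltW h0)//; last first.
  by apply: continuous_subspaceW cf; apply: subset_itvl; rewrite bnd_simp.
have DG2 (t : R) : d / 2 <= t <= d -> is_derive t 1 (fun t => - G (d - t)) (f t).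
  move=> /andP[t1 t2]; have td : 0 <= d - t <= d / 2 by apply/andP; split; lra.
  have := DG _ td; rewrite -fs// (_ : d - (d - t) = t); last by ring.
  rewrite (_ : d - t = -1 * t + d); last by ring.
  move=> /is_derive1_comp_affine/is_derive1N.
  under eq_fun do rewrite mulN1r addrC.
  by move=> H; apply: (trigger_derive H); ring.
rewrite (Rintegral_derive_segment hd DG2).
  rewrite subrr (_ : d - d / 2 = d / 2); last by field.
  by ring.
by apply: continuous_subspaceW cf; apply: subset_itvr; rewrite bnd_simp ltW.
Qed.

(** The Cauchy-Schwarz quotient: the integrals of c^2 and of c^-2 over [0, d / 2], multiplied and
    divided by (d / 2)^2. *)
Definition ratio : R := (d / 2 + s (d / 2) * c (d / 2)) * s (d / 2) / (2 * (d / 2) ^+ 2 * c (d / 2)).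

(** Whichever periodic solution [u_sol] selects is a multiple a c of c on the central cell, and a^2
    cancels between the two means. *)
Lemma alpha_critE : alpha_crit d beta = Num.sqrt (4^-1 * (1 - ratio^-1)).
Proof.
have h0 : 0 < d / 2 by rewrite divr_gt0.
have [u Hu] := ground_state_periodic.
have V : periodic_solution d beta (u_sol d beta) by apply: (@getPex _ (periodic_solution d beta)); exists u.
rewrite /alpha_crit /c_crit; move: (u_sol d beta) V => {u Hu} v Hv.
have [a a0 va] := periodic_solution_cell Hv.
have [cv _ vd _ _] := Hv.
have [[Dc Ds] _ _ c0 _] := F.
have v1 t : 0 <= t <= d / 2 -> v t = a * c t.
  by move=> /andP[t1 t2]; apply: va; apply/andP; split; lra.
have v2 t : 0 <= t <= d / 2 -> v (d - t) = v t.
  move=> td; rewrite (v1 t td) -(cN t) addrC vd va//.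
  by move: td => /andP[t1 t2]; apply/andP; split; lra.
have ct t : 0 <= t <= d / 2 -> c t != 0.
  by move=> /andP[t1 t2]; rewrite gt_eqF// cgt//; apply/andP; split; lra.
have vn t : 0 <= t <= d -> v t != 0.
  move=> /andP[t1 t2]; have [th|ht] := leP t (d / 2).
    by rewrite v1 ?t1// mulf_neq0// ct// t1.
  have td : 0 <= d - t <= d / 2 by apply/andP; split; lra.
  have := v2 _ td; rewrite (_ : d - (d - t) = t); last by ring.
  by move=> ->; rewrite v1// mulf_neq0// ct.
have W := fundamental_wronskian F; have s0 := fundamental_s0 F.
have c2 : continuous (fun t => v t ^+ 2).
  by move=> x; apply: (@continuous_comp _ _ _ v (fun y => y ^+ 2)); [exact: cv|exact: exprn_continuous].
have -> : \int[mu]_(x in `[0, d]) (v x ^+ 2) = a ^+ 2 * (d / 2 + s (d / 2) * c (d / 2)).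
  have DG (t : R) : 0 <= t <= d / 2 -> is_derive t 1 (fun t => a ^+ 2 / 2 * (t + s t * c t)) (v t ^+ 2).
    move=> td; rewrite v1//.
    have := is_derive1_scale (a ^+ 2 / 2) (is_derive1D (is_derive_id t 1) (is_derive1M (Ds t) (Dc t))).
    move=> H; apply: (trigger_derive H).
    (* The Wronskian relation turns the derivative 1 + c^2 - lam s^2 of t + s c into 2 c^2. *)
    have -> : s t * - (lam * s t) = c t ^+ 2 - (c t ^+ 2 + lam * s t ^+ 2) by ring.
    by rewrite W; field.
  rewrite (Rintegral_symmetric _ DG).
  - by rewrite s0 mul0r addr0 mulr0 subr0; field.
  - exact: continuous_subspaceT.
  - by move=> t td; rewrite v2.
have -> : \int[mu]_(x in `[0, d]) (v x ^+ 2)^-1 = 2 * (s (d / 2) / c (d / 2)) / a ^+ 2.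
  have DG (t : R) : 0 <= t <= d / 2 ->
      is_derive t 1 (fun t => (a ^+ 2)^-1 * (s t / c t)) (v t ^+ 2)^-1.
    move=> td; rewrite v1//.
    apply: (trigger_derive (is_derive1_scale (a ^+ 2)^-1 (is_derive1_div (ct t td) (Ds t) (Dc t)))).
    have -> : c t * c t - s t * - (lam * s t) = 1 by rewrite -(W t); ring.
    by rewrite div1r exprMn -invfM.
  rewrite (Rintegral_symmetric _ DG).
  - by rewrite s0 mul0r mulr0 subr0; ring.
  - apply: continuous_in_subspaceT => x; rewrite inE/= in_itv/= => xd.
    by apply: cvgV; [rewrite expf_neq0// vn|exact: c2].
  - by move=> t td; rewrite v2.
have S0 := fundamental_s_gt0 F (half_cell d0); have C0 := fundamental_c_gt0 d0 F.
congr Num.sqrt; rewrite /ratio.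
by field; rewrite a0 !gt_eqF//= addr_gt0// !mulr_gt0.
Qed.

End GroundState.

(** * The critical flux *)

Section RatioBounds.
Context {R : realType}.
Context (d : R) (d0 : 0 < d).
Context (beta lam : R) (c s : R -> R).
Hypothesis F : fundamental d lam c s.
Hypothesis E : beta * c (d / 2) = 2 * lam * s (d / 2).
Local Notation h := (d / 2).

Let h0 : 0 < h. Proof. by rewrite divr_gt0. Qed.

Let S0 : 0 < s h. Proof. exact: fundamental_s_gt0 F _ (half_cell d0). Qed.

Let C0 : 0 < c h. Proof. exact: (fundamental_c_gt0 d0 F). Qed.

Let s0 : s 0 = 0. Proof. exact: fundamental_s0 F. Qed.

Let Dc (x : R) : is_derive x 1 c (- (lam * s x)). Proof. by case: F => -[]. Qed.

Let Ds (x : R) : is_derive x 1 s (c x). Proof. by case: F => -[]. Qed.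

Let c0 : c 0 = 1. Proof. by case: F. Qed.

Let cgt x : 0 <= x <= h -> 0 < c x. Proof. by case: F => _ _ _ _; apply. Qed.

Let sgt x : 0 < x <= h -> 0 < s x. Proof. exact: fundamental_s_gt0 F _. Qed.

Let lam_gt0 : (0 < lam) = (0 < beta).
Proof.
have -> : (0 < beta) = (0 < beta * c h) by rewrite pmulr_lgt0.
by rewrite E pmulr_lgt0// pmulr_rgt0.
Qed.

Let lam_lt0 : (lam < 0) = (beta < 0).
Proof.
have -> : (beta < 0) = (beta * c h < 0) by rewrite pmulr_llt0.
by rewrite E pmulr_llt0// pmulr_rlt0.
Qed.

(* With m = h / \int_0^h c^2, the function m (t + s c) / 2 + (s / c) / m - 2 t has the
   nonnegative derivative (m c^2 - 1)^2 / (m c^2), which does not vanish identically. *)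
Lemma ratio_gt1 : beta != 0 -> 1 < ratio d c s.
Proof.
move=> b0; pose X := (h + s h * c h) / 2; pose m := h / X.
have X0 : 0 < X by rewrite divr_gt0// addr_gt0// mulr_gt0.
have m0 : 0 < m by rewrite divr_gt0.
pose Z t := m * ((t + s t * c t) / 2) + m^-1 * (s t / c t) - 2 * t.
pose Z1 t := (m * c t ^+ 2 - 1) ^+ 2 / (m * c t ^+ 2).
have W := fundamental_wronskian F.
have ct t : 0 <= t <= h -> c t != 0 by move=> /cgt; rewrite lt0r => /andP[].
have DZ (t : R) : 0 <= t <= h -> is_derive t 1 Z (Z1 t).
  move=> th; have D1 := is_derive1_scale m (is_derive1_scale 2^-1 (is_derive1D (is_derive_id t 1) (is_derive1M (Ds t) (Dc t)))).
  have D2 := is_derive1_scale m^-1 (is_derive1_div (ct t th) (Ds t) (Dc t)).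
  have D3 := is_derive1B (is_derive1D D1 D2) (is_derive1_scale 2 (is_derive_id t 1)).
  rewrite (_ : Z = fun t => m * (2^-1 * (t + s t * c t)) + m^-1 * (s t / c t) - 2 * t); last first.
    by apply/funext => x; rewrite /Z [_ / 2]mulrC.
  apply: (trigger_derive D3).
  have -> : s t * - (lam * s t) = c t ^+ 2 - 1 by rewrite -(W t); ring.
  by rewrite /Z1; field; rewrite (ct t th) gt_eqF.
have step a b : 0 <= a -> a < b -> b <= h ->
    exists2 z, a < z < b & Z b - Z a = Z1 z * (b - a).
  move=> a0 ab bh; have [||z] := @MVT _ Z Z1 a b ab.
  - by move=> t; rewrite in_itv/= => /andP[at_ tb]; apply: DZ; rewrite (le_trans a0 (ltW at_)) (le_trans (ltW tb)).
  - apply: derivable_within_continuous => t; rewrite in_itv/= => /andP[at_ tb].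
    by have [] := DZ t; rewrite ?(le_trans a0 at_) ?(le_trans tb).
  by rewrite in_itv/= => zab zE; exists z.
have k0 : 0 < h / 2 by rewrite divr_gt0.
have kh : h / 2 < h by have := h0; lra.
(* One mean value point in each half: if Z h = Z 0, both are zeros of Z1, so c takes the same value
   at two distinct points, and Rolle's theorem forces lam = 0, hence beta = 0. *)
have [z1 /andP[z10 z11] E1] := step 0 (h / 2) (lexx 0) k0 (ltW kh).
have [z2 /andP[z20 z21] E2] := step (h / 2) h (ltW k0) kh (lexx _).
have Z1_ge0 z : 0 < m * c z ^+ 2 -> 0 <= Z1 z by move=> H; rewrite divr_ge0 ?sqr_ge0// ltW.
have z1h : 0 <= z1 <= h by rewrite (ltW z10)/= (le_trans (ltW z11) (ltW kh)).
have z2h : 0 <= z2 <= h by rewrite (le_trans (ltW k0) (ltW z20)) ltW.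
have p1 : 0 < m * c z1 ^+ 2 by rewrite mulr_gt0// exprn_gt0// cgt.
have p2 : 0 < m * c z2 ^+ 2 by rewrite mulr_gt0// exprn_gt0// cgt.
have Zh : 0 < Z h - Z 0.
  rewrite lt0r; apply/andP; split; last first.
    have -> : Z h - Z 0 = (Z h - Z (h / 2)) + (Z (h / 2) - Z 0) by ring.
    by rewrite E1 E2 addr_ge0// mulr_ge0 ?Z1_ge0// subr_ge0 ltW.
  apply: contra_neq b0 => Z0.
  have H1 : 0 <= Z (h / 2) - Z 0 by rewrite E1 mulr_ge0 ?Z1_ge0// subr_ge0 ltW.
  have H2 : 0 <= Z h - Z (h / 2) by rewrite E2 mulr_ge0 ?Z1_ge0// subr_ge0 ltW.
  have e1 : Z (h / 2) - Z 0 = 0 by lra.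
  have e2 : Z h - Z (h / 2) = 0 by lra.
  have sol z b : 0 < b -> 0 < m * c z ^+ 2 -> Z1 z * b = 0 -> c z ^+ 2 = m^-1.
    move=> bp pz /eqP; rewrite mulf_eq0 (gt_eqF bp) orbF /Z1 mulf_eq0 invr_eq0 (gt_eqF pz) orbF.
    rewrite expf_eq0/= subr_eq0 => /eqP H; apply: (mulfI (lt0r_neq0 m0)).
    by rewrite H mulfV ?gt_eqF.
  have r1 : c z1 ^+ 2 = m^-1.
    apply: (sol z1 (h / 2 - 0)) => //; [by rewrite subr0|by rewrite -E1].
  have r2 : c z2 ^+ 2 = m^-1.
    apply: (sol z2 (h - h / 2)) => //; [by rewrite subr_gt0|by rewrite -E2].
  have cc : c z1 = c z2.
    apply/eqP; rewrite -(@eqrXn2 _ 2) ?ltW ?cgt//; apply/eqP; by rewrite r1 r2.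
  have z12 : z1 < z2 by apply: lt_trans z20.
  have [z /andP[zl zr]] := MVT_lt z12 Dc; rewrite cc subrr => /esym/eqP.
  rewrite mulf_eq0 oppr_eq0 mulf_eq0 subr_eq0 (gt_eqF z12) orbF.
  have /gt_eqF -> : 0 < s z by rewrite sgt// (lt_trans z10 zl) ltW// (lt_trans zr).
  rewrite orbF => /eqP l0; have := E; rewrite l0 mulr0 mul0r => /eqP.
  by rewrite mulf_eq0 (gt_eqF C0) orbF => /eqP.
rewrite -(ltr_pM2l h0) mulr1 -subr_gt0.
suff -> : h * ratio d c s - h = Z h - Z 0 by [].
have Z0 : Z 0 = 0 by rewrite /Z s0; ring.
rewrite Z0 subr0 /Z /m /X /ratio.
by field; rewrite !gt_eqF//= addr_gt0// !mulr_gt0.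
Qed.

Lemma ratioE : ratio d c s = s h / (2 * h * c h) + s h ^+ 2 / (2 * h ^+ 2).
Proof. by rewrite /ratio; field; rewrite !gt_eqF. Qed.

Lemma s_increasing x : 0 <= x <= h -> 0 <= s x <= s h.
Proof.
move=> /andP[x0 xh]; have [z /andP[z1 z2] e1] := MVT_le x0 Ds.
have [y /andP[y1 y2] e2] := MVT_le xh Ds; apply/andP; split.
  by move: e1; rewrite s0 !subr0 => ->; rewrite mulr_ge0// ltW// cgt// z1 (le_trans z2).
by rewrite -subr_ge0 e2 mulr_ge0 ?subr_ge0// ltW// cgt// (le_trans x0 y1).
Qed.

(** Write S, C for the values at h. The mean value theorem and the monotonicity of s and c give S <=
    h and C (1 + beta h / 2) >= 1 when beta >= 0, and S <= C h and C (1 + beta h / 2) <= 1 when beta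
    < 0. The factor 2 comes from the second case. *)
Lemma ratio_le : `|beta| * h <= 1 -> ratio d c s <= 1 + 2 * (`|beta| * h).
Proof.
have [z /andP[z0 zh] cz] := MVT_lt h0 Dc; rewrite c0 subr0 in cz.
have [w /andP[w0 wh] sw] := MVT_lt h0 Ds; rewrite s0 !subr0 in sw.
have sz : 0 <= s z <= s h by apply: s_increasing; rewrite !ltW.
have [sz0 sz1] := andP sz.
have [w' /andP[w'0 w'w] cw] := MVT_lt w0 Dc; rewrite c0 subr0 in cw.
have [y /andP[y0 yh] cy] := MVT_lt wh Dc.
have sy : 0 <= s y by rewrite ltW// sgt// (lt_trans w0 y0) ltW.
have sw' : 0 <= s w' by rewrite ltW// sgt// w'0 ltW// (lt_trans w'w).
(* Eliminates the unknown level lam in favour of beta. *)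
have eC : 2 * (lam * s h * h) = beta * h * c h.
  by rewrite (mulrAC beta) E; ring.
rewrite ratioE; have [b0|b0] := ger0P beta.
- have l0 : 0 <= lam by rewrite leNgt lam_lt0 -leNgt.
  move=> bh.
  have cw1 : c w <= 1.
    by rewrite -subr_le0 cw mulNr oppr_le0 !mulr_ge0// ltW.
  have sh1 : s h <= h by rewrite sw -[leRHS]mul1r ler_pM2r.
  have H : 1 <= c h * (1 + beta * h / 2).
    have : lam * s z * h <= lam * s h * h by rewrite ler_wpM2r ?(ltW h0)// ler_wpM2l.
    by move=> H; lra.
  have r1 : s h / (2 * h * c h) <= 2^-1 * (1 + beta * h / 2).
    rewrite ler_pdivrMr ?mulr_gt0//.
    have -> : 2^-1 * (1 + beta * h / 2) * (2 * h * c h) = h * (c h * (1 + beta * h / 2)) by field.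
    by apply: le_trans sh1 _; rewrite ler_pMr.
  have r2 : s h ^+ 2 / (2 * h ^+ 2) <= 2^-1.
    rewrite ler_pdivrMr ?mulr_gt0 ?exprn_gt0// mulrA mulVf// mul1r.
    by rewrite ler_pXn2r ?nnegrE ?(ltW h0) ?(ltW S0).
  have bh0 : 0 <= beta * h by rewrite mulr_ge0// ltW.
  by lra.
- have l0 : lam < 0 by rewrite lam_lt0.
  rewrite mulNr => bh.
  have cw1 : c w <= c h.
    by rewrite -subr_ge0 cy mulr_ge0 ?subr_ge0 ?(ltW wh)// oppr_ge0 mulr_le0_ge0// ltW.
  have sh1 : s h <= c h * h by rewrite sw ler_pM2r.
  have H : c h * (1 + beta * h / 2) <= 1.
    have : lam * s h * h <= lam * s z * h by rewrite ler_wpM2r ?(ltW h0)// ler_wnM2l// ltW.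
    by move=> H; lra.
  have bh0 : 0 < - (beta * h) by rewrite oppr_gt0 pmulr_llt0.
  have w2 : 2^-1 <= 1 + beta * h / 2 by lra.
  have C2 : c h <= 2.
    have : c h * 2^-1 <= c h * (1 + beta * h / 2) by rewrite ler_pM2l.
    by move=> H'; lra.
  (* With x = - beta h and C = c h, C <= 2 gives C <= 1 + x, and then C^2 <= C + C^2 x / 2 <= 1 + 3
     x. *)
  have H2 : c h ^+ 2 <= 1 + 4 * (- (beta * h)).
    have : c h * - (beta * h) <= 2 * - (beta * h) by rewrite ler_pM2r.
    move=> h1; have : c h <= 1 + - (beta * h) by lra.
    move=> h2; have : c h * (c h * (1 + beta * h / 2)) <= c h * 1 by rewrite ler_pM2l.
    have : c h * (c h * - (beta * h)) <= 2 * (2 * - (beta * h)).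
      apply: ler_pM => //; first exact: ltW.
      by rewrite mulr_ge0// ltW.
    by rewrite expr2 => h3; lra.
  have r1 : s h / (2 * h * c h) <= 2^-1.
    rewrite ler_pdivrMr ?mulr_gt0// (_ : 2^-1 * (2 * h * c h) = c h * h)//; by field.
  have r2 : s h ^+ 2 / (2 * h ^+ 2) <= 2^-1 * c h ^+ 2.
    rewrite ler_pdivrMr ?mulr_gt0 ?exprn_gt0//.
    have -> : 2^-1 * c h ^+ 2 * (2 * h ^+ 2) = (c h * h) ^+ 2 by field.
    have ch : 0 <= c h * h by rewrite mulr_ge0// ltW.
    by rewrite ler_pXn2r// nnegrE// ltW.
  by lra.
Qed.

(** By the level equation the first summand of [ratioE] is beta / (4 h lam), and lam < (pi / d)^2
    with d = 2 h. *)
Lemma ratio_ge_pos : 0 < beta -> lam < (pi / d) ^+ 2 -> beta * h / pi ^+ 2 <= ratio d c s.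
Proof.
move=> b0 l1; have l0 : 0 < lam by rewrite lam_gt0.
rewrite ratioE; apply: le_trans (_ : s h / (2 * h * c h) <= _); last first.
  by rewrite lerDl divr_ge0 ?sqr_ge0// mulr_ge0 ?sqr_ge0.
have sE : s h = beta * c h / (2 * lam) by rewrite E; field; rewrite gt_eqF.
have -> : s h / (2 * h * c h) = beta / (4 * h * lam).
  by rewrite sE; field; rewrite !gt_eqF.
rewrite ler_pdivlMr ?mulr_gt0// mulrAC ler_pdivrMr ?exprn_gt0 ?pi_gt0//.
have -> : beta * h * (4 * h * lam) = beta * (lam * d ^+ 2) by field.
by rewrite ler_pM2l// ltW// -ltr_pdivlMr ?exprn_gt0// -expr_div_n.
Qed.

(** Bounds the second summand of [ratioE]. Taylor's inequality S >= h + |lam| h^3 / 6 with |lam| >=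
    beta^2 / 4 gives S >= beta^2 h^3 / 24; multiplied by S >= h and divided by 2 h^2 this yields the
    constant 48. *)
Lemma ratio_ge_neg : beta < 0 -> (beta * h) ^+ 2 / 48 <= ratio d c s.
Proof.
move=> b0; have l0 : lam < 0 by rewrite lam_lt0.
have ln : 0 < - lam by rewrite oppr_gt0.
have c_ge1 x : 0 <= x <= h -> 1 <= c x.
  move=> /andP[x0 xh]; have [z /andP[z0 zx]] := MVT_le x0 Dc; rewrite c0 subr0 => e.
  rewrite -subr_ge0 e mulr_ge0// -mulNr mulr_ge0// ?(ltW ln)//.
  by have /andP[] : 0 <= s z <= s h by apply: s_increasing; rewrite z0 (le_trans zx).
have mono (f g : R -> R) : (forall x : R, is_derive x 1 f (g x)) ->
    (forall x, 0 <= x <= h -> 0 <= g x) -> forall x, 0 <= x <= h -> f 0 <= f x.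
  move=> fg g0 x /andP[x0 xh]; have [z /andP[z0 zx] e] := MVT_le x0 fg.
  by rewrite -subr_ge0 e mulr_ge0 ?subr_ge0// g0// z0 (le_trans zx).
have s_ge x : 0 <= x <= h -> x <= s x.
  move=> xh; have := mono _ _ (fun x => is_derive1B (Ds x) (is_derive_id x 1)) _ x xh.
  rewrite s0 subr0 subr_ge0; apply => y yh; by rewrite subr_ge0 c_ge1.
have Dpow n (x : R) : is_derive x 1 (fun t : R => t ^+ n.+1) (n.+1%:R * x ^+ n).
  apply: (trigger_derive (is_derive1X n.+1 (is_derive_id x 1))); by rewrite /= mulr1.
have c_ge x : 0 <= x <= h -> 1 - lam / 2 * x ^+ 2 <= c x.
  move=> xh; have := mono _ _ (fun x => is_derive1B (Dc x) (is_derive1_scale (- lam / 2) (Dpow 1 x))) _ x xh.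
  rewrite /= c0 expr0n/= mulr0 subr0 => H; have : 1 <= c x - - lam / 2 * x ^+ 2; last by lra.
  apply: H => y yh; have -> : - (lam * s y) - - lam / 2 * (2 * y ^+ 1) = - lam * (s y - y) by field.
  by rewrite mulr_ge0 ?(ltW ln)// subr_ge0 s_ge.
have s_ge3 : h - lam / 6 * h ^+ 3 <= s h.
  have hh : 0 <= h <= h by rewrite lexx ltW.
  have := mono _ _ (fun x => is_derive1B (is_derive1B (Ds x) (is_derive_id x 1)) (is_derive1_scale (- lam / 6) (Dpow 2 x))) _ h hh.
  rewrite /= s0 expr0n/= mulr0 !subr0 => H.
  have : 0 <= s h - h - - lam / 6 * h ^+ 3; last by lra.
  apply: H => y yh.
  have -> : c y - 1 - - lam / 6 * (3 * y ^+ 2) = c y - (1 - lam / 2 * y ^+ 2) by field.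
  by rewrite subr_ge0 c_ge.
have W := fundamental_wronskian F h.
(* By the level equation and the Wronskian relation, - beta S C = - 2 lam S^2 = 2 C^2 - 2. *)
have bC : - beta * s h <= 2 * c h.
  rewrite -(ler_pM2r C0); have -> : - beta * s h * c h = - (beta * c h) * s h by ring.
  by rewrite E; lra.
(* The level of the comb lies at or below - beta^2 / 4, the eigenvalue of a single attractive delta
   interaction. *)
have lb : beta ^+ 2 / 4 <= - lam.
  rewrite -(ler_pM2r S0); have -> : - lam * s h = - beta * c h / 2.
    by rewrite !mulNr E; field.
  have : - beta * (- beta * s h) <= - beta * (2 * c h) by rewrite ler_wpM2l// oppr_ge0 ltW.
  by move=> H; lra.
rewrite ratioE; apply: le_trans (_ : s h ^+ 2 / (2 * h ^+ 2) <= _); last first.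
  by rewrite lerDr divr_ge0 ?(ltW S0)// !mulr_ge0// ltW.
rewrite ler_pdivlMr ?mulr_gt0 ?exprn_gt0//.
have h3 : 0 < h ^+ 3 by rewrite exprn_gt0.
have h1 := h0.
have t1 : beta ^+ 2 / 24 * h ^+ 3 <= s h.
  move: h3 s_ge3; set k := h ^+ 3 => h3 s_ge3.
  have : beta ^+ 2 / 4 * k <= - lam * k by rewrite ler_pM2r.
  by move=> H; lra.
have t2 : h <= s h by apply: s_ge; rewrite lexx ltW.
apply: le_trans (_ : (beta ^+ 2 / 24 * h ^+ 3) * h <= _).
  by rewrite le_eqVlt; apply/orP; left; apply/eqP; field.
rewrite expr2; apply: ler_pM => //; last exact: ltW.
by rewrite mulr_ge0 ?divr_ge0 ?sqr_ge0// ltW.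
Qed.

End RatioBounds.

(** * Limits of the critical flux *)

Section CriticalFlux.
Context {R : realType}.
Context (d : R) (d0 : 0 < d).
Implicit Types (beta q e : R).

(** Hides the level and the solutions behind one number q, whose four bounds are all that the limits
    use. *)
Lemma alpha_crit_ratio beta : beta != 0 -> exists q, [/\ 1 < q,
  alpha_crit d beta = Num.sqrt (4^-1 * (1 - q^-1)),
  `|beta| * (d / 2) <= 1 -> q <= 1 + 2 * (`|beta| * (d / 2)),
  0 < beta -> beta * (d / 2) / pi ^+ 2 <= q &
  beta < 0 -> (beta * (d / 2)) ^+ 2 / 48 <= q].
Proof.
move=> b0; have [lam [c [s [F lt E]]]] := ground_level d0 b0.
exists (ratio d c s); split.
- exact: (ratio_gt1 d0 F E).
- exact: (alpha_critE d0 F lt E).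
- exact: (ratio_le d0 F E).
- by move=> bp; exact: (ratio_ge_pos d0 F E bp lt).
- exact: (ratio_ge_neg d0 F E).
Qed.

Lemma sqrt_flux_bounds q : 1 < q ->
  0 < Num.sqrt (4^-1 * (1 - q^-1)) < 2^-1.
Proof.
move=> q1; have q0 : 0 < q by rewrite (lt_trans _ q1).
have qi : 0 < q^-1 < 1 by rewrite invr_gt0 q0/= invf_lt1.
have [qi0 qi1] := andP qi.
rewrite sqrtr_gt0; apply/andP; split; first by rewrite mulr_gt0// subr_gt0.
rewrite -(@ltr_pXn2r _ 2) ?nnegrE ?sqrtr_ge0// sqr_sqrtr; last by rewrite mulr_ge0// subr_ge0 ltW.
by rewrite expr2; lra.
Qed.

(** Since q > 1, one has 1 - 1 / q < q - 1 < 4 e^2. *)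
Lemma sqrt_flux_lt q e : 1 < q -> 0 < e -> q < 1 + 4 * e ^+ 2 ->
  Num.sqrt (4^-1 * (1 - q^-1)) < e.
Proof.
move=> q1 e0 qe; have q0 : 0 < q by rewrite (lt_trans _ q1).
have qi : q^-1 < 1 by rewrite invf_lt1.
rewrite -(@ltr_pXn2r _ 2) ?nnegrE ?sqrtr_ge0 ?(ltW e0)// sqr_sqrtr; last by rewrite mulr_ge0// subr_ge0 ltW.
have : (1 - q^-1) * q < 4 * e ^+ 2 * q.
  rewrite mulrBl mul1r mulVf ?gt_eqF//; apply: lt_trans (_ : 4 * e ^+ 2 < _); first by lra.
  by rewrite ltr_pMr// mulr_gt0// exprn_gt0.
by rewrite ltr_pM2r// => H; lra.
Qed.

(* For 0 < x < 1/2 one has x > 2 x^2. *)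
Lemma sqrt_flux_gt q e : 1 < q -> 0 < e -> (2 * e)^-1 < q ->
  2^-1 - e < Num.sqrt (4^-1 * (1 - q^-1)).
Proof.
move=> q1 e0 qe; have q0 : 0 < q by rewrite (lt_trans _ q1).
have /andP[x0 x1] := sqrt_flux_bounds q1.
have qi : q^-1 < 1 by rewrite invf_lt1.
have : Num.sqrt (4^-1 * (1 - q^-1)) ^+ 2 = 4^-1 * (1 - q^-1).
  by rewrite sqr_sqrtr// mulr_ge0// subr_ge0 ltW.
move: (Num.sqrt _) x0 x1 => x x0 x1 E.
have : q^-1 < 2 * e by rewrite invf_plt// posrE mulr_gt0.
have : x * x < x * 2^-1 by rewrite ltr_pM2l.
by rewrite -expr2 E => H1 H2; lra.
Qed.

(** The left filter at 1/2 contains only points strictly below 1/2, so the strict upper bound enters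
    along with the lower estimate. *)
Lemma flux_cvg_half (G : set_system R) : Filter G ->
  (forall beta, beta != 0 -> 0 < alpha_crit d beta < 2^-1) ->
  (forall e, 0 < e -> \forall beta \near G, beta != 0 /\ 2^-1 - e < alpha_crit d beta) ->
  alpha_crit d beta @[beta --> G] --> (2^-1 : R)^'-.
Proof.
move=> FG bnd H A [e /= e0 He]; have := H e e0; apply: filterS => beta [b0 ab].
have /andP[_ lt] := bnd beta b0.
by apply: He => //=; rewrite gtr0_norm ?subr_gt0//; lra.
Qed.

(** A general filter covers both infinities; the sign of beta decides which of the two conditional
    lower bounds on q becomes available. *)
Lemma alpha_crit_cvg_half (G : set_system R) : Filter G ->
  (forall M, \forall beta \near G, beta != 0 /\ forall q,
     (0 < beta -> beta * (d / 2) / pi ^+ 2 <= q) ->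
     (beta < 0 -> (beta * (d / 2)) ^+ 2 / 48 <= q) -> M < q) ->
  alpha_crit d beta @[beta --> G] --> (2^-1 : R)^'-.
Proof.
move=> FG H; apply: flux_cvg_half => [beta b0|e e0].
  by have [q [q1 -> _ _ _]] := alpha_crit_ratio b0; exact: sqrt_flux_bounds.
have := H (2 * e)^-1; apply: filterS => beta [b0 Hq]; split=> //.
by have [q [q1 -> _ q2 q3]] := alpha_crit_ratio b0; apply: sqrt_flux_gt => //; exact: Hq.
Qed.

End CriticalFlux.

Theorem mainTheorem2 (R : realType) (d : R) (hd : 0 < d) :
  (forall beta : R, beta != 0 -> 0 < alpha_crit d beta < 2^-1) /\
  [/\ alpha_crit d beta @[beta --> +oo] --> (2^-1)^'-,
      alpha_crit d beta @[beta --> -oo] --> (2^-1)^'- &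
      alpha_crit d beta @[beta --> 0^'] --> 0^'+].
Proof.
have h0 : 0 < d / 2 by rewrite divr_gt0.
have bnd (beta : R) : beta != 0 -> 0 < alpha_crit d beta < 2^-1.
  by move=> b0; have [q [q1 -> _ _ _]] := alpha_crit_ratio hd b0; exact: sqrt_flux_bounds.
split; first exact: bnd.
split.
- apply: alpha_crit_cvg_half => // M.
  near=> beta.
  have b0 : 0 < beta by near: beta; apply: nbhs_pinfty_gt; exact: num_real.
  split; first by rewrite gt_eqF.
  move=> q /(_ b0) + _; apply: lt_le_trans.
  rewrite ltr_pdivlMr ?exprn_gt0 ?pi_gt0// -ltr_pdivrMr//.
  by near: beta; apply: nbhs_pinfty_gt; exact: num_real.
- apply: alpha_crit_cvg_half => // M.
  near=> beta.
  have b0 : beta < 0 by near: beta; apply: nbhs_ninfty_lt; exact: num_real.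
  split; first by rewrite lt_eqF.
  move=> q _ /(_ b0); apply: lt_le_trans.
  rewrite ltr_pdivlMr// exprMn.
  (* For beta < -1 one has beta^2 >= - beta, so a threshold linear in beta suffices. *)
  have b1 : beta < - 1 by near: beta; apply: nbhs_ninfty_lt; exact: num_real.
  have b2 : beta < - (M * 48 / (d / 2) ^+ 2) by near: beta; apply: nbhs_ninfty_lt; exact: num_real.
  rewrite -ltr_pdivrMr ?exprn_gt0//.
  have : 1 * - beta <= beta ^+ 2 by rewrite -sqrrN expr2 ler_pM2r ?oppr_gt0//; lra.
  by apply: lt_le_trans; lra.
- move=> A [e /= e0 He].
  suff H : \forall beta \near (0 : R)^', A (alpha_crit d beta) by exact: H.
  near=> beta.
  have b0 : beta != 0 by near: beta; exact: nbhs_dnbhs_neq.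
  have /andP[a0 _] := bnd beta b0.
  apply: He => //=; rewrite sub0r normrN gtr0_norm//.
  have [q [q1 -> q2 _ _]] := alpha_crit_ratio hd b0.
  apply: sqrt_flux_lt => //.
  have b1 : `|beta| * (d / 2) < 1.
    by rewrite -ltr_pdivlMr//; near: beta; apply: dnbhs0_lt; rewrite divr_gt0.
  (* This gives q < 1 + 2 e^2, within the 1 + 4 e^2 required by [sqrt_flux_lt]. *)
  have b2 : `|beta| * (d / 2) < e ^+ 2.
    by rewrite -ltr_pdivlMr//; near: beta; apply: dnbhs0_lt; rewrite divr_gt0// exprn_gt0.
  apply: le_lt_trans (q2 (ltW b1)) _.
  have : 0 < e ^+ 2 by rewrite exprn_gt0.
  by move=> H; lra.
Unshelve. all: by end_near. Qed.
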